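(* For every $r$ with $0<r<1$, $$W_r=\left\{\frac{2u}{v(u+v)}: u,v\in\mathbb C,\ |u-1|\le r,\ |v-1|\le r\right\}.$$
   Context: $\mathbb D=\{z\in\mathbb C:|z|<1\}$. An analytic function $g$ on $\mathbb D$ with $g(0)=g'(0)-1=0$ is called convex if it is univalent and $g(\mathbb D)$ is a convex set. $\mathcal C$ denotes the class of close-to-convex functions, that is, analytic functions $f$ on $\mathbb D$ with $f(0)=f'(0)-1=0$ such that $\operatorname{Re}[e^{i\lambda}f'(z)/g'(z)]>0$ for all $z\in\mathbb D$, for some convex function $g$ (normalized by $g(0)=g'(0)-1=0$) and some real constant $\lambda$ with $|\lambda|<\pi/2$. Every $f\in\mathcal C$ is univalent, so $f(z)\neq0$ for $0<|z|<1$. For $0<r<1$, $W_r=\{rf'(r)/f(r): f\in\mathcal C\}$. *)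

(* Defs.v *)
From Stdlib Require Import Reals.
From Coquelicot Require Import Coquelicot.

Open Scope R_scope.
Open Scope C_scope.

Definition unit_disk (z : C) : Prop := (Cmod z < 1)%R.

(* [f : C -> C] is total; only its values on the open set [unit_disk] matter.
   At every point where [ex_derive] holds, [C_derive f z] is the complex
   derivative (Coquelicot's [C_derive_correct]). *)
Definition analytic_on_disk (f : C -> C) : Prop :=
  forall z : C, unit_disk z -> @ex_derive C_AbsRing C_NormedModule f z.

Definition normalized (f : C -> C) : Prop :=
  f 0 = 0 /\ C_derive f 0 - 1 = 0.

Definition univalent_on_disk (f : C -> C) : Prop :=
  forall z w : C, unit_disk z -> unit_disk w -> f z = f w -> z = w.

Definition image_of_disk (f : C -> C) (w : C) : Prop :=
  exists z : C, unit_disk z /\ f z = w.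

Definition convex_set (A : C -> Prop) : Prop :=
  forall (a b : C) (t : R), A a -> A b -> (0 <= t <= 1)%R ->
    A (RtoC (1 - t) * a + RtoC t * b).

Definition convex_function (g : C -> C) : Prop :=
  analytic_on_disk g /\ normalized g /\
  univalent_on_disk g /\ convex_set (image_of_disk g).

Definition expi (lambda : R) : C := (cos lambda, sin lambda).

(* Division in [C] is total, but [C_derive g] has no zero on the disk when
   [g] is convex, since [g] is analytic and univalent there. *)
Definition close_to_convex (f : C -> C) : Prop :=
  analytic_on_disk f /\ normalized f /\
  exists (g : C -> C) (lambda : R),
    convex_function g /\ (Rabs lambda < PI / 2)%R /\
    forall z : C, unit_disk z ->
      (Re (expi lambda * (C_derive f z / C_derive g z)) > 0)%R.

(* For [0 < r < 1] the denominator is nonzero because a close-to-convex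
   function is univalent and vanishes at the origin. *)
Definition W (r : R) (w : C) : Prop :=
  exists f : C -> C, close_to_convex f /\
    w = RtoC r * C_derive f (RtoC r) / f (RtoC r).

(* Main.v *)
Require Import Defs.
From Stdlib Require Import Reals Lra ClassicalEpsilon.
From Coquelicot Require Import Coquelicot.

Open Scope R_scope.
Open Scope C_scope.

(** Let [f] be close-to-convex with respect to [g] and put
    [omega = f(r) / (r f'(r))] and
    [L phi = omega phi(1) - (integral of phi over [0, 1])].  By the fundamental
    theorem of calculus [L] vanishes on [t |-> f'(r t)].  On the other hand
    [L ((1 - a t) / (1 - b t)^3) = (2 omega u - u v - v^2) / (2 v^3)] with
    [u = 1 - a], [v = 1 - b].  If [1 / omega] were not in the region, this
    would not vanish for [a], [b] in a disc of some radius [s > r].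

    This non-vanishing is carried over to [L (f'(r t))] by replacing the three
    factors [1 / (1 - b t)], one at a time, by [sqrt g'], [sqrt g'] and
    [p = f'/g'], on slightly smaller discs.  For a weight [k] let
    [R(eta) = L (k / (1 - eta t)) / L k].  If [Re R > 1/2] on a circle, then
    [L (k F) / L k] is, by Cauchy's formula, a mean of the values of [F] on a
    circle with the positive weight [2 Re R - 1], so it does not vanish when
    [F] has values in a half-plane through the origin.  This is so for [F = p],
    and for [F = (1 - a t) sqrt (g'(r t))] because
    [Re (1 + z g''/g') >= 0] bounds the variation of its argument on circles.
    The inequality [Re R > 1/2] is first proved for pole and [eta] on a common
    circle: there [Re R - 1/2] has the sign of the integral over an arc of a
    function with the sign of the sine of an angle that increases by [2 PI]
    along the circle, its full integral being zero; the minimum principle then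
    gives it for poles inside the disc.

    Conversely the functions [(z - (x + y) z^2 / 2) / (1 - y z)^2] with
    [|x|, |y| <= 1] are close-to-convex relative to [z / (1 - y z)] and fill
    the region. *)

(** * Differentiation along an embedding *)

(** Non-vanishing of [L] is not a convex condition, so representing the functions by averages of
    model functions would not give it; this is why the factors are exchanged one at a time. Each
    exchange carries a linear factor [1 - a t]: for a weight [h], the statement that
    [L (h (1 - a t))] has no zero for [|a| < s] amounts to [|L h| >= s |L (h t)|] with [L h <> 0],
    and this is the source of the constant 1/2. The square root is forced twice. For the model
    [g = z / (1 - b z)] it is [sqrt g'] that equals one simple factor [1 / (1 - b z)], and it is the
    halved argument of [g'] that, combined with that of [1 - a z], stays within an open half-plane.
    The contours have radius [1 / sg > 1], and [t |-> g'(r t)] is holomorphic only for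
    [|t| < 1 / r]; hence every radius must exceed [r], and the closed discs of radius [r] are
    reached by compactness at the end. The convexity of [g] acts through [Re (1 + z g''/g') >= 0],
    which rests on subordination and the Schwarz lemma; the complex analysis is built up from
    Goursat's theorem. *)

(** The map [i] embeds the domain into the plane: the identity gives complex differentiability,
    [RtoC] gives derivatives of complex-valued functions of a real variable. The sum, product,
    quotient and chain rules are thus proved once for both. *)
Definition gder {X : Type} (i : X -> C) (f : X -> C) (x : X) (l : C) : Prop :=
  forall eps : R, (0 < eps)%R -> exists delta : R, (0 < delta)%R /\
    forall y : X, (Cmod (i y - i x) < delta)%R ->
      (Cmod (f y - f x - (i y - i x) * l) <= eps * Cmod (i y - i x))%R.

Notation cder := (gder (fun z : C => z)).
Notation rder := (gder RtoC).

Lemma Cmod_sub_sym (a b : C) : Cmod (a - b) = Cmod (b - a).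
Proof. rewrite <- Cmod_opp. f_equal. ring. Qed.

Lemma Cmod_triangle_sub (a b : C) : (Cmod (a - b) <= Cmod a + Cmod b)%R.
Proof. unfold Cminus. rewrite <- (Cmod_opp b). apply Cmod_triangle. Qed.

Lemma Cmod_triangle_inv (a b : C) : (Cmod a - Cmod b <= Cmod (a - b))%R.
Proof.
  pose proof (Cmod_triangle (a - b) b) as H.
  replace (a - b + b) with a in H by ring. lra.
Qed.

Lemma cder_is_derive (f : C -> C) (z l : C) :
  cder f z l -> @is_derive C_AbsRing C_NormedModule f z l.
Proof.
  intros H. split.
  { apply is_linear_scal_l. }
  intros x Hx.
  assert (Exz : x = z).
  { symmetry. apply is_filter_lim_locally_unique. exact Hx. }
  subst x. intros eps. destruct (H eps (cond_pos eps)) as [d [Hd Hf]].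
  exists (mkposreal d Hd). intros y Hy. exact (Hf y Hy).
Qed.

Lemma is_derive_cder (f : C -> C) (z l : C) :
  @is_derive C_AbsRing C_NormedModule f z l -> cder f z l.
Proof.
  intros [_ H] eps Heps.
  destruct (H z (fun P HP => HP) (mkposreal eps Heps)) as [d Hd].
  exists d. split; [apply cond_pos|]. intros y Hy. exact (Hd y Hy).
Qed.

(** The link to the fundamental theorem of calculus, which is applied to functions with values in
    the real normed module [C_R_NormedModule]. *)
Lemma rder_is_derive (f : R -> C) (x : R) (l : C) :
  rder f x l -> @is_derive R_AbsRing C_R_NormedModule f x l.
Proof.
  intros H. split.
  { apply is_linear_scal_l. }
  intros x' Hx.
  assert (Exz : x' = x).
  { symmetry. apply is_filter_lim_locally_unique. exact Hx. }
  subst x'. intros eps. destruct (H eps (cond_pos eps)) as [d [Hd Hf]].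
  exists (mkposreal d Hd). intros y Hy.
  specialize (Hf y).
  assert (E : Cmod (RtoC y - RtoC x) = Rabs (y - x)).
  { rewrite <- RtoC_minus. apply Cmod_R. }
  rewrite E in Hf. specialize (Hf Hy).
  match goal with |- (norm ?u <= _)%R =>
    assert (Eu : u = f y - f x - (RtoC y - RtoC x) * l) end.
  { apply injective_projections; unfold minus, plus, opp, scal; simpl;
    unfold plus, opp, scal, mult; simpl; unfold mult; simpl; ring. }
  rewrite Eu. rewrite Cmod_norm in Hf. exact Hf.
Qed.

Lemma gder_ext {X} (i f g : X -> C) x l :
  (forall y, f y = g y) -> gder i f x l -> gder i g x l.
Proof.
  intros E H eps He. destruct (H eps He) as [d [Hd Hf]].
  exists d. split; [exact Hd|]. intros y Hy. rewrite <- !E. auto.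
Qed.

Lemma gder_ext_loc {X} (i f g : X -> C) x l (d0 : R) :
  (0 < d0)%R -> (forall y, (Cmod (i y - i x) < d0)%R -> f y = g y) ->
  gder i f x l -> gder i g x l.
Proof.
  intros H0 E H eps He. destruct (H eps He) as [d [Hd Hf]].
  exists (Rmin d d0). split; [apply Rmin_glb_lt; auto|]. intros y Hy.
  rewrite <- !E.
  - apply Hf. eapply Rlt_le_trans; [exact Hy | apply Rmin_l].
  - unfold Cminus. rewrite Cplus_opp_r, Cmod_0. exact H0.
  - eapply Rlt_le_trans; [exact Hy | apply Rmin_r].
Qed.

Lemma gder_const {X} (i : X -> C) (c : C) x : gder i (fun _ => c) x 0.
Proof.
  intros eps He. exists 1%R. split; [lra|]. intros y _.
  replace (c - c - (i y - i x) * 0) with (RtoC 0) by ring.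
  rewrite Cmod_0. apply Rmult_le_pos; [lra | apply Cmod_ge_0].
Qed.

Lemma gder_id {X} (i : X -> C) x : gder i i x 1.
Proof.
  intros eps He. exists 1%R. split; [lra|]. intros y _.
  replace (i y - i x - (i y - i x) * 1) with (RtoC 0) by ring.
  rewrite Cmod_0. apply Rmult_le_pos; [lra | apply Cmod_ge_0].
Qed.

Lemma gder_lipschitz {X} (i f : X -> C) x l : gder i f x l ->
  exists delta M : R, (0 < delta)%R /\ (0 < M)%R /\
    forall y, (Cmod (i y - i x) < delta)%R ->
      (Cmod (f y - f x) <= M * Cmod (i y - i x))%R.
Proof.
  intros H. destruct (H 1%R Rlt_0_1) as [d [Hd Hf]].
  exists d, (Cmod l + 1)%R. pose proof (Cmod_ge_0 l).
  split; [exact Hd|]. split; [lra|]. intros y Hy.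
  specialize (Hf y Hy).
  replace (f y - f x) with ((f y - f x - (i y - i x) * l) + (i y - i x) * l) by ring.
  eapply Rle_trans; [apply Cmod_triangle|]. rewrite Cmod_mult. lra.
Qed.

Lemma gder_cont {X} (i f : X -> C) x l : gder i f x l ->
  forall eps, (0 < eps)%R -> exists delta, (0 < delta)%R /\
    forall y, (Cmod (i y - i x) < delta)%R -> (Cmod (f y - f x) < eps)%R.
Proof.
  intros H eps He. destruct (gder_lipschitz i f x l H) as [d [M [Hd [HM Hf]]]].
  exists (Rmin d (eps / (M + 1))). split.
  { apply Rmin_glb_lt; auto. apply Rdiv_lt_0_compat; lra. }
  intros y Hy.
  assert (H1 : (Cmod (i y - i x) < d)%R) by (eapply Rlt_le_trans; [exact Hy | apply Rmin_l]).
  assert (H2 : (Cmod (i y - i x) < eps / (M + 1))%R) by (eapply Rlt_le_trans; [exact Hy | apply Rmin_r]).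
  eapply Rle_lt_trans; [apply Hf, H1|].
  apply Rmult_lt_compat_r with (r := (M + 1)%R) in H2; [|lra].
  unfold Rdiv in H2. rewrite Rmult_assoc, Rinv_l, Rmult_1_r in H2 by lra.
  pose proof (Cmod_ge_0 (i y - i x)). nra.
Qed.

Lemma gder_comp {X} (i f : X -> C) (F : C -> C) x l m :
  gder i f x l -> cder F (f x) m -> gder i (fun y => F (f y)) x (m * l).
Proof.
  intros Hf HF eps He.
  destruct (gder_lipschitz i f x l Hf) as [d1 [M [Hd1 [HM Hl]]]].
  assert (Hm : (0 < Cmod m + 1)%R) by (pose proof (Cmod_ge_0 m); lra).
  destruct (Hf (eps / (2 * (Cmod m + 1)))%R) as [d2 [Hd2 Hf2]].
  { apply Rdiv_lt_0_compat; lra. }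
  destruct (HF (eps / (2 * M))%R) as [d3 [Hd3 HF3]].
  { apply Rdiv_lt_0_compat; lra. }
  destruct (gder_cont i f x l Hf d3 Hd3) as [d4 [Hd4 Hc]].
  exists (Rmin d1 (Rmin d2 d4)). split.
  { repeat apply Rmin_glb_lt; auto. }
  intros y Hy.
  assert (H1 : (Cmod (i y - i x) < d1)%R) by (eapply Rlt_le_trans; [exact Hy | apply Rmin_l]).
  assert (H24 : (Cmod (i y - i x) < Rmin d2 d4)%R) by (eapply Rlt_le_trans; [exact Hy | apply Rmin_r]).
  assert (H2 : (Cmod (i y - i x) < d2)%R) by (eapply Rlt_le_trans; [exact H24 | apply Rmin_l]).
  assert (H4 : (Cmod (i y - i x) < d4)%R) by (eapply Rlt_le_trans; [exact H24 | apply Rmin_r]).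
  specialize (Hl y H1). specialize (Hf2 y H2). specialize (HF3 (f y) (Hc y H4)).
  replace (F (f y) - F (f x) - (i y - i x) * (m * l)) with
    ((F (f y) - F (f x) - (f y - f x) * m) + m * (f y - f x - (i y - i x) * l)) by ring.
  eapply Rle_trans; [apply Cmod_triangle|]. rewrite Cmod_mult.
  pose proof (Cmod_ge_0 (i y - i x)) as Hi. pose proof (Cmod_ge_0 m) as Hm0.
  assert (T1 : (eps / (2 * M) * Cmod (f y - f x) <= eps / 2 * Cmod (i y - i x))%R).
  { replace (eps / 2 * Cmod (i y - i x))%R with
      (eps / (2 * M) * (M * Cmod (i y - i x)))%R by (field; lra).
    apply Rmult_le_compat_l; [|exact Hl]. apply Rlt_le, Rdiv_lt_0_compat; lra. }
  assert (T2 : (Cmod m * Cmod (f y - f x - (i y - i x) * l) <= eps / 2 * Cmod (i y - i x))%R).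
  { apply Rle_trans with ((Cmod m + 1) * (eps / (2 * (Cmod m + 1)) * Cmod (i y - i x)))%R.
    - apply Rmult_le_compat; auto; try lra. apply Cmod_ge_0.
    - right. field. lra. }
  lra.
Qed.

Lemma gder_plus {X} (i f g : X -> C) x l m :
  gder i f x l -> gder i g x m -> gder i (fun y => f y + g y) x (l + m).
Proof.
  intros Hf Hg eps He.
  destruct (Hf (eps / 2)%R) as [d1 [Hd1 H1]]; [lra|].
  destruct (Hg (eps / 2)%R) as [d2 [Hd2 H2]]; [lra|].
  exists (Rmin d1 d2). split; [apply Rmin_glb_lt; auto|]. intros y Hy.
  specialize (H1 y (Rlt_le_trans _ _ _ Hy (Rmin_l _ _))).
  specialize (H2 y (Rlt_le_trans _ _ _ Hy (Rmin_r _ _))).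
  replace (f y + g y - (f x + g x) - (i y - i x) * (l + m)) with
   ((f y - f x - (i y - i x) * l) + (g y - g x - (i y - i x) * m)) by ring.
  eapply Rle_trans; [apply Cmod_triangle|]. lra.
Qed.

Lemma cder_sqr (z : C) : cder (fun w => w * w) z (2 * z).
Proof.
  intros eps He. exists eps. split; [exact He|]. intros y Hy.
  replace (y * y - z * z - (y - z) * (2 * z)) with ((y - z) * (y - z)).
  2:{ apply injective_projections; simpl; ring. }
  rewrite Cmod_mult. apply Rmult_le_compat_r; [apply Cmod_ge_0 | lra].
Qed.

Lemma cder_scal (c z : C) : cder (fun w => c * w) z c.
Proof.
  intros eps He. exists 1%R. split; [lra|]. intros y _.
  replace (c * y - c * z - (y - z) * c) with (RtoC 0) by ring.
  rewrite Cmod_0. apply Rmult_le_pos; [lra | apply Cmod_ge_0].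
Qed.

Lemma gder_scal {X} (i f : X -> C) x l c :
  gder i f x l -> gder i (fun y => c * f y) x (c * l).
Proof. intros H. exact (gder_comp i f (fun w => c * w) x l c H (cder_scal c (f x))). Qed.

Lemma gder_eq {X} (i f : X -> C) x l m : l = m -> gder i f x l -> gder i f x m.
Proof. intros <-. auto. Qed.

Lemma gder_minus {X} (i f g : X -> C) x l m :
  gder i f x l -> gder i g x m -> gder i (fun y => f y - g y) x (l - m).
Proof.
  intros Hf Hg.
  apply gder_ext with (f := fun y => f y + (-(1)) * g y); [intros; ring|].
  apply gder_eq with (l + (-(1)) * m); [ring|].
  apply gder_plus; [exact Hf | apply gder_scal; exact Hg].
Qed.

(* Polarization: [f g = ((f + g)^2 - (f - g)^2) / 4]. *)
Lemma gder_mult {X} (i f g : X -> C) x l m :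
  gder i f x l -> gder i g x m -> gder i (fun y => f y * g y) x (l * g x + f x * m).
Proof.
  intros Hf Hg.
  pose proof (gder_comp _ _ _ _ _ _ (gder_plus _ _ _ _ _ _ Hf Hg) (cder_sqr _)) as H1.
  pose proof (gder_comp _ _ _ _ _ _ (gder_minus _ _ _ _ _ _ Hf Hg) (cder_sqr _)) as H2.
  pose proof (gder_scal _ _ _ _ (RtoC (/4)) (gder_minus _ _ _ _ _ _ H1 H2)) as H3.
  simpl in H3.
  eapply gder_eq; [|eapply gder_ext; [|exact H3]].
  - apply injective_projections; simpl; field.
  - intros y. apply injective_projections; simpl; field.
Qed.

Lemma cder_inv (z : C) : z <> 0 -> cder (fun w => / w) z (- / (z * z)).
Proof.
  intros Hz eps He.
  assert (Hp : (0 < Cmod z)%R) by (apply Cmod_gt_0; exact Hz).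
  set (m := Cmod z) in *.
  (* The first bound keeps [|y| > m / 2]; the second then makes [|y - z| / (|y| m^2)] at most
     [eps]. *)
  exists (Rmin (m / 2) (eps * (m * m * m) / 2)). split.
  { apply Rmin_glb_lt; [lra|]. apply Rmult_lt_0_compat; [|lra].
    repeat apply Rmult_lt_0_compat; auto. }
  intros y Hy.
  assert (H1 : (Cmod (y - z) < m / 2)%R) by (eapply Rlt_le_trans; [exact Hy | apply Rmin_l]).
  assert (H2 : (Cmod (y - z) < eps * (m * m * m) / 2)%R) by (eapply Rlt_le_trans; [exact Hy | apply Rmin_r]).
  assert (Hym : (m / 2 < Cmod y)%R).
  { pose proof (Cmod_triangle_inv z y). rewrite Cmod_sub_sym in H1. fold m in H. lra. }
  assert (Hy0 : y <> 0) by (apply Cmod_gt_0; lra).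
  replace (/ y - / z - (y - z) * - / (z * z)) with ((y - z) * ((y - z) / (y * (z * z)))).
  2:{ field. split; assumption. }
  rewrite Cmod_mult, Rmult_comm. apply Rmult_le_compat_r; [apply Cmod_ge_0|].
  rewrite Cmod_div.
  2:{ apply Cmult_neq_0; [|apply Cmult_neq_0]; assumption. }
  rewrite !Cmod_mult. fold m.
  apply Rmult_le_reg_r with (Cmod y * (m * m))%R.
  { repeat apply Rmult_lt_0_compat; lra. }
  unfold Rdiv. rewrite Rmult_assoc, Rinv_l, Rmult_1_r.
  2:{ apply Rgt_not_eq. repeat apply Rmult_lt_0_compat; lra. }
  assert (eps * (m / 2 * (m * m)) <= eps * (Cmod y * (m * m)))%R.
  { apply Rmult_le_compat_l; [lra|]. apply Rmult_le_compat_r; [nra|lra]. }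
  lra.
Qed.

Lemma gder_inv {X} (i f : X -> C) x l : f x <> 0 ->
  gder i f x l -> gder i (fun y => / f y) x (- l / (f x * f x)).
Proof.
  intros H0 Hf. eapply gder_eq; [|exact (gder_comp _ _ _ _ _ _ Hf (cder_inv _ H0))].
  field. exact H0.
Qed.

Lemma gder_div {X} (i f g : X -> C) x l m : g x <> 0 ->
  gder i f x l -> gder i g x m ->
  gder i (fun y => f y / g y) x ((l * g x - f x * m) / (g x * g x)).
Proof.
  intros H0 Hf Hg. eapply gder_eq; [|exact (gder_mult _ _ _ _ _ _ Hf (gder_inv _ _ _ _ H0 Hg))].
  simpl. field. exact H0.
Qed.

Lemma gder_pair (f g : R -> R) x l m :
  is_derive f x l -> is_derive g x m ->
  rder (fun t => (f t, g t)) x (l, m).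
Proof.
  intros Hf Hg.
  assert (K : forall (f : R -> R) l, is_derive f x l -> rder (fun t => RtoC (f t)) x (RtoC l)).
  { intros h k [_ H] eps Heps.
    destruct (H x (fun P HP => HP) (mkposreal eps Heps)) as [d Hd].
    exists d. split; [apply cond_pos|]. intros y Hy.
    rewrite <- !RtoC_minus, <- RtoC_mult, <- RtoC_minus, !Cmod_R in *.
    exact (Hd y Hy). }
  eapply gder_eq; [|eapply gder_ext; [|exact (gder_plus _ _ _ _ _ _ (K f l Hf) (gder_scal _ _ _ _ Ci (K g m Hg)))]].
  - apply injective_projections; simpl; ring.
  - intros y. apply injective_projections; simpl; ring.
Qed.

Lemma rder_expi t : rder expi t (Ci * expi t).
Proof.
  eapply gder_eq; [|apply gder_pair; [apply is_derive_cos | apply is_derive_sin]].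
  apply injective_projections; simpl; ring.
Qed.

Lemma Cmod_expi t : Cmod (expi t) = 1%R.
Proof.
  unfold Cmod, expi; simpl. transitivity (sqrt 1)%R; [f_equal | apply sqrt_1].
  pose proof (sin2_cos2 t) as H. unfold Rsqr in H. etransitivity; [|exact H]. ring.
Qed.

Lemma expi_plus s t : expi (s + t) = expi s * expi t.
Proof.
  apply injective_projections; simpl; [rewrite cos_plus | rewrite sin_plus]; ring.
Qed.

Lemma expi_0 : expi 0 = 1.
Proof. unfold expi. rewrite cos_0, sin_0. reflexivity. Qed.

Lemma expi_conj t : Cconj (expi t) = expi (- t).
Proof. unfold Cconj, expi; simpl. rewrite cos_neg, sin_neg. reflexivity. Qed.

Lemma expi_2PI t : expi (t + 2 * PI) = expi t.
Proof. unfold expi. rewrite cos_plus, sin_plus, cos_2PI, sin_2PI. f_equal; ring. Qed.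

Lemma expi_neq_0 t : expi t <> 0.
Proof. apply Cmod_gt_0. rewrite Cmod_expi. lra. Qed.

(** * Continuity and integrals of complex-valued functions *)

Section Continuity.
Context {U : UniformSpace}.
Implicit Types (f g : U -> C) (x : U).

Lemma cont_Re f x : continuous f x -> continuous (fun y => Re (f y)) x.
Proof. intros H. apply (continuous_comp f fst); [exact H|]. destruct (f x). apply continuous_fst. Qed.

Lemma cont_Im f x : continuous f x -> continuous (fun y => Im (f y)) x.
Proof. intros H. apply (continuous_comp f snd); [exact H|]. destruct (f x). apply continuous_snd. Qed.

Lemma cont_pair (f g : U -> R) x :
  continuous f x -> continuous g x -> continuous (fun y => (f y, g y) : C) x.
Proof.
  intros Hf Hg P [e HP]. specialize (Hf (ball (f x) e)). specialize (Hg (ball (g x) e)).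
  assert (H : locally x (fun y => ball (f x) e (f y) /\ ball (g x) e (g y))).
  { apply filter_and; [apply Hf | apply Hg]; exists e; auto. }
  change (locally x (fun y => P (f y, g y))).
  revert H. apply filter_imp. intros y [H1 H2]. apply HP. split; assumption.
Qed.

Lemma cont_const (c : C) x : continuous (fun _ : U => c) x.
Proof. apply continuous_const. Qed.

Lemma cont_RtoC (f : U -> R) x : continuous f x -> continuous (fun y => RtoC (f y)) x.
Proof. intros H. apply cont_pair; [exact H | apply continuous_const]. Qed.

Lemma cont_Rmult (f g : U -> R) x :
  continuous f x -> continuous g x -> continuous (fun y => (f y * g y)%R) x.
Proof. exact (continuous_mult (K := R_AbsRing) f g x). Qed.

Lemma cont_Rplus (f g : U -> R) x :
  continuous f x -> continuous g x -> continuous (fun y => (f y + g y)%R) x.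
Proof. exact (continuous_plus (V := R_NormedModule) f g x). Qed.

Lemma cont_plus f g x : continuous f x -> continuous g x -> continuous (fun y => f y + g y) x.
Proof.
  intros Hf Hg. apply cont_pair.
  - apply (continuous_plus (V := R_NormedModule) (fun y => Re (f y)) (fun y => Re (g y))); apply cont_Re; assumption.
  - apply (continuous_plus (V := R_NormedModule) (fun y => Im (f y)) (fun y => Im (g y))); apply cont_Im; assumption.
Qed.

Lemma cont_opp f x : continuous f x -> continuous (fun y => - f y) x.
Proof.
  intros Hf. apply cont_pair.
  - apply (continuous_opp (V := R_NormedModule) (fun y => Re (f y))). apply cont_Re; assumption.
  - apply (continuous_opp (V := R_NormedModule) (fun y => Im (f y))). apply cont_Im; assumption.
Qed.

Lemma cont_minus f g x : continuous f x -> continuous g x -> continuous (fun y => f y - g y) x.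
Proof. intros Hf Hg. apply cont_plus; [exact Hf | apply cont_opp; exact Hg]. Qed.

Lemma cont_conj f x : continuous f x -> continuous (fun y => Cconj (f y)) x.
Proof.
  intros Hf. apply cont_pair; [apply cont_Re; assumption|].
  apply (continuous_opp (V := R_NormedModule) (fun y => Im (f y))). apply cont_Im; assumption.
Qed.

Lemma cont_mult f g x : continuous f x -> continuous g x -> continuous (fun y => f y * g y) x.
Proof.
  intros Hf Hg.
  pose proof (cont_Re _ _ Hf) as F1. pose proof (cont_Im _ _ Hf) as F2.
  pose proof (cont_Re _ _ Hg) as G1. pose proof (cont_Im _ _ Hg) as G2.
  apply cont_pair.
  - apply (continuous_minus (V := R_NormedModule) (fun y => Re (f y) * Re (g y))%R (fun y => Im (f y) * Im (g y))%R);
      apply (continuous_mult (K := R_AbsRing)); assumption.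
  - apply (continuous_plus (V := R_NormedModule) (fun y => Re (f y) * Im (g y))%R (fun y => Im (f y) * Re (g y))%R);
      apply (continuous_mult (K := R_AbsRing)); assumption.
Qed.

Lemma cont_Cmod f x : continuous f x -> continuous (fun y => Cmod (f y)) x.
Proof.
  intros Hf. apply continuous_ext with (f := fun y => sqrt (Re (f y) * Re (f y) + Im (f y) * Im (f y))).
  - intros y. unfold Cmod, Re, Im. simpl. rewrite !Rmult_1_r. reflexivity.
  - apply (continuous_comp (fun y => (Re (f y) * Re (f y) + Im (f y) * Im (f y))%R) sqrt);
      [|apply continuous_sqrt].
    apply cont_Rplus; apply cont_Rmult; [apply cont_Re | apply cont_Re | apply cont_Im | apply cont_Im]; exact Hf.
Qed.

Lemma cont_eps f x : continuous f x <->
  (forall eps, (0 < eps)%R -> locally x (fun y => (Cmod (f y - f x) < eps)%R)).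
Proof.
  split.
  - intros Hf eps He.
    pose proof (cont_Cmod _ _ (cont_minus _ _ _ Hf (cont_const (f x) x))) as H.
    specialize (H (fun r => (r < eps)%R)).
    apply H. replace (Cmod (f x - f x)) with 0%R.
    2:{ unfold Cminus. rewrite Cplus_opp_r, Cmod_0. reflexivity. }
    exists (mkposreal eps He). intros r Hr. unfold ball in Hr; simpl in Hr.
    unfold AbsRing_ball, abs, minus, plus, opp in Hr; simpl in Hr.
    apply Rabs_lt_between in Hr. simpl in Hr. lra.
  - intros H P [e HP]. change (locally x (fun y => P (f y))).
    generalize (H e (cond_pos e)). apply filter_imp.
    intros y Hy. apply HP. pose proof (Rmax_Cmod (f y - f x)) as M.
    split; (eapply Rle_lt_trans; [|exact Hy]); (eapply Rle_trans; [|exact M]).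
    + apply Rmax_l.
    + apply Rmax_r.
Qed.
End Continuity.

Lemma cder_cont (f : C -> C) z l : cder f z l -> continuous f z.
Proof.
  intros H. apply cont_eps. intros eps He.
  destruct (gder_cont _ _ _ _ H eps He) as [d [Hd Hf]].
  assert (Hd2 : (0 < d / 2)%R) by lra.
  exists (mkposreal _ Hd2). intros y Hy. apply Hf.
  eapply Rlt_le_trans.
  - exact (C_NormedModule_mixin_compat2 z y (mkposreal _ Hd2) Hy).
  - simpl. pose proof (Rsqr_sqrt 2 ltac:(lra)) as Hs. unfold Rsqr in Hs.
    pose proof (sqrt_pos 2). assert (sqrt 2 <= 2)%R by nra. nra.
Qed.

Lemma rder_cont (f : R -> C) z l : rder f z l -> continuous f z.
Proof.
  intros H. apply cont_eps. intros eps He.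
  destruct (gder_cont _ _ _ _ H eps He) as [d [Hd Hf]].
  exists (mkposreal _ Hd). intros y Hy. apply Hf.
  rewrite <- RtoC_minus, Cmod_R. exact Hy.
Qed.

Lemma cont_Cinv {U : UniformSpace} (f : U -> C) x :
  continuous f x -> f x <> 0 -> continuous (fun y => / f y) x.
Proof.
  intros H H0. apply (continuous_comp f Cinv); [exact H|].
  exact (cder_cont _ _ _ (cder_inv _ H0)).
Qed.

Lemma cont_div {U : UniformSpace} (f g : U -> C) x :
  continuous f x -> continuous g x -> g x <> 0 -> continuous (fun y => f y / g y) x.
Proof. intros Hf Hg H0. apply cont_mult; [exact Hf | apply cont_Cinv; assumption]. Qed.

Lemma cont_cder_comp {U : UniformSpace} (f : U -> C) (F : C -> C) x l :
  continuous f x -> cder F (f x) l -> continuous (fun y => F (f y)) x.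
Proof. intros H HF. apply (continuous_comp f F); [exact H | exact (cder_cont _ _ _ HF)]. Qed.

(** * Integrals of complex-valued functions of a real variable *)

(** Linearity over [C] and additivity reduce to the real [RInt] of the components, while norm bounds
    and the fundamental theorem come from the vector-valued integral that has these components. *)
Definition CInt (f : R -> C) (a b : R) : C :=
  (RInt (fun t => Re (f t)) a b, RInt (fun t => Im (f t)) a b).

(** [Rmin] and [Rmax] admit either orientation of the interval, as needed for segments with a moving
    endpoint. *)
Definition con (f : R -> C) (a b : R) : Prop :=
  forall x, (Rmin a b <= x <= Rmax a b)%R -> continuous f x.

Lemma con_Re f a b : con f a b -> ex_RInt (fun t => Re (f t)) a b.
Proof. intros H. apply (ex_RInt_continuous (V := R_CompleteNormedModule)). intros z Hz. apply cont_Re. auto. Qed.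

Lemma con_Im f a b : con f a b -> ex_RInt (fun t => Im (f t)) a b.
Proof. intros H. apply (ex_RInt_continuous (V := R_CompleteNormedModule)). intros z Hz. apply cont_Im. auto. Qed.

Lemma con_le f a b : (forall x, (a <= x <= b)%R -> continuous f x) -> (a <= b)%R -> con f a b.
Proof. intros H Hab x. rewrite Rmin_left, Rmax_right by exact Hab. apply H. Qed.

Lemma CInt_ext f g a b :
  (forall x, (Rmin a b < x < Rmax a b)%R -> f x = g x) -> CInt f a b = CInt g a b.
Proof.
  intros H. unfold CInt. f_equal; apply RInt_ext; intros x Hx; rewrite H by exact Hx; reflexivity.
Qed.

Lemma CInt_plus f g a b : con f a b -> con g a b ->
  CInt (fun t => f t + g t) a b = CInt f a b + CInt g a b.
Proof.
  intros Hf Hg. unfold CInt. apply injective_projections; simpl.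
  - apply (RInt_plus (V := R_CompleteNormedModule)); apply con_Re; assumption.
  - apply (RInt_plus (V := R_CompleteNormedModule)); apply con_Im; assumption.
Qed.

Lemma CInt_scal c f a b : con f a b -> CInt (fun t => c * f t) a b = c * CInt f a b.
Proof.
  intros Hf. pose proof (con_Re _ _ _ Hf) as H1. pose proof (con_Im _ _ _ Hf) as H2.
  unfold CInt. apply injective_projections; simpl.
  - etransitivity.
    + apply (RInt_minus (V := R_CompleteNormedModule) (fun t => fst c * fst (f t))%R (fun t => snd c * snd (f t))%R);
        apply (ex_RInt_scal (V := R_CompleteNormedModule)); assumption.
    + unfold minus, plus, opp; simpl. unfold Rminus. f_equal; [|f_equal];
      apply (RInt_scal (V := R_CompleteNormedModule)); assumption.
  - etransitivity.
    + apply (RInt_plus (V := R_CompleteNormedModule) (fun t => fst c * snd (f t))%R (fun t => snd c * fst (f t))%R);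
        apply (ex_RInt_scal (V := R_CompleteNormedModule)); assumption.
    + unfold minus, plus, opp; simpl. f_equal;
      apply (RInt_scal (V := R_CompleteNormedModule)); assumption.
Qed.

Lemma con_scal c f a b : con f a b -> con (fun t => c * f t) a b.
Proof. intros H x Hx. apply cont_mult; [apply cont_const | auto]. Qed.

Lemma CInt_minus f g a b : con f a b -> con g a b ->
  CInt (fun t => f t - g t) a b = CInt f a b - CInt g a b.
Proof.
  intros Hf Hg. etransitivity.
  - apply CInt_ext with (g := fun t => f t + (-(1)) * g t). intros. ring.
  - rewrite CInt_plus; [rewrite CInt_scal by assumption; ring | assumption | apply con_scal; assumption].
Qed.

Lemma CInt_const c a b : CInt (fun _ => c) a b = RtoC (b - a) * c.
Proof.
  pose proof (RInt_const (V := R_CompleteNormedModule) a b) as H.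
  unfold CInt. apply injective_projections; simpl; (etransitivity; [apply H|]);
    unfold scal; simpl; unfold mult; simpl; unfold Re, Im; ring.
Qed.

Lemma CInt_Chasles f a b c : con f a b -> con f b c ->
  CInt f a b + CInt f b c = CInt f a c.
Proof.
  intros Hf Hg. unfold CInt. apply injective_projections; simpl.
  - apply (RInt_Chasles (V := R_CompleteNormedModule)); apply con_Re; assumption.
  - apply (RInt_Chasles (V := R_CompleteNormedModule)); apply con_Im; assumption.
Qed.

Lemma CInt_swap f a b : con f a b -> CInt f b a = - CInt f a b.
Proof.
  intros Hf. unfold CInt. apply injective_projections; simpl; symmetry.
  - apply (opp_RInt_swap (V := R_CompleteNormedModule)); apply con_Re; assumption.
  - apply (opp_RInt_swap (V := R_CompleteNormedModule)); apply con_Im; assumption.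
Qed.

Lemma CInt_point f a : CInt f a a = 0.
Proof. unfold CInt. apply injective_projections; apply (RInt_point (V := R_CompleteNormedModule)). Qed.

Lemma CInt_bound_le f a b M : (a <= b)%R -> con f a b ->
  (forall x, (a <= x <= b)%R -> (Cmod (f x) <= M)%R) -> (Cmod (CInt f a b) <= (b - a) * M)%R.
Proof.
  intros Hab Hf HM.
  assert (H : @is_RInt C_R_NormedModule f a b (CInt f a b)).
  { apply (is_RInt_fct_extend_pair (U := R_NormedModule) (V := R_NormedModule));
    apply (RInt_correct (V := R_CompleteNormedModule)); [apply con_Re | apply con_Im]; assumption. }
  rewrite Cmod_norm.
  refine (norm_RInt_le_const (V := C_R_NormedModule) f a b _ M Hab _ H).
  intros x Hx. specialize (HM x Hx). rewrite Cmod_norm in HM. exact HM.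
Qed.

Lemma CInt_bound f a b M : con f a b ->
  (forall x, (Rmin a b <= x <= Rmax a b)%R -> (Cmod (f x) <= M)%R) ->
  (Cmod (CInt f a b) <= Rabs (b - a) * M)%R.
Proof.
  intros Hf HM. destruct (Rle_dec a b) as [Hab|Hab].
  - rewrite Rabs_pos_eq by lra. apply CInt_bound_le; auto.
    rewrite Rmin_left, Rmax_right in HM by exact Hab. exact HM.
  - assert (Hba : con f b a).
    { intros x. rewrite Rmin_comm, Rmax_comm. apply Hf. }
    rewrite (CInt_swap _ _ _ Hba), Cmod_opp, Rabs_left by lra.
    replace (- (b - a))%R with (a - b)%R by ring.
    apply CInt_bound_le; auto; [lra|].
    rewrite Rmin_right, Rmax_left in HM by lra. exact HM.
Qed.

Lemma CInt_FTC f df a b :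
  (forall x, (Rmin a b <= x <= Rmax a b)%R -> rder f x (df x)) -> con df a b ->
  CInt df a b = f b - f a.
Proof.
  intros Hf Hc.
  assert (H : @is_RInt C_R_NormedModule df a b (f b - f a)).
  { apply (is_RInt_derive (V := C_R_CompleteNormedModule)); [|exact Hc].
    intros x Hx. apply rder_is_derive. auto. }
  unfold CInt. apply injective_projections; simpl.
  - apply (is_RInt_unique (V := R_CompleteNormedModule)).
    apply (is_RInt_fct_extend_fst (U := R_NormedModule) (V := R_NormedModule) _ _ _ _ H).
  - apply (is_RInt_unique (V := R_CompleteNormedModule)).
    apply (is_RInt_fct_extend_snd (U := R_NormedModule) (V := R_NormedModule) _ _ _ _ H).
Qed.

Lemma rder_zero_const f a b :
  (forall x, (Rmin a b <= x <= Rmax a b)%R -> rder f x 0) -> f a = f b.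
Proof.
  intros H. pose proof (CInt_FTC f (fun _ => 0) a b H (fun x _ => cont_const _ x)) as E.
  rewrite CInt_const in E.
  replace (f b) with (f a + (f b - f a)) by ring. rewrite <- E. ring.
Qed.

Lemma rder_CInt f a x :
  (forall y, continuous f y) -> rder (fun y => CInt f a y) x (f x).
Proof.
  intros H. unfold CInt.
  destruct (f x) as [u v] eqn:E.
  assert (Hu : u = Re (f x)) by (rewrite E; reflexivity).
  assert (Hv : v = Im (f x)) by (rewrite E; reflexivity).
  rewrite Hu, Hv. apply gder_pair.
  - apply (is_derive_RInt (V := R_NormedModule) (fun t => Re (f t)) _ a).
    + apply filter_forall. intros y. apply (RInt_correct (V := R_CompleteNormedModule)).
      apply con_Re. intros z _; apply H.
    + apply cont_Re, H.
  - apply (is_derive_RInt (V := R_NormedModule) (fun t => Im (f t)) _ a).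
    + apply filter_forall. intros y. apply (RInt_correct (V := R_CompleteNormedModule)).
      apply con_Im. intros z _; apply H.
    + apply cont_Im, H.
Qed.

(** * Fubini and differentiation under the integral sign *)

Section Fubini.
Variable f : R -> R -> R.
Hypothesis Hf : forall p : R * R, continuous (fun q : R * R => f (fst q) (snd q)) p.

Lemma fub_c2 x y : continuity_2d_pt f x y.
Proof. apply continuity_2d_pt_filterlim. exact (Hf (x, y)). Qed.

Lemma fub_cy x y : continuous (f x) y.
Proof.
  apply (continuous_comp_2 (fun _ => x) (fun y => y) f); [apply continuous_const | apply continuous_id|].
  apply (Hf (x, y)).
Qed.

Lemma fub_cx x y : continuous (fun x => f x y) x.
Proof.
  apply (continuous_comp_2 (fun x => x) (fun _ => y) f); [apply continuous_id | apply continuous_const|].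
  apply (Hf (x, y)).
Qed.

Lemma fub_ex_y x c d : ex_RInt (f x) c d.
Proof. apply (ex_RInt_continuous (V := R_CompleteNormedModule)). intros; apply fub_cy. Qed.

Lemma fub_ex_x y c d : ex_RInt (fun x => f x y) c d.
Proof. apply (ex_RInt_continuous (V := R_CompleteNormedModule)). intros; apply fub_cx. Qed.

(** Uniform continuity of [f] near the compact segment [{x}] times [[c, d]] bounds the increment of
    the integrand uniformly; the 1 added to [d - c] covers the case [c = d]. *)
Lemma fub_param x c d : (c <= d)%R -> continuous (fun x => RInt (f x) c d) x.
Proof.
  intros Hcd P [e HP].
  assert (He : (0 < e / (d - c + 1))%R).
  { apply Rdiv_lt_0_compat; [apply cond_pos | lra]. }
  destruct (uniform_continuity_2d_1d' f c d x (fun y _ => fub_c2 x y) (mkposreal _ He)) as [dl Hdl].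
  exists dl. intros y Hy. apply HP.
  assert (Hy' : (Rabs (y - x) < dl)%R) by exact Hy.
  change (Rabs (RInt (f y) c d - RInt (f x) c d) < e)%R.
  apply Rabs_lt_between in Hy'.
  assert (E : (RInt (f y) c d - RInt (f x) c d)%R = RInt (fun t => (f y t - f x t)%R) c d).
  { symmetry. apply (RInt_minus (V := R_CompleteNormedModule)); apply fub_ex_y. }
  rewrite E.
  apply Rle_lt_trans with ((d - c) * (e / (d - c + 1)))%R.
  - apply abs_RInt_le_const; [exact Hcd| |].
    + apply (ex_RInt_minus (V := R_CompleteNormedModule)); apply fub_ex_y.
    + intros t Ht. apply Rlt_le. apply (Hdl t x t y); try lra.
      replace (t - t)%R with 0%R by ring. rewrite Rabs_R0. apply cond_pos.
  - pose proof (cond_pos e). apply Rmult_lt_reg_r with (d - c + 1)%R; [lra|].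
    unfold Rdiv. field_simplify; [nra | lra].
Qed.
End Fubini.

(** Both sides, as functions of the upper limit [b], vanish at [a] and have the same derivative
    [RInt (f t) c d], so their difference is constant. *)
Lemma RInt_Fubini (f : R -> R -> R) a b c d : (a <= b)%R -> (c <= d)%R ->
  (forall p : R * R, continuous (fun q : R * R => f (fst q) (snd q)) p) ->
  RInt (fun x => RInt (f x) c d) a b = RInt (fun y => RInt (fun x => f x y) a b) c d.
Proof.
  intros Hab Hcd Hf.
  assert (Hs : forall p : R * R, continuous (fun q : R * R => (fun y x => f x y) (fst q) (snd q)) p).
  { intros [y x].
    apply (continuous_comp (fun q : R * R => (snd q, fst q)) (fun q : R * R => f (fst q) (snd q))).
    - apply cont_pair; [apply continuous_snd | apply continuous_fst].
    - apply Hf. }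
  pose (Psi u := RInt (fun x => RInt (f x) c d) a u).
  pose (Phi u := RInt (fun y => RInt (fun x => f x y) a u) c d).
  enough (H : (Psi b - Phi b)%R = (Psi a - Phi a)%R).
  { unfold Psi, Phi in H.
    rewrite (RInt_point a (V := R_CompleteNormedModule)) in H.
    assert (E : RInt (fun y => RInt (fun x => f x y) a a) c d = 0%R).
    { etransitivity.
      - apply (RInt_ext (V := R_CompleteNormedModule) _ (fun _ => 0%R)). intros.
        apply (RInt_point (V := R_CompleteNormedModule)).
      - etransitivity; [apply (RInt_const (V := R_CompleteNormedModule))|].
        unfold scal; simpl; unfold mult; simpl. ring. }
    rewrite E in H. unfold zero in H; simpl in H. lra. }
  destruct (Rle_lt_or_eq_dec _ _ Hab) as [Hlt|Heq]; [|rewrite Heq; reflexivity].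
  symmetry.
  apply (eq_is_derive (V := R_NormedModule) (fun u => Psi u - Phi u)%R a b); [|exact Hlt].
  intros t _.
  assert (D1 : is_derive Psi t (RInt (f t) c d)).
  { apply (is_derive_RInt (V := R_NormedModule) (fun x => RInt (f x) c d) Psi a t).
    - apply filter_forall. intros u. apply (RInt_correct (V := R_CompleteNormedModule)).
      apply (ex_RInt_continuous (V := R_CompleteNormedModule)). intros.
      apply fub_param; assumption.
    - apply fub_param; assumption. }
  assert (D0 : forall u v, is_derive (fun u => RInt (fun x => f x v) a u) u (f u v)).
  { intros u v. apply (is_derive_RInt (V := R_NormedModule) (fun x => f x v) _ a u).
    - apply filter_forall. intros w. apply (RInt_correct (V := R_CompleteNormedModule)).
      apply fub_ex_x; assumption.
    - apply fub_cx; assumption. }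
  assert (D2 : is_derive Phi t (RInt (f t) c d)).
  { assert (ED : forall u v, Derive (fun z => RInt (fun x => f x v) a z) u = f u v).
    { intros. apply is_derive_unique, D0. }
    pose proof (is_derive_RInt_param (fun u y => RInt (fun x => f x y) a u) c d t) as H.
    assert (E : RInt (fun t0 => Derive (fun u => RInt (fun x => f x t0) a u) t) c d = RInt (f t) c d).
    { apply (RInt_ext (V := R_CompleteNormedModule)). intros; apply ED. }
    refine (eq_ind _ (fun v => is_derive Phi t v) (H _ _ _) _ E).
    - apply filter_forall. intros u v _. eexists; apply D0.
    - intros v _. apply continuity_2d_pt_ext with (f := f); [intros; symmetry; apply ED|].
      apply fub_c2; assumption.
    - apply filter_forall. intros u. apply (ex_RInt_continuous (V := R_CompleteNormedModule)).
      intros z _. destruct (Rle_dec a u) as [Hau|Hau].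
      + apply (fub_param (fun y x => f x y) Hs z a u Hau).
      + apply (continuous_ext (fun y => opp (RInt (fun x => f x y) u a))).
        { intros y. apply (opp_RInt_swap (V := R_CompleteNormedModule)), fub_ex_x; assumption. }
        apply (continuous_opp (V := R_NormedModule)).
        apply (fub_param (fun y x => f x y) Hs z u a). lra. }
  pose proof (is_derive_minus (V := R_NormedModule) _ _ _ _ _ D1 D2) as H.
  refine (eq_ind _ (fun v => is_derive _ t v) H _ _).
  unfold minus, plus, opp, zero; simpl. ring.
Qed.

(** The retraction of the line onto [[a, b]]. Composing with it extends a function continuous on a
    rectangle to the plane without changing its integrals there, so Fubini can be used with
    continuity on the rectangle only. *)
Definition clamp (a b x : R) : R := Rmax a (Rmin b x).

Lemma clamp_in a b x : (a <= b)%R -> (a <= clamp a b x <= b)%R.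
Proof.
  intros H. unfold clamp. split; [apply Rmax_l|].
  apply Rmax_lub; [exact H | apply Rmin_l].
Qed.

Lemma clamp_id a b x : (a <= x <= b)%R -> clamp a b x = x.
Proof. intros H. unfold clamp. rewrite Rmin_right, Rmax_right; lra. Qed.

Lemma cont_clamp a b {U : UniformSpace} (g : U -> R) x :
  continuous g x -> continuous (fun y => clamp a b (g y)) x.
Proof.
  intros Hg. apply (continuous_comp g (clamp a b)); [exact Hg|].
  generalize (g x). clear. intros x P [e HP]. exists e. intros y Hy. apply HP.
  assert (Hy' : (Rabs (y - x) < e)%R) by exact Hy.
  change (Rabs (clamp a b y - clamp a b x) < e)%R.
  eapply Rle_lt_trans; [|exact Hy'].
  unfold clamp. apply Rle_trans with (Rabs (Rmin b y - Rmin b x)).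
  - generalize (Rmin b y), (Rmin b x). intros u v. unfold Rmax.
    destruct (Rle_dec a u), (Rle_dec a v); unfold Rabs;
    repeat destruct Rcase_abs; lra.
  - unfold Rmin. destruct (Rle_dec b y), (Rle_dec b x); unfold Rabs;
    repeat destruct Rcase_abs; lra.
Qed.

Lemma CInt_Fubini (f : R -> R -> C) a b c d : (a <= b)%R -> (c <= d)%R ->
  (forall x y, (a <= x <= b)%R -> (c <= y <= d)%R ->
    continuous (fun q : R * R => f (fst q) (snd q)) (x, y)) ->
  CInt (fun x => CInt (f x) c d) a b = CInt (fun y => CInt (fun x => f x y) a b) c d.
Proof.
  intros Hab Hcd Hf.
  assert (Hc : forall p : R * R,
    continuous (fun q : R * R => f (clamp a b (fst q)) (clamp c d (snd q))) p).
  { intros [x y].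
    apply (continuous_comp (fun q : R * R => (clamp a b (fst q), clamp c d (snd q)))
      (fun q : R * R => f (fst q) (snd q))).
    - apply cont_pair; apply cont_clamp; [apply continuous_fst | apply continuous_snd].
    - apply Hf; apply clamp_in; assumption. }
  assert (K : forall pr : C -> R, (forall p : R * R,
     continuous (fun q : R * R => pr (f (clamp a b (fst q)) (clamp c d (snd q)))) p) ->
     RInt (fun x => RInt (fun y => pr (f x y)) c d) a b =
     RInt (fun y => RInt (fun x => pr (f x y)) a b) c d).
  { intros pr Hpr.
    pose proof (RInt_Fubini (fun x y => pr (f (clamp a b x) (clamp c d y))) a b c d Hab Hcd Hpr) as H.
    etransitivity; [|etransitivity; [exact H|]].
    - apply (RInt_ext (V := R_CompleteNormedModule)). intros x Hx.
      rewrite Rmin_left, Rmax_right in Hx by exact Hab.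
      apply (RInt_ext (V := R_CompleteNormedModule)). intros y Hy.
      rewrite Rmin_left, Rmax_right in Hy by exact Hcd.
      rewrite !clamp_id by lra. reflexivity.
    - apply (RInt_ext (V := R_CompleteNormedModule)). intros y Hy.
      rewrite Rmin_left, Rmax_right in Hy by exact Hcd.
      apply (RInt_ext (V := R_CompleteNormedModule)). intros x Hx.
      rewrite Rmin_left, Rmax_right in Hx by exact Hab.
      rewrite !clamp_id by lra. reflexivity. }
  apply injective_projections; simpl.
  - apply (K Re). intros p. apply cont_Re. apply (Hc p).
  - apply (K Im). intros p. apply cont_Im. apply (Hc p).
Qed.

(** * Integrals depending on a complex parameter *)

Lemma con_bounded f a b : (a <= b)%R -> con f a b ->
  exists M, (0 < M)%R /\ forall x, (a <= x <= b)%R -> (Cmod (f x) <= M)%R.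
Proof.
  intros Hab Hf.
  destruct (continuity_ab_maj (fun x => Cmod (f x)) a b Hab) as [m [Hm _]].
  { intros c Hc. apply continuity_pt_filterlim. apply (cont_Cmod f).
    apply Hf. rewrite Rmin_left, Rmax_right by exact Hab. exact Hc. }
  exists (Cmod (f m) + 1)%R. pose proof (Cmod_ge_0 (f m)). split; [lra|].
  intros x Hx. specialize (Hm x Hx). simpl in Hm. lra.
Qed.

Lemma con_bounded_below f a b : (a <= b)%R -> con f a b ->
  (forall x, (a <= x <= b)%R -> f x <> 0) ->
  exists M, (0 < M)%R /\ forall x, (a <= x <= b)%R -> (M <= Cmod (f x))%R.
Proof.
  intros Hab Hf H0.
  destruct (continuity_ab_min (fun x => Cmod (f x)) a b Hab) as [m [Hm Hm']].
  { intros c Hc. apply continuity_pt_filterlim. apply (cont_Cmod f).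
    apply Hf. rewrite Rmin_left, Rmax_right by exact Hab. exact Hc. }
  exists (Cmod (f m)). split; [apply Cmod_gt_0; auto | exact Hm].
Qed.

(** A second-order remainder whose constant does not depend on [t] remains of second order after
    integration over [t]. *)
Lemma cder_CInt (k : R -> C -> C) (k' : R -> C) a b z0 (d M : R) :
  (a <= b)%R -> (0 < d)%R -> (0 <= M)%R ->
  (forall z, (Cmod (z - z0) < d)%R -> con (fun t => k t z) a b) -> con k' a b ->
  (forall t z, (a <= t <= b)%R -> (Cmod (z - z0) < d)%R ->
    (Cmod (k t z - k t z0 - (z - z0) * k' t) <= M * Cmod (z - z0) ^ 2)%R) ->
  cder (fun z => CInt (fun t => k t z) a b) z0 (CInt k' a b).
Proof.
  intros Hab Hd HM Hk Hk' H eps He.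
  assert (Hz0 : (Cmod (z0 - z0) < d)%R).
  { replace (z0 - z0) with (RtoC 0) by ring. rewrite Cmod_0. exact Hd. }
  assert (Hp : (0 < (b - a) * M + 1)%R).
  { assert (0 <= (b - a) * M)%R by (apply Rmult_le_pos; lra). lra. }
  exists (Rmin d (eps / ((b - a) * M + 1))). split.
  { apply Rmin_glb_lt; [exact Hd|]. apply Rdiv_lt_0_compat; assumption. }
  intros z Hz.
  assert (H1 : (Cmod (z - z0) < d)%R) by (eapply Rlt_le_trans; [exact Hz | apply Rmin_l]).
  assert (H2 : (Cmod (z - z0) < eps / ((b - a) * M + 1))%R) by (eapply Rlt_le_trans; [exact Hz | apply Rmin_r]).
  rewrite <- CInt_scal, <- CInt_minus, <- CInt_minus;
    [|intros x Hx; apply cont_minus; [apply (Hk z) | apply (Hk z0)]; assumption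
     |apply con_scal; assumption|apply Hk; assumption|apply Hk; assumption|assumption].
  eapply Rle_trans.
  - apply CInt_bound_le with (M := (M * Cmod (z - z0) ^ 2)%R); [exact Hab| |].
    + intros x Hx. apply cont_minus; [|apply con_scal with (a := a) (b := b); assumption].
      apply cont_minus; [apply (Hk z) | apply (Hk z0)]; assumption.
    + intros t Ht. apply H; assumption.
  - pose proof (Cmod_ge_0 (z - z0)).
    assert (Cmod (z - z0) * ((b - a) * M + 1) <= eps)%R.
    { apply Rmult_lt_compat_r with (r := ((b - a) * M + 1)%R) in H2; [|exact Hp].
      unfold Rdiv in H2. rewrite Rmult_assoc, Rinv_l in H2 by lra. lra. }
    replace ((b - a) * (M * Cmod (z - z0) ^ 2))%R with
      ((Cmod (z - z0) * ((b - a) * M)) * Cmod (z - z0))%R by ring.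
    apply Rmult_le_compat_r; [assumption|]. lra.
Qed.

(** With [m] the minimum of the denominator at [z0] and [Q] a bound for [q], moving [z] by less than
    [m / (2 Q)] changes the denominator by at most [m / 2]. *)
Lemma kernel_setup (w p q : R -> C) (a b : R) (z0 : C) :
  (a <= b)%R -> con w a b -> con p a b -> con q a b ->
  (forall t, (a <= t <= b)%R -> p t - q t * z0 <> 0) ->
  exists W Q m d : R, (0 < W)%R /\ (0 < Q)%R /\ (0 < m)%R /\ (0 < d)%R /\
    forall t, (a <= t <= b)%R -> (Cmod (w t) <= W)%R /\ (Cmod (q t) <= Q)%R /\
      (m <= Cmod (p t - q t * z0))%R /\
      forall z, (Cmod (z - z0) < d)%R -> (m / 2 <= Cmod (p t - q t * z))%R.
Proof.
  intros Hab Hw Hp Hq H0.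
  destruct (con_bounded w a b Hab Hw) as [W [HW HW']].
  destruct (con_bounded q a b Hab Hq) as [Q [HQ HQ']].
  destruct (con_bounded_below (fun t => p t - q t * z0) a b Hab) as [m [Hm Hm']].
  { intros t Ht. apply cont_minus; [auto|]. apply cont_mult; [auto | apply cont_const]. }
  { exact H0. }
  exists W, Q, m, (m / 2 / Q)%R.
  split; [assumption|]. split; [assumption|]. split; [assumption|].
  assert (0 < m / 2)%R by lra.
  split; [apply Rdiv_lt_0_compat; assumption|].
  intros t Ht. split; [auto|]. split; [auto|]. split; [auto|].
  intros z Hz.
  assert (E : (Cmod (q t * (z - z0)) <= m / 2)%R).
  { rewrite Cmod_mult. apply Rle_trans with (Q * (m / 2 / Q))%R.
    - apply Rmult_le_compat; try apply Cmod_ge_0; [auto | lra].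
    - right. field. lra. }
  pose proof (Cmod_triangle_inv (p t - q t * z0) (q t * (z - z0))) as T.
  replace (p t - q t * z0 - q t * (z - z0)) with (p t - q t * z) in T by ring.
  specialize (Hm' t Ht). simpl in Hm'. lra.
Qed.

Lemma Cmod_inv_le (x : C) (m : R) : (0 < m)%R -> (m <= Cmod x)%R -> (Cmod (/ x) <= / m)%R.
Proof.
  intros Hm H. assert (x <> 0) by (apply Cmod_gt_0; lra).
  rewrite Cmod_inv by assumption. apply Rinv_le_contravar; assumption.
Qed.

(** The denominator [p t - q t z] covers two kernels: [zeta - z] with [zeta] on a circle, for
    Cauchy's formula, and [1 - t z] with [t] in [[0, 1]], for the functional with a movable pole. *)
Lemma cder_kernel1 (w p q : R -> C) (a b : R) (z0 : C) :
  (a <= b)%R -> con w a b -> con p a b -> con q a b ->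
  (forall t, (a <= t <= b)%R -> p t - q t * z0 <> 0) ->
  cder (fun z => CInt (fun t => w t / (p t - q t * z)) a b) z0
       (CInt (fun t => w t * q t / ((p t - q t * z0) * (p t - q t * z0))) a b).
Proof.
  intros Hab Hw Hp Hq H0.
  destruct (kernel_setup w p q a b z0 Hab Hw Hp Hq H0) as
    [W [Q [m [d [HW [HQ [Hm [Hd HB]]]]]]]].
  apply (cder_CInt (fun t z => w t / (p t - q t * z))) with
    (d := d) (M := (W * (Q * Q) * (/ (m / 2) * (/ m * / m)))%R); auto.
  - repeat apply Rmult_le_pos; try lra; apply Rlt_le, Rinv_0_lt_compat; lra.
  - intros z Hz x Hx.
    apply cont_div; [auto|apply cont_minus; [auto | apply cont_mult; [auto | apply cont_const]]|].
    rewrite Rmin_left, Rmax_right in Hx by exact Hab.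
    destruct (HB x Hx) as [_ [_ [_ HB']]]. apply Cmod_gt_0. specialize (HB' z Hz). lra.
  - intros x Hx.
    assert (Hx' : (a <= x <= b)%R) by (rewrite Rmin_left, Rmax_right in Hx by exact Hab; exact Hx).
    assert (continuous (fun t => p t - q t * z0) x)
      by (apply cont_minus; [auto | apply cont_mult; [auto | apply cont_const]]).
    apply cont_div; [apply cont_mult; auto | apply cont_mult; assumption|].
    apply Cmult_neq_0; auto.
  - intros t z Ht Hz. destruct (HB t Ht) as [B1 [B2 [B3 B4]]]. specialize (B4 z Hz).
    assert (N1 : p t - q t * z0 <> 0) by auto.
    assert (N2 : p t - q t * z <> 0) by (apply Cmod_gt_0; lra).
    (* With [D] and [D0] the denominators at [z] and [z0], the remainder is exactly
       [w q^2 (z - z0)^2 / (D D0^2)]. *)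
    match goal with |- (Cmod ?e <= _)%R =>
      replace e with ((w t * (q t * q t) * (/ (p t - q t * z) * (/ (p t - q t * z0) * / (p t - q t * z0))))
       * ((z - z0) * (z - z0))) by (field; split; assumption) end.
    rewrite Cmod_mult, (Cmod_mult (z - z0)). simpl. rewrite Rmult_1_r.
    apply Rmult_le_compat_r; [apply Rle_0_sqr|].
    rewrite !Cmod_mult.
    pose proof (Cmod_inv_le _ _ Hm B3). pose proof (Cmod_inv_le _ (m / 2)%R ltac:(lra) B4).
    repeat apply Rmult_le_compat; repeat apply Rmult_le_pos; try apply Cmod_ge_0; assumption.
Qed.

Lemma RtoC_2 : RtoC 2 = 1 + 1.
Proof. apply injective_projections; simpl; ring. Qed.

(** The double-pole version serves to differentiate Cauchy's integral for the derivative once more,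
    and the functional with the squared kernel [ker b t]. *)
Lemma cder_kernel2 (w p q : R -> C) (a b : R) (z0 : C) :
  (a <= b)%R -> con w a b -> con p a b -> con q a b ->
  (forall t, (a <= t <= b)%R -> p t - q t * z0 <> 0) ->
  cder (fun z => CInt (fun t => w t / ((p t - q t * z) * (p t - q t * z))) a b) z0
       (CInt (fun t => RtoC 2 * (w t * q t) / ((p t - q t * z0) * (p t - q t * z0) * (p t - q t * z0))) a b).
Proof.
  intros Hab Hw Hp Hq H0.
  destruct (kernel_setup w p q a b z0 Hab Hw Hp Hq H0) as
    [W [Q [m [d [HW [HQ [Hm [Hd HB]]]]]]]].
  apply (cder_CInt (fun t z => w t / ((p t - q t * z) * (p t - q t * z)))) with
    (d := d) (M := (W * (Q * Q) * ((/ (m / 2) * / (m / 2)) * (/ m * / m)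
                     + 2 * (/ (m / 2) * (/ m * (/ m * / m)))))%R); auto.
  - repeat first [apply Rmult_le_pos | apply Rplus_le_le_0_compat]; try lra; apply Rlt_le, Rinv_0_lt_compat; lra.
  - intros z Hz x Hx.
    assert (continuous (fun t => p t - q t * z) x)
      by (apply cont_minus; [auto | apply cont_mult; [auto | apply cont_const]]).
    apply cont_div; [auto|apply cont_mult; assumption|].
    rewrite Rmin_left, Rmax_right in Hx by exact Hab.
    destruct (HB x Hx) as [_ [_ [_ HB']]]. specialize (HB' z Hz).
    apply Cmult_neq_0; apply Cmod_gt_0; lra.
  - intros x Hx.
    assert (Hx' : (a <= x <= b)%R) by (rewrite Rmin_left, Rmax_right in Hx by exact Hab; exact Hx).
    assert (continuous (fun t => p t - q t * z0) x)
      by (apply cont_minus; [auto | apply cont_mult; [auto | apply cont_const]]).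
    apply cont_div; [apply cont_mult; [apply cont_const | apply cont_mult; auto]
                    | apply cont_mult; [apply cont_mult|]; assumption|].
    repeat apply Cmult_neq_0; auto.
  - intros t z Ht Hz. destruct (HB t Ht) as [B1 [B2 [B3 B4]]]. specialize (B4 z Hz).
    assert (N1 : p t - q t * z0 <> 0) by auto.
    assert (N2 : p t - q t * z <> 0) by (apply Cmod_gt_0; lra).
    match goal with |- (Cmod ?e <= _)%R =>
      replace e with ((w t * (q t * q t) * ((/ (p t - q t * z) * / (p t - q t * z)) * (/ (p t - q t * z0) * / (p t - q t * z0))
         + RtoC 2 * (/ (p t - q t * z) * (/ (p t - q t * z0) * (/ (p t - q t * z0) * / (p t - q t * z0))))))
       * ((z - z0) * (z - z0))) by (rewrite RtoC_2; field; split; assumption) end.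
    rewrite Cmod_mult, (Cmod_mult (z - z0)). simpl. rewrite Rmult_1_r.
    apply Rmult_le_compat_r; [apply Rle_0_sqr|].
    rewrite Cmod_mult.
    pose proof (Cmod_inv_le _ _ Hm B3). pose proof (Cmod_inv_le _ (m / 2)%R ltac:(lra) B4).
    apply Rmult_le_compat; try apply Cmod_ge_0.
    + rewrite !Cmod_mult.
      repeat apply Rmult_le_compat; repeat apply Rmult_le_pos; try apply Cmod_ge_0; assumption.
    + eapply Rle_trans; [apply Cmod_triangle|].
      rewrite !Cmod_mult, Cmod_R, Rabs_pos_eq by lra.
      repeat first [apply Rplus_le_compat | apply Rmult_le_compat]; repeat apply Rmult_le_pos; try apply Cmod_ge_0; try assumption; lra.
Qed.

(** * Goursat's theorem *)

(** The contour integral over the boundary of [[a, b]] times [[c, d]], counterclockwise when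
    [a <= b] and [c <= d]. *)
Definition rect_int (F : C -> C) (a b c d : R) : C :=
  CInt (fun s => F (s, c)) a b - CInt (fun s => F (s, d)) a b
  + Ci * (CInt (fun s => F (b, s)) c d - CInt (fun s => F (a, s)) c d).

Lemma rder_hor (c s : R) : rder (fun s => (s, c) : C) s 1.
Proof.
  apply (gder_pair (fun s => s) (fun _ => c) s 1 0).
  - apply (is_derive_id (K := R_AbsRing)).
  - apply (is_derive_const (K := R_AbsRing) (V := R_NormedModule)).
Qed.

Lemma rder_ver (b s : R) : rder (fun s => (b, s) : C) s Ci.
Proof.
  apply (gder_pair (fun _ => b) (fun s => s) s 0 1).
  - apply (is_derive_const (K := R_AbsRing) (V := R_NormedModule)).
  - apply (is_derive_id (K := R_AbsRing)).
Qed.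

Lemma cont_hor (F : C -> C) (c s : R) : continuous F (s, c) -> continuous (fun s => F (s, c)) s.
Proof. intros H. apply (continuous_comp (fun s => (s, c) : C) F); [exact (rder_cont _ _ _ (rder_hor c s)) | exact H]. Qed.

Lemma cont_ver (F : C -> C) (b s : R) : continuous F (b, s) -> continuous (fun s => F (b, s)) s.
Proof. intros H. apply (continuous_comp (fun s => (b, s) : C) F); [exact (rder_cont _ _ _ (rder_ver b s)) | exact H]. Qed.

Definition in_rect (a b c d : R) (z : C) : Prop :=
  (Rmin a b <= Re z <= Rmax a b)%R /\ (Rmin c d <= Im z <= Rmax c d)%R.

Lemma Rmin_max_l a b : (Rmin a b <= a <= Rmax a b)%R.
Proof. split; [apply Rmin_l | apply Rmax_l]. Qed.

Lemma Rmin_max_r a b : (Rmin a b <= b <= Rmax a b)%R.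
Proof. split; [apply Rmin_r | apply Rmax_r]. Qed.

Section Rectangle.
Variables (F : C -> C).

Lemma rect_con a b c d : (forall z, in_rect a b c d z -> continuous F z) ->
  forall a' b' c' d', in_rect a b c d (a', c') -> in_rect a b c d (b', d') ->
  con (fun s => F (s, c')) a' b' /\ con (fun s => F (s, d')) a' b' /\
  con (fun s => F (a', s)) c' d' /\ con (fun s => F (b', s)) c' d'.
Proof.
  intros H a' b' c' d' [H1 H2] [H3 H4]. simpl in *.
  assert (K : forall u v p q x, (Rmin u v <= p <= Rmax u v)%R -> (Rmin u v <= q <= Rmax u v)%R ->
    (Rmin p q <= x <= Rmax p q)%R -> (Rmin u v <= x <= Rmax u v)%R).
  { intros u v p q x Hp Hq [Hx Hx']. split.
    - eapply Rle_trans; [|exact Hx]. apply Rmin_glb; tauto.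
    - eapply Rle_trans; [exact Hx'|]. apply Rmax_lub; tauto. }
  repeat split; intros x Hx; (apply cont_hor || apply cont_ver); apply H; split; simpl; eauto.
Qed.

Lemma rect_int_split a b c d m n :
  (forall z, in_rect a b c d z -> continuous F z) ->
  (Rmin a b <= m <= Rmax a b)%R -> (Rmin c d <= n <= Rmax c d)%R ->
  rect_int F a b c d = rect_int F a m c n + rect_int F m b c n
                     + (rect_int F a m n d + rect_int F m b n d).
Proof.
  intros H Hm Hn. unfold rect_int.
  pose proof (Rmin_max_l a b) as Ha. pose proof (Rmin_max_r a b) as Hb.
  pose proof (Rmin_max_l c d) as Hc. pose proof (Rmin_max_r c d) as Hd.
  assert (K : forall p q r s, (Rmin a b <= p <= Rmax a b)%R -> (Rmin a b <= q <= Rmax a b)%R ->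
    (Rmin c d <= r <= Rmax c d)%R -> (Rmin c d <= s <= Rmax c d)%R ->
    con (fun t => F (t, r)) p q /\ con (fun t => F (t, s)) p q /\
    con (fun t => F (p, t)) r s /\ con (fun t => F (q, t)) r s).
  { intros p q r s Hp Hq Hr Hs. apply (rect_con a b c d H p q r s); split; simpl; assumption. }
  destruct (K a m c n Ha Hm Hc Hn) as (A1 & A2 & A3 & A4).
  destruct (K m b n d Hm Hb Hn Hd) as (B1 & B2 & B3 & B4).
  destruct (K a m n d Ha Hm Hn Hd) as (C1 & C2 & C3 & C4).
  destruct (K m b c n Hm Hb Hc Hn) as (D1 & D2 & D3 & D4).
  rewrite <- (CInt_Chasles (fun s => F (s, c)) a m b) by assumption.
  rewrite <- (CInt_Chasles (fun s => F (s, d)) a m b) by assumption.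
  rewrite <- (CInt_Chasles (fun s => F (b, s)) c n d) by assumption.
  rewrite <- (CInt_Chasles (fun s => F (a, s)) c n d) by assumption.
  ring.
Qed.

Lemma rect_int_primitive (P : C -> C) a b c d :
  (forall z, in_rect a b c d z -> cder P z (F z)) ->
  (forall z, in_rect a b c d z -> continuous F z) ->
  rect_int F a b c d = 0.
Proof.
  intros HP H.
  pose proof (Rmin_max_l a b) as Ha. pose proof (Rmin_max_r a b) as Hb.
  pose proof (Rmin_max_l c d) as Hc. pose proof (Rmin_max_r c d) as Hd.
  destruct (rect_con a b c d H a b c d) as (A1 & A2 & A3 & A4); [split; assumption..|].
  assert (Hh : forall y, (Rmin c d <= y <= Rmax c d)%R -> con (fun s => F (s, y)) a b ->
    CInt (fun s => F (s, y)) a b = P (b, y) - P (a, y)).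
  { intros y Hy Hcn. apply (CInt_FTC (fun s => P (s, y))); [|exact Hcn].
    intros x Hx. eapply gder_eq; [|apply (gder_comp RtoC (fun s => (s, y) : C) P x 1 (F (x, y)))].
    - ring.
    - apply rder_hor.
    - apply HP. split; assumption. }
  assert (Hv : forall x, (Rmin a b <= x <= Rmax a b)%R -> con (fun s => F (x, s)) c d ->
    Ci * CInt (fun s => F (x, s)) c d = P (x, d) - P (x, c)).
  { intros x Hx Hcn. rewrite <- CInt_scal by exact Hcn.
    apply (CInt_FTC (fun s => P (x, s))); [|apply con_scal; exact Hcn].
    intros y Hy. eapply gder_eq; [|apply (gder_comp RtoC (fun s => (x, s) : C) P y Ci (F (x, y)))].
    - ring.
    - apply rder_ver.
    - apply HP. split; assumption. }
  unfold rect_int. rewrite (Hh c Hc A1), (Hh d Hd A2).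
  transitivity (P (b, c) - P (a, c) - (P (b, d) - P (a, d))
    + (Ci * CInt (fun s => F (b, s)) c d - Ci * CInt (fun s => F (a, s)) c d)); [ring|].
  rewrite (Hv b Hb A4), (Hv a Ha A3). ring.
Qed.

Lemma rect_int_bound a b c d M : (a <= b)%R -> (c <= d)%R ->
  (forall z, in_rect a b c d z -> continuous F z) ->
  (forall z, in_rect a b c d z -> (Cmod (F z) <= M)%R) ->
  (Cmod (rect_int F a b c d) <= 2 * ((b - a) + (d - c)) * M)%R.
Proof.
  intros Hab Hcd H HM.
  pose proof (Rmin_max_l a b) as Ha. pose proof (Rmin_max_r a b) as Hb.
  pose proof (Rmin_max_l c d) as Hc. pose proof (Rmin_max_r c d) as Hd.
  destruct (rect_con a b c d H a b c d) as (A1 & A2 & A3 & A4); [split; assumption..|].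
  unfold rect_int.
  eapply Rle_trans; [apply Cmod_triangle|]. rewrite Cmod_mult, Cmod_Ci, Rmult_1_l.
  assert (I : forall x y, (a <= x <= b)%R -> (c <= y <= d)%R -> in_rect a b c d (x, y)).
  { intros x y Hx Hy. split; simpl; rewrite Rmin_left, Rmax_right; assumption. }
  pose proof (Cmod_triangle_sub (CInt (fun s => F (s, c)) a b) (CInt (fun s => F (s, d)) a b)).
  pose proof (Cmod_triangle_sub (CInt (fun s => F (b, s)) c d) (CInt (fun s => F (a, s)) c d)).
  assert (Cmod (CInt (fun s => F (s, c)) a b) <= (b - a) * M)%R
    by (apply CInt_bound_le; auto; intros; apply HM, I; lra).
  assert (Cmod (CInt (fun s => F (s, d)) a b) <= (b - a) * M)%R
    by (apply CInt_bound_le; auto; intros; apply HM, I; lra).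
  assert (Cmod (CInt (fun s => F (b, s)) c d) <= (d - c) * M)%R
    by (apply CInt_bound_le; auto; intros; apply HM, I; lra).
  assert (Cmod (CInt (fun s => F (a, s)) c d) <= (d - c) * M)%R
    by (apply CInt_bound_le; auto; intros; apply HM, I; lra).
  lra.
Qed.
End Rectangle.

Lemma rect_int_minus F G a b c d :
  (forall z, in_rect a b c d z -> continuous F z) ->
  (forall z, in_rect a b c d z -> continuous G z) ->
  rect_int (fun z => F z - G z) a b c d = rect_int F a b c d - rect_int G a b c d.
Proof.
  intros HF HG.
  pose proof (Rmin_max_l a b) as Ha. pose proof (Rmin_max_r a b) as Hb.
  pose proof (Rmin_max_l c d) as Hc. pose proof (Rmin_max_r c d) as Hd.
  destruct (rect_con F a b c d HF a b c d) as (A1 & A2 & A3 & A4); [split; assumption..|].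
  destruct (rect_con G a b c d HG a b c d) as (B1 & B2 & B3 & B4); [split; assumption..|].
  unfold rect_int. rewrite !CInt_minus by assumption. ring.
Qed.

Section Goursat.
Variables (F : C -> C) (eps : R).
Hypothesis Heps : (0 < eps)%R.

Record quad := Quad { qa : R; qb : R; qc : R; qd : R }.

Definition qsize (q : quad) : R := ((qb q - qa q) + (qd q - qc q))%R.

Definition qsub (q r : quad) : Prop :=
  (qa r <= qa q)%R /\ (qb q <= qb r)%R /\ (qc r <= qc q)%R /\ (qd q <= qd r)%R.

(** The threshold is quadratic in the size, so halving the sides divides it by four, the number of
    pieces: some quarter of a bad rectangle is bad again. *)
Definition bad (q : quad) : Prop :=
  (qa q <= qb q)%R /\ (qc q <= qd q)%R /\
  (forall z, in_rect (qa q) (qb q) (qc q) (qd q) z -> exists l, cder F z l) /\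
  (eps * qsize q ^ 2 < Cmod (rect_int F (qa q) (qb q) (qc q) (qd q)))%R.

Lemma bad_step (q : quad) : bad q ->
  exists r, bad r /\ qsub r q /\ qsize r = (qsize q / 2)%R.
Proof.
  destruct q as [a b c d]. unfold bad, qsub, qsize; cbn [qa qb qc qd]. intros (Hab & Hcd & Hd & HB).
  set (m := ((a + b) / 2)%R). set (n := ((c + d) / 2)%R).
  assert (Hm : (a <= m <= b)%R) by (unfold m; lra).
  assert (Hn : (c <= n <= d)%R) by (unfold n; lra).
  assert (Hcont : forall z, in_rect a b c d z -> continuous F z).
  { intros z Hz. destruct (Hd z Hz) as [l Hl]. exact (cder_cont _ _ _ Hl). }
  rewrite (rect_int_split F a b c d m n Hcont) in HB;
    [|rewrite Rmin_left, Rmax_right; assumption|rewrite Rmin_left, Rmax_right; assumption].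
  assert (D : forall a' b' c' d', (a <= a' <= b')%R -> (b' <= b)%R -> (c <= c' <= d')%R -> (d' <= d)%R ->
    forall z, in_rect a' b' c' d' z -> exists l, cder F z l).
  { intros a' b' c' d' H1 H2 H3 H4 z [Hz1 Hz2]. apply Hd.
    rewrite Rmin_left, Rmax_right in Hz1, Hz2 by lra.
    split; rewrite Rmin_left, Rmax_right; lra. }
  set (T := (eps * (b - a + (d - c)) ^ 2)%R) in HB.
  assert (ET : forall u v : R, (u = (b - a) / 2 -> v = (d - c) / 2 -> eps * (u + v) ^ 2 = T / 4)%R).
  { intros u v -> ->. unfold T. field. }
  pose proof (Cmod_triangle (rect_int F a m c n + rect_int F m b c n) (rect_int F a m n d + rect_int F m b n d)) as T1.
  pose proof (Cmod_triangle (rect_int F a m c n) (rect_int F m b c n)) as T2.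
  pose proof (Cmod_triangle (rect_int F a m n d) (rect_int F m b n d)) as T3.
  destruct (Rlt_dec (T / 4) (Cmod (rect_int F a m c n))) as [H1|H1].
  { exists (Quad a m c n); cbn [qa qb qc qd]. split; [split; [lra|split; [lra|split]]|split; [lra|]].
    - apply D; lra.
    - rewrite (ET (m - a)%R (n - c)%R); [exact H1| unfold m; lra | unfold n; lra].
    - unfold m, n; lra. }
  destruct (Rlt_dec (T / 4) (Cmod (rect_int F m b c n))) as [H2|H2].
  { exists (Quad m b c n); cbn [qa qb qc qd]. split; [split; [lra|split; [lra|split]]|split; [lra|]].
    - apply D; lra.
    - rewrite (ET (b - m)%R (n - c)%R); [exact H2| unfold m; lra | unfold n; lra].
    - unfold m, n; lra. }
  destruct (Rlt_dec (T / 4) (Cmod (rect_int F a m n d))) as [H3|H3].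
  { exists (Quad a m n d); cbn [qa qb qc qd]. split; [split; [lra|split; [lra|split]]|split; [lra|]].
    - apply D; lra.
    - rewrite (ET (m - a)%R (d - n)%R); [exact H3| unfold m; lra | unfold n; lra].
    - unfold m, n; lra. }
  destruct (Rlt_dec (T / 4) (Cmod (rect_int F m b n d))) as [H4|H4].
  { exists (Quad m b n d); cbn [qa qb qc qd]. split; [split; [lra|split; [lra|split]]|split; [lra|]].
    - apply D; lra.
    - rewrite (ET (b - m)%R (d - n)%R); [exact H4| unfold m; lra | unfold n; lra].
    - unfold m, n; lra. }
  exfalso. lra.
Qed.

(** Nested bad quarters shrink to a point [z0] where [F] is differentiable. There [F] differs from
    an affine function by [o(|z - z0|)], and affine functions have primitives, so the integral is
    small compared with the squared size. *)
Lemma not_bad (q0 : quad) : ~ bad q0.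
Proof.
  intros H0.
  pose (step := fun q : {q | bad q} =>
    let (r, Hr) := constructive_indefinite_description _ (bad_step (proj1_sig q) (proj2_sig q)) in
    exist bad r (proj1 Hr)).
  assert (Hstep : forall q, qsub (proj1_sig (step q)) (proj1_sig q) /\
    qsize (proj1_sig (step q)) = (qsize (proj1_sig q) / 2)%R).
  { intros q. unfold step. destruct constructive_indefinite_description as [r Hr].
    simpl. exact (proj2 Hr). }
  pose (sq := fix sq (n : nat) : {q | bad q} :=
    match n with O => exist bad q0 H0 | S n => step (sq n) end).
  pose (u := fun n => proj1_sig (sq n)).
  assert (Hbad : forall n, bad (u n)) by (intros n; exact (proj2_sig (sq n))).
  assert (Hsub1 : forall n, qsub (u (S n)) (u n)) by (intros n; apply (Hstep (sq n))).
  assert (Hsz : forall n, qsize (u n) = (qsize q0 * (/ 2) ^ n)%R).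
  { induction n as [|n IH]; [change (u O) with q0; simpl; ring|].
    transitivity (qsize (u n) / 2)%R; [exact (proj2 (Hstep (sq n)))|].
    rewrite IH. simpl. field. }
  assert (Hsub : forall k n, qsub (u (n + k)%nat) (u n)).
  { induction k as [|k IH]; intros n.
    - rewrite Nat.add_0_r. unfold qsub; lra.
    - rewrite Nat.add_succ_r. specialize (IH n). specialize (Hsub1 (n + k)%nat).
      unfold qsub in *; lra. }
  assert (Hcross : forall m n, (qa (u m) <= qb (u n))%R /\ (qc (u m) <= qd (u n))%R).
  { intros m n. pose proof (Hsub n m) as S1. pose proof (Hsub m n) as S2.
    rewrite Nat.add_comm in S2. destruct (Hbad (m + n)%nat) as (B1 & B2 & _).
    unfold qsub in *; lra. }
  destruct (completeness (fun x => exists n, x = qa (u n))) as [x [Hx1 Hx2]].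
  { exists (qb (u O)). intros y [n ->]. apply Hcross. }
  { exists (qa (u O)), O. reflexivity. }
  destruct (completeness (fun x => exists n, x = qc (u n))) as [y [Hy1 Hy2]].
  { exists (qd (u O)). intros y [n ->]. apply Hcross. }
  { exists (qc (u O)), O. reflexivity. }
  assert (Hin : forall n, (qa (u n) <= x <= qb (u n))%R /\ (qc (u n) <= y <= qd (u n))%R).
  { intros n. repeat split.
    - apply Hx1. exists n; reflexivity.
    - apply Hx2. intros z [m ->]. apply Hcross.
    - apply Hy1. exists n; reflexivity.
    - apply Hy2. intros z [m ->]. apply Hcross. }
  destruct (Hbad O) as (B1 & B2 & B3 & _).
  destruct (B3 (x, y)) as [l Hl].
  { destruct (Hin O) as [I1 I2].
    split; simpl; rewrite Rmin_left, Rmax_right; lra. }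
  (* An error of [eps / 2] times a distance bounded by the size, along a perimeter of twice the
     size, gives [eps] times the squared size: the negation of [bad]. *)
  destruct (Hl (eps / 2)%R) as [dl [Hdl HL]]; [lra|].
  assert (HS0 : (0 <= qsize q0)%R).
  { pose proof H0 as (A1 & A2 & _). unfold qsize; lra. }
  destruct (pow_lt_1_zero (/ 2)%R ltac:(rewrite Rabs_pos_eq; lra) (dl / (qsize q0 + 1))%R) as [N HN].
  { apply Rdiv_lt_0_compat; lra. }
  assert (Hsmall : (qsize (u N) < dl)%R).
  { specialize (HN N (Nat.le_refl N)). rewrite Hsz.
    rewrite Rabs_pos_eq in HN by (apply pow_le; lra).
    assert (0 <= (/ 2) ^ N)%R by (apply pow_le; lra).
    apply Rmult_lt_compat_r with (r := (qsize q0 + 1)%R) in HN; [|lra].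
    unfold Rdiv in HN. rewrite Rmult_assoc, Rinv_l in HN by lra. nra. }
  destruct (Hbad N) as (C1 & C2 & C3 & C4). destruct (Hin N) as [I1 I2].
  destruct (u N) as [a b c d] eqn:EN; simpl in *.
  unfold qsize in *; simpl in *.
  assert (Hcont : forall z, in_rect a b c d z -> continuous F z).
  { intros z Hz. destruct (C3 z Hz) as [l' Hl']. exact (cder_cont _ _ _ Hl'). }
  set (z0 := (x, y) : C) in *.
  pose (A := fun z => F z0 + (z - z0) * l).
  assert (HA : forall z, cder A z l).
  { intros z. unfold A.
    eapply gder_eq; [|apply gder_plus; [apply gder_const|
      apply gder_mult; [apply gder_minus; [apply gder_id | apply gder_const] | apply gder_const]]].
    cbv beta. ring. }
  assert (HAP : forall z, cder (fun z => F z0 * z + l * (RtoC (/ 2) * ((z - z0) * (z - z0)))) z (A z)).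
  { intros z. unfold A.
    eapply gder_eq; [|apply gder_plus; [apply cder_scal|apply gder_scal, gder_scal;
      apply gder_mult; apply gder_minus; try apply gder_id; apply gder_const]].
    apply injective_projections; simpl; field. }
  assert (HcA : forall z, in_rect a b c d z -> continuous A z).
  { intros z _. exact (cder_cont _ _ _ (HA z)). }
  assert (E : rect_int F a b c d = rect_int (fun z => F z - A z) a b c d).
  { rewrite rect_int_minus by assumption.
    rewrite (rect_int_primitive A _ a b c d (fun z _ => HAP z) HcA). ring. }
  rewrite E in C4. clear E.
  assert (Hb : (Cmod (rect_int (fun z => F z - A z)%C a b c d)
    <= 2 * ((b - a) + (d - c)) * (eps / 2 * ((b - a) + (d - c))))%R).
  { apply rect_int_bound; auto.
    - intros z Hz. apply cont_minus; auto.
    - intros z [Hz1 Hz2]. rewrite Rmin_left, Rmax_right in Hz1, Hz2 by assumption.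
      assert (Hzz : (Cmod (z - z0) <= (b - a) + (d - c))%R).
      { replace (z - z0) with (RtoC (Re z - x) + Ci * RtoC (Im z - y)).
        2:{ unfold z0. apply injective_projections; simpl; unfold Re, Im; ring. }
        eapply Rle_trans; [apply Cmod_triangle|].
        rewrite Cmod_mult, Cmod_Ci, !Cmod_R, Rmult_1_l.
        apply Rplus_le_compat; apply Rabs_le; lra. }
      unfold A. replace (F z - (F z0 + (z - z0) * l)) with (F z - F z0 - (z - z0) * l) by ring.
      eapply Rle_trans; [apply HL; lra|]. apply Rmult_le_compat_l; lra. }
  simpl in C4. lra.
Qed.
End Goursat.

Lemma Goursat_le F a b c d : (a <= b)%R -> (c <= d)%R ->
  (forall z, in_rect a b c d z -> exists l, cder F z l) -> rect_int F a b c d = 0.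
Proof.
  intros Hab Hcd H. apply Cmod_eq_0.
  destruct (Rle_lt_or_eq_dec _ _ (Cmod_ge_0 (rect_int F a b c d))) as [Hp|Hz]; [|auto].
  exfalso.
  set (S := ((b - a) + (d - c))%R).
  assert (0 <= S)%R by (unfold S; lra).
  assert (HS : (0 < S ^ 2 + 1)%R) by nra.
  (* The divisor [S^2 + 1] makes the threshold strictly smaller than the integral, also for a
     degenerate rectangle. *)
  refine (not_bad F (Cmod (rect_int F a b c d) / (S ^ 2 + 1)) _ (Quad a b c d) _).
  { apply Rdiv_lt_0_compat; assumption. }
  repeat split; auto. unfold qsize; cbn [qa qb qc qd]. fold S.
  set (m := Cmod (rect_int F a b c d)) in *.
  replace (m / (S ^ 2 + 1) * S ^ 2)%R with (m - m / (S ^ 2 + 1))%R by (field; lra).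
  pose proof (Rdiv_lt_0_compat m (S ^ 2 + 1) Hp HS). lra.
Qed.

(** Reversing an interval only changes the sign. All orientations are wanted because the primitive
    below uses rectangles with corners 0 and [z] in every quadrant. *)
Lemma Goursat F a b c d :
  (forall z, in_rect a b c d z -> exists l, cder F z l) -> rect_int F a b c d = 0.
Proof.
  intros H.
  assert (Hc : forall z, in_rect a b c d z -> continuous F z).
  { intros z Hz. destruct (H z Hz) as [l Hl]. exact (cder_cont _ _ _ Hl). }
  assert (S1 : rect_int F b a c d = - rect_int F a b c d /\ rect_int F a b d c = - rect_int F a b c d
     /\ rect_int F b a d c = rect_int F a b c d).
  { destruct (rect_con F a b c d Hc a b c d) as (A1 & A2 & A3 & A4);
      [split; (apply Rmin_max_l || apply Rmin_max_r)..|].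
    unfold rect_int. rewrite !(CInt_swap _ a b), !(CInt_swap _ c d) by assumption.
    repeat split; ring. }
  destruct S1 as (S1 & S2 & S3).
  assert (O1 : forall z, in_rect b a c d z -> in_rect a b c d z).
  { intros z [? ?]. split; [rewrite Rmin_comm, Rmax_comm|]; assumption. }
  assert (O2 : forall z, in_rect a b d c z -> in_rect a b c d z).
  { intros z [? ?]. split; [|rewrite Rmin_comm, Rmax_comm]; assumption. }
  assert (O3 : forall z, in_rect b a d c z -> in_rect a b c d z).
  { intros z [? ?]. split; rewrite Rmin_comm, Rmax_comm; assumption. }
  destruct (Rle_dec a b) as [Hab|Hab]; destruct (Rle_dec c d) as [Hcd|Hcd].
  - apply Goursat_le; auto.
  - replace (rect_int F a b c d) with (- - rect_int F a b c d) by ring. rewrite <- S2.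
    rewrite Goursat_le; [ring|lra|lra|auto].
  - replace (rect_int F a b c d) with (- - rect_int F a b c d) by ring. rewrite <- S1.
    rewrite Goursat_le; [ring|lra|lra|auto].
  - rewrite <- S3. apply Goursat_le; [lra|lra|auto].
Qed.

(** * Cauchy's formula *)

Lemma RtoC_neq (x : R) : x <> 0%R -> RtoC x <> 0.
Proof. intros H E. apply H. injection E. auto. Qed.

Definition holo (F : C -> C) (rho : R) : Prop :=
  forall z, (Cmod z < rho)%R -> exists l, cder F z l.

Lemma holo_cont F rho z : holo F rho -> (Cmod z < rho)%R -> continuous F z.
Proof. intros H Hz. destruct (H z Hz) as [l Hl]. exact (cder_cont _ _ _ Hl). Qed.

Lemma Cmod_le_parts (z : C) (x y : R) :
  (Rabs (Re z) <= Rabs x)%R -> (Rabs (Im z) <= Rabs y)%R -> (Cmod z <= Cmod (x, y))%R.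
Proof.
  intros Hx Hy. unfold Cmod. apply sqrt_le_1_alt. simpl.
  rewrite !Rmult_1_r. apply Rplus_le_compat.
  - apply (Rsqr_le_abs_1 (fst z) x Hx).
  - apply (Rsqr_le_abs_1 (snd z) y Hy).
Qed.

Lemma between_0_abs x s : (Rmin 0 x <= s <= Rmax 0 x)%R -> (Rabs s <= Rabs x)%R.
Proof.
  intros H. unfold Rmin, Rmax, Rabs in *. destruct (Rle_dec 0 x); repeat destruct Rcase_abs; lra.
Qed.

Lemma between_abs u x s : (Rmin u x <= s <= Rmax u x)%R -> (Rabs (s - u) <= Rabs (x - u))%R.
Proof.
  intros H. unfold Rmin, Rmax, Rabs in *. destruct (Rle_dec u x); repeat destruct Rcase_abs; lra.
Qed.

Lemma im_le_Cmod (z : C) : (Rabs (Im z) <= Cmod z)%R.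
Proof. eapply Rle_trans; [|apply Rmax_Cmod]. apply Rmax_r. Qed.

Lemma Cmod_le_sum (z : C) : (Cmod z <= Rabs (Re z) + Rabs (Im z))%R.
Proof.
  replace z with (RtoC (Re z) + Ci * RtoC (Im z)) at 1.
  2:{ apply injective_projections; simpl; unfold Re, Im; ring. }
  eapply Rle_trans; [apply Cmod_triangle|]. rewrite Cmod_mult, Cmod_Ci, !Cmod_R. lra.
Qed.

(** The primitive integrates [F] from 0 horizontally and then vertically, inside a rectangle that
    stays in the disc. Goursat's theorem equates this with the path in the other order ([Alt]), so
    that each coordinate increment becomes an integral over one short segment. *)
Lemma holo_primitive F rho : holo F rho ->
  exists P, forall z, (Cmod z < rho)%R -> cder P z (F z).
Proof.
  intros HF.
  assert (Hc : forall z, (Cmod z < rho)%R -> continuous F z) by (intros; eapply holo_cont; eauto).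
  pose (P := fun z : C => CInt (fun s => F (s, 0%R)) 0 (Re z) + Ci * CInt (fun s => F (Re z, s)) 0 (Im z)).
  exists P. intros z0 Hz0.
  set (x0 := Re z0). set (y0 := Im z0).
  assert (Ez0 : z0 = (x0, y0)) by (destruct z0; reflexivity).
  assert (Hin : forall z w : C, (Cmod z < rho)%R -> in_rect 0 (Re z) 0 (Im z) w -> (Cmod w < rho)%R).
  { intros z w Hz [H1 H2]. eapply Rle_lt_trans; [|exact Hz].
    destruct z as [x y]. apply Cmod_le_parts; apply between_0_abs; assumption. }
  assert (Alt : forall x y, (Cmod (x, y) < rho)%R ->
    P (x, y) = CInt (fun s => F (s, y)) 0 x + Ci * CInt (fun s => F (0%R, s)) 0 y).
  { intros x y Hxy.
    assert (E : rect_int F 0 x 0 y = 0).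
    { apply Goursat. intros w Hw. apply HF, (Hin (x, y) w Hxy Hw). }
    unfold rect_int in E. unfold P. simpl.
    match type of E with ?a - ?b + Ci * (?c - ?d) = _ =>
      transitivity (b + Ci * d + (a - b + Ci * (c - d))); [ring | rewrite E; ring] end. }
  assert (Con_v : forall x y, (Cmod (x, y) < rho)%R -> con (fun s => F (x, s)) 0 y).
  { intros x y Hxy s Hs. apply cont_ver, Hc, (Hin (x, y) _ Hxy). split; simpl; [|exact Hs].
    apply Rmin_max_r. }
  assert (Con_h : forall x y, (Cmod (x, y) < rho)%R -> con (fun s => F (s, y)) 0 x).
  { intros x y Hxy s Hs. apply cont_hor, Hc, (Hin (x, y) _ Hxy). split; simpl; [exact Hs|].
    apply Rmin_max_r. }
  intros eps Heps.
  destruct (HF z0 Hz0) as [l Hl].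
  destruct (gder_cont _ _ _ _ Hl (eps / 2)%R ltac:(lra)) as [d [Hd Hdc]].
  exists (Rmin d (rho - Cmod z0)). split; [apply Rmin_glb_lt; lra|].
  intros z Hz. destruct z as [x y].
  assert (Hz1 : (Cmod ((x, y) - z0) < d)%R) by (eapply Rlt_le_trans; [exact Hz | apply Rmin_l]).
  assert (Hz2 : (Cmod ((x, y) - z0) < rho - Cmod z0)%R) by (eapply Rlt_le_trans; [exact Hz | apply Rmin_r]).
  assert (Hnear : forall w : C, (Cmod (w - z0) <= Cmod ((x, y) - z0))%R -> (Cmod w < rho)%R /\ (Cmod (F w - F z0) <= eps / 2)%R).
  { intros w Hw. split.
    - pose proof (Cmod_triangle (w - z0) z0). replace (w - z0 + z0) with w in H by ring. lra.
    - apply Rlt_le, Hdc. lra. }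
  assert (Hpx : forall s, (Rmin x0 x <= s <= Rmax x0 x)%R -> (Cmod (((s, y0) : C) - z0) <= Cmod ((x, y) - z0))%R).
  { intros s Hs. rewrite Ez0. unfold Cminus, Cplus; simpl. apply Cmod_le_parts; simpl.
    - apply between_abs; exact Hs.
    - rewrite Rplus_opp_r, Rabs_R0. apply Rabs_pos. }
  assert (Hpy : forall s, (Rmin y0 y <= s <= Rmax y0 y)%R -> (Cmod (((x, s) : C) - z0) <= Cmod ((x, y) - z0))%R).
  { intros s Hs. rewrite Ez0. unfold Cminus, Cplus; simpl. apply Cmod_le_parts; simpl.
    - apply Rle_refl.
    - apply between_abs; exact Hs. }
  assert (Ez : (Cmod ((x, y) : C) < rho)%R) by (apply Hnear, Rle_refl).
  assert (Ez' : (Cmod ((x, y0) : C) < rho)%R) by (apply Hnear, Hpx, Rmin_max_r).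
  assert (C0 : (Cmod ((x0, y0) : C) < rho)%R) by (rewrite <- Ez0; exact Hz0).
  assert (CH : con (fun s => F (s, y0)) x0 x).
  { intros s Hs. apply cont_hor, Hc, Hnear, Hpx, Hs. }
  assert (CV : con (fun s => F (x, s)) y0 y).
  { intros s Hs. apply cont_ver, Hc, Hnear, Hpy, Hs. }
  assert (E1 : P (x, y) - P (x, y0) = Ci * CInt (fun s => F (x, s)) y0 y).
  { unfold P. simpl. rewrite <- (CInt_Chasles (fun s => F (x, s)) 0 y0 y); [ring| |exact CV].
    apply Con_v; exact Ez'. }
  assert (E2 : P (x, y0) - P (x0, y0) = CInt (fun s => F (s, y0)) x0 x).
  { rewrite !Alt by assumption. rewrite <- (CInt_Chasles (fun s => F (s, y0)) 0 x0 x); [ring| |exact CH].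
    apply Con_h; exact C0. }
  assert (E3 : P (x, y) - P z0 - ((x, y) - z0) * F z0 =
    CInt (fun s => F (s, y0) - F z0) x0 x + Ci * CInt (fun s => F (x, s) - F z0) y0 y).
  { rewrite !CInt_minus, !CInt_const by (assumption || (intros ? _; apply cont_const)).
    rewrite <- E2. rewrite Ez0 at 1.
    transitivity ((P (x, y) - P (x, y0)) + (P (x, y0) - P (x0, y0)) - ((x, y) - z0) * F z0); [ring|].
    rewrite E1. rewrite Ez0 at 1.
    replace (((x, y) : C) - (x0, y0)) with (RtoC (x - x0) + Ci * RtoC (y - y0)).
    2:{ apply injective_projections; simpl; ring. }
    ring. }
  rewrite E3.
  assert (B1 : (Cmod (CInt (fun s => F (s, y0) - F z0)%C x0 x) <= Rabs (x - x0) * (eps / 2))%R).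
  { apply CInt_bound.
    - intros s Hs. apply cont_minus; [apply CH, Hs | apply cont_const].
    - intros s Hs. apply Hnear, Hpx, Hs. }
  assert (B2 : (Cmod (CInt (fun s => F (x, s) - F z0)%C y0 y) <= Rabs (y - y0) * (eps / 2))%R).
  { apply CInt_bound.
    - intros s Hs. apply cont_minus; [apply CV, Hs | apply cont_const].
    - intros s Hs. apply Hnear, Hpy, Hs. }
  eapply Rle_trans; [apply Cmod_triangle|]. rewrite Cmod_mult, Cmod_Ci, Rmult_1_l.
  pose proof (re_le_Cmod ((x, y) - z0)) as R1. pose proof (im_le_Cmod ((x, y) - z0)) as R2.
  change (Rabs (x - x0) <= Cmod ((x, y) - z0))%R in R1.
  change (Rabs (y - y0) <= Cmod ((x, y) - z0))%R in R2.
  apply Rmult_le_compat_r with (r := (eps / 2)%R) in R1; [|lra].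
  apply Rmult_le_compat_r with (r := (eps / 2)%R) in R2; [|lra].
  lra.
Qed.

Definition circ (r t : R) : C := RtoC r * expi t.

Lemma rder_circ r t : rder (circ r) t (Ci * circ r t).
Proof.
  eapply gder_eq; [|apply gder_scal, rder_expi]. unfold circ. ring.
Qed.

Lemma cont_circ r t : continuous (circ r) t.
Proof. exact (rder_cont _ _ _ (rder_circ r t)). Qed.

Lemma Cmod_circ r t : (0 <= r)%R -> Cmod (circ r t) = r.
Proof. intros H. unfold circ. rewrite Cmod_mult, Cmod_expi, Cmod_R, Rabs_pos_eq by exact H. ring. Qed.

Lemma circ_2PI r : circ r (2 * PI) = circ r 0.
Proof. unfold circ. rewrite <- (expi_2PI 0), Rplus_0_l. reflexivity. Qed.

Lemma circ_neq r t z : (0 <= r)%R -> (Cmod z < r)%R -> circ r t - z <> 0.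
Proof.
  intros Hr Hz E. assert (H : circ r t = z) by (rewrite <- (Cplus_0_r z), <- E; ring).
  rewrite <- H, Cmod_circ in Hz by exact Hr. lra.
Qed.

Lemma two_PI_pos : (0 < 2 * PI)%R.
Proof. pose proof PI_RGT_0. lra. Qed.

Lemma Cmod_segment (z w : C) (t M : R) : (0 <= t <= 1)%R -> (Cmod z < M)%R -> (Cmod w < M)%R ->
  (Cmod (z + RtoC t * (w - z)) < M)%R.
Proof.
  intros Ht Hz Hw.
  replace (z + RtoC t * (w - z)) with (RtoC (1 - t) * z + RtoC t * w) by (rewrite RtoC_minus; ring).
  eapply Rle_lt_trans; [apply Cmod_triangle|].
  rewrite !Cmod_mult, !Cmod_R, !Rabs_pos_eq by lra.
  destruct (Req_dec t 0) as [->|H0]; [lra|]. nra.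
Qed.

Lemma cder_zero_const F rho z w :
  (forall u, (Cmod u < rho)%R -> cder F u 0) -> (Cmod z < rho)%R -> (Cmod w < rho)%R -> F z = F w.
Proof.
  intros H Hz Hw.
  pose proof (rder_zero_const (fun t => F (z + RtoC t * (w - z))) 0 1) as K.
  simpl in K. rewrite !Cmult_0_l, !Cmult_1_l, Cplus_0_r in K.
  replace (z + (w - z)) with w in K by ring. apply K.
  intros t Ht. rewrite Rmin_left, Rmax_right in Ht by lra.
  eapply gder_eq; [|apply (gder_comp RtoC (fun t => z + RtoC t * (w - z)) F t (w - z) 0)].
  - ring.
  - eapply gder_eq; [|apply gder_plus; [apply gder_const | apply gder_mult; [apply gder_id | apply gder_const]]].
    cbv beta. ring.
  - apply H. apply Cmod_segment; assumption.
Qed.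

(** The [z]-derivative of the integrand is, up to a constant factor, the [t]-derivative of the
    [2 PI]-periodic function [1 / (zeta - z)]. The integral is therefore constant in [z] and equals
    its value at 0. *)
Lemma mean_kernel r z : (Cmod z < r)%R ->
  CInt (fun t => circ r t / (circ r t - z)) 0 (2 * PI) = RtoC (2 * PI).
Proof.
  intros Hz.
  pose proof (Cmod_ge_0 z) as Hz0. pose proof two_PI_pos as HPI.
  pose (I := fun z => CInt (fun t => circ r t / (circ r t - 1 * z)) 0 (2 * PI)).
  assert (HI : forall u, (Cmod u < r)%R -> cder I u 0).
  { intros u Hu.
    pose proof (cder_kernel1 (circ r) (circ r) (fun _ => 1) 0 (2 * PI) u (Rlt_le _ _ HPI)
      (fun t _ => cont_circ r t) (fun t _ => cont_circ r t) (fun t _ => cont_const 1 t)) as K.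
    eapply gder_eq; [|apply K].
    - assert (N : forall t, circ r t - u <> 0) by (intros; apply circ_neq; lra).
      transitivity (Ci * CInt (fun t => - (Ci * circ r t) / ((circ r t - u) * (circ r t - u))) 0 (2 * PI)).
      + rewrite <- CInt_scal.
        * apply CInt_ext. intros t _. replace (circ r t - 1 * u) with (circ r t - u) by ring.
          unfold Cdiv. generalize (/ ((circ r t - u) * (circ r t - u))). intros c.
          apply injective_projections; simpl; ring.
        * intros t _. assert (continuous (fun t => circ r t - u) t)
            by (apply cont_minus; [apply cont_circ | apply cont_const]).
          apply cont_div; [apply cont_opp, cont_mult; [apply cont_const | apply cont_circ]|apply cont_mult; assumption|].
          apply Cmult_neq_0; apply N.
      + rewrite (CInt_FTC (fun t => / (circ r t - u))).
        * rewrite circ_2PI. ring.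
        * intros t _. apply (gder_inv RtoC (fun t => circ r t - u)); [apply N|].
          eapply gder_eq; [|apply gder_minus; [apply rder_circ | apply gder_const]]. ring.
        * intros t _. assert (continuous (fun t => circ r t - u) t)
            by (apply cont_minus; [apply cont_circ | apply cont_const]).
          apply cont_div; [apply cont_opp, cont_mult; [apply cont_const | apply cont_circ]|apply cont_mult; assumption|].
          apply Cmult_neq_0; apply N.
    - intros t _. rewrite Cmult_1_l. apply circ_neq; lra. }
  transitivity (I z).
  { unfold I. apply CInt_ext. intros. rewrite Cmult_1_l. reflexivity. }
  rewrite (cder_zero_const I r z 0 HI Hz) by (rewrite Cmod_0; lra).
  unfold I. transitivity (CInt (fun _ => 1) 0 (2 * PI)).
  - apply CInt_ext. intros t _. field.
    pose proof (circ_neq r t 0 ltac:(lra)) as N. rewrite Cmod_0 in N.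
    specialize (N ltac:(lra)). unfold Cminus in N. rewrite Copp_0, Cplus_0_r in N. exact N.
  - rewrite CInt_const, Rminus_0_r. ring.
Qed.

(* Homotopy of the circle to the point [z]: the average of
   [zeta F(z + s (zeta - z))] over the circle vanishes for [s > 0], being the
   average of an angular derivative. *)
Lemma Cauchy_C1 (P F : C -> C) rho r z : (0 < r < rho)%R -> (Cmod z < r)%R ->
  (forall u, (Cmod u < rho)%R -> cder P u (F u)) ->
  (forall u, (Cmod u < rho)%R -> continuous F u) ->
  CInt (fun t => P (circ r t) * (circ r t / (circ r t - z))) 0 (2 * PI) = RtoC (2 * PI) * P z.
Proof.
  intros Hr Hz HP HF. pose proof two_PI_pos as HPI.
  assert (Hcr : forall t, (Cmod (circ r t) < rho)%R) by (intros; rewrite Cmod_circ; lra).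
  assert (Hseg : forall s t, (0 <= s <= 1)%R -> (Cmod (z + RtoC s * (circ r t - z)) < rho)%R).
  { intros s t Hs. apply Cmod_segment; auto. lra. }
  assert (N : forall t, circ r t - z <> 0) by (intros; apply circ_neq; lra).
  assert (CK : forall t, continuous (fun t => circ r t / (circ r t - z)) t).
  { intros t. apply cont_div; [apply cont_circ | apply cont_minus; [apply cont_circ | apply cont_const] | apply N]. }
  assert (CP : forall t, continuous (fun t => P (circ r t)) t).
  { intros t. eapply cont_cder_comp; [apply cont_circ | apply HP, Hcr]. }
  pose (H := fun t s => circ r t * F (z + RtoC s * (circ r t - z))).
  assert (HH : forall t s, (0 <= s <= 1)%R -> continuous (fun q : R * R => H (fst q) (snd q)) (t, s)).
  { intros t s Hs. unfold H.
    assert (A : continuous (fun q : R * R => circ r (fst q)) (t, s)).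
    { apply (continuous_comp fst (circ r)); [apply continuous_fst | apply cont_circ]. }
    apply cont_mult; [exact A|].
    apply (continuous_comp (fun q : R * R => z + RtoC (snd q) * (circ r (fst q) - z)) F).
    - apply cont_plus; [apply cont_const|]. apply cont_mult.
      + apply cont_RtoC, continuous_snd.
      + apply cont_minus; [exact A | apply cont_const].
    - apply HF, Hseg, Hs. }
  assert (Hs_c : forall t s, (0 <= s <= 1)%R -> continuous (H t) s).
  { intros t s Hs. apply (continuous_comp_2 (fun _ => t) (fun s => s) H);
      [apply continuous_const | apply continuous_id | apply HH, Hs]. }
  assert (Ht_c : forall t s, (0 <= s <= 1)%R -> continuous (fun t => H t s) t).
  { intros t s Hs. apply (continuous_comp_2 (fun t => t) (fun _ => s) H);
      [apply continuous_id | apply continuous_const | apply HH, Hs]. }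
  assert (Inner : forall t, CInt (H t) 0 1 = (P (circ r t) - P z) * (circ r t / (circ r t - z))).
  { intros t.
    transitivity (circ r t / (circ r t - z) * CInt (fun s => F (z + RtoC s * (circ r t - z)) * (circ r t - z)) 0 1).
    - rewrite <- CInt_scal.
      + apply CInt_ext. intros s _. unfold H. field. apply N.
      + apply con_le; [|lra]. intros s Hs. apply cont_mult; [|apply cont_const].
        apply (continuous_comp (fun s => z + RtoC s * (circ r t - z)) F).
        * apply cont_plus; [apply cont_const | apply cont_mult; [apply cont_RtoC, continuous_id | apply cont_const]].
        * apply HF, Hseg, Hs.
    - rewrite (CInt_FTC (fun s => P (z + RtoC s * (circ r t - z)))).
      + rewrite Cmult_0_l, Cmult_1_l, Cplus_0_r. replace (z + (circ r t - z)) with (circ r t) by ring. ring.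
      + intros s Hs. rewrite Rmin_left, Rmax_right in Hs by lra.
        apply (gder_comp RtoC (fun s => z + RtoC s * (circ r t - z)) P).
        * eapply gder_eq; [|apply gder_plus; [apply gder_const | apply gder_mult; [apply gder_id | apply gder_const]]].
          cbv beta. ring.
        * apply HP, Hseg, Hs.
      + apply con_le; [|lra]. intros s Hs. apply cont_mult; [|apply cont_const].
        apply (continuous_comp (fun s => z + RtoC s * (circ r t - z)) F).
        * apply cont_plus; [apply cont_const | apply cont_mult; [apply cont_RtoC, continuous_id | apply cont_const]].
        * apply HF, Hseg, Hs. }
  assert (Outer : forall s, (0 < s <= 1)%R -> CInt (fun t => H t s) 0 (2 * PI) = 0).
  { intros s Hs.
    assert (Hs' : RtoC s <> 0) by (apply RtoC_neq, Rgt_not_eq; lra).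
    assert (HC : Ci <> 0) by (apply Cmod_gt_0; rewrite Cmod_Ci; lra).
    transitivity (/ (Ci * RtoC s) * CInt (fun t => F (z + RtoC s * (circ r t - z)) * (RtoC s * (Ci * circ r t))) 0 (2 * PI)).
    - rewrite <- CInt_scal.
      + apply CInt_ext. intros t _. unfold H. field. split; assumption.
      + intros t _. apply cont_mult; [|apply cont_mult; [apply cont_const | apply cont_mult; [apply cont_const | apply cont_circ]]].
        apply (continuous_comp (fun t => z + RtoC s * (circ r t - z)) F).
        * apply cont_plus; [apply cont_const | apply cont_mult; [apply cont_const|apply cont_minus; [apply cont_circ | apply cont_const]]].
        * apply HF, Hseg; lra.
    - rewrite (CInt_FTC (fun t => P (z + RtoC s * (circ r t - z)))).
      + rewrite circ_2PI. ring.
      + intros t _. apply (gder_comp RtoC (fun t => z + RtoC s * (circ r t - z)) P).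
        * eapply gder_eq; [|apply gder_plus; [apply gder_const | apply gder_scal, gder_minus; [apply rder_circ | apply gder_const]]].
          cbv beta. ring.
        * apply HP, Hseg; lra.
      + intros t _. apply cont_mult; [|apply cont_mult; [apply cont_const | apply cont_mult; [apply cont_const | apply cont_circ]]].
        apply (continuous_comp (fun t => z + RtoC s * (circ r t - z)) F).
        * apply cont_plus; [apply cont_const | apply cont_mult; [apply cont_const|apply cont_minus; [apply cont_circ | apply cont_const]]].
        * apply HF, Hseg; lra. }
  assert (Key : CInt (fun t => (P (circ r t) - P z) * (circ r t / (circ r t - z))) 0 (2 * PI) = 0).
  { transitivity (CInt (fun t => CInt (H t) 0 1) 0 (2 * PI)).
    - apply CInt_ext. intros t _. symmetry. apply Inner.
    - rewrite (CInt_Fubini H 0 (2 * PI) 0 1) by (try lra; intros; apply HH; assumption).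
      transitivity (CInt (fun _ => 0) 0 1).
      + apply CInt_ext. intros s Hs. rewrite Rmin_left, Rmax_right in Hs by lra.
        apply Outer. lra.
      + rewrite CInt_const. ring. }
  rewrite <- (mean_kernel r z Hz), (Cmult_comm _ (P z)), <- CInt_scal by (intros t _; apply CK).
  replace (CInt (fun t => P (circ r t) * (circ r t / (circ r t - z))) 0 (2 * PI)) with
    (CInt (fun t => (P (circ r t) - P z) * (circ r t / (circ r t - z)) + P z * (circ r t / (circ r t - z))) 0 (2 * PI))
    by (apply CInt_ext; intros; ring).
  rewrite CInt_plus; [rewrite Key; ring| |].
  - intros t _. apply cont_mult; [apply cont_minus; [apply CP | apply cont_const] | apply CK].
  - intros t _. apply cont_mult; [apply cont_const | apply CK].
Qed.

Lemma RtoC_2PI_neq : RtoC (2 * PI) <> 0.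
Proof. apply RtoC_neq, Rgt_not_eq. apply two_PI_pos. Qed.

Lemma Ci_sub_eq (a b : C) : Ci * (a - b) = 0 -> a = b.
Proof.
  intros H. replace a with (b + (- Ci) * (Ci * (a - b))).
  - rewrite H. ring.
  - apply injective_projections; simpl; ring.
Qed.

(** [Cauchy_C1] asks for a continuous derivative, which a primitive [P] of [F] has. Differentiating
    its formula in [z] gives [F z] as an integral of [P] with a double pole, and integration by
    parts along the circle turns this into an integral of [F] with a simple pole. *)
Lemma Cauchy_formula F rho r z : holo F rho -> (0 < r < rho)%R -> (Cmod z < r)%R ->
  CInt (fun t => F (circ r t) * circ r t / (circ r t - z)) 0 (2 * PI) = RtoC (2 * PI) * F z.
Proof.
  intros HF Hr Hz. pose proof two_PI_pos as HPI.
  destruct (holo_primitive F rho HF) as [P HP].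
  assert (HFc : forall u, (Cmod u < rho)%R -> continuous F u) by (intros; eapply holo_cont; eauto).
  assert (Hcr : forall t, (Cmod (circ r t) < rho)%R) by (intros; rewrite Cmod_circ; lra).
  assert (CP : forall t, continuous (fun t => P (circ r t)) t).
  { intros t. eapply cont_cder_comp; [apply cont_circ | apply HP, Hcr]. }
  assert (CF : forall t, continuous (fun t => F (circ r t)) t).
  { intros t. apply (continuous_comp (circ r) F); [apply cont_circ | apply HFc, Hcr]. }
  assert (N : forall t, circ r t - z <> 0) by (intros; apply circ_neq; lra).
  assert (Cd : forall t, continuous (fun t => circ r t - z) t).
  { intros t. apply cont_minus; [apply cont_circ | apply cont_const]. }
  pose proof (cder_kernel1 (fun t => P (circ r t) * circ r t) (circ r) (fun _ => 1) 0 (2 * PI) z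
    (Rlt_le _ _ HPI)) as K.
  assert (D1 : cder (fun u => RtoC (2 * PI) * P u) z (RtoC (2 * PI) * F z)).
  { apply gder_scal, HP. lra. }
  assert (E : RtoC (2 * PI) * F z =
    CInt (fun t => P (circ r t) * circ r t * 1 / ((circ r t - 1 * z) * (circ r t - 1 * z))) 0 (2 * PI)).
  { apply cder_is_derive in D1. apply is_C_derive_unique in D1. rewrite <- D1.
    apply is_C_derive_unique, cder_is_derive.
    eapply gder_ext_loc; [| |apply K].
    - instantiate (1 := (r - Cmod z)%R). lra.
    - intros u Hu. cbv beta. rewrite <- (Cauchy_C1 P F rho r u); auto.
      + apply CInt_ext. intros t _. unfold Cdiv. rewrite Cmult_1_l. ring.
      + pose proof (Cmod_triangle (u - z) z) as T. replace (u - z + z) with u in T by ring. lra.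
    - intros t _. apply cont_mult; [apply CP | apply cont_circ].
    - intros t _. apply cont_circ.
    - intros t _. apply cont_const.
    - intros t _. rewrite Cmult_1_l. apply N. }
  rewrite E.
  assert (FT : CInt (fun t => Ci * (F (circ r t) * circ r t / (circ r t - z)
     - P (circ r t) * circ r t * 1 / ((circ r t - 1 * z) * (circ r t - 1 * z)))) 0 (2 * PI) = 0).
  { rewrite (CInt_FTC (fun t => P (circ r t) / (circ r t - z))).
    - rewrite circ_2PI. ring.
    - intros t _. eapply gder_eq; [|apply gder_div; [apply N | apply (gder_comp RtoC (circ r) P); [apply rder_circ | apply HP, Hcr]
        | apply gder_minus; [apply rder_circ | apply gder_const]]].
      specialize (N t). cbv beta. field. exact N.
    - intros t _. apply cont_mult; [apply cont_const|]. apply cont_minus.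
      + apply cont_div; [apply cont_mult; [apply CF | apply cont_circ] | apply Cd | apply N].
      + assert (continuous (fun t => circ r t - 1 * z) t) by (apply cont_minus; [apply cont_circ | apply cont_const]).
        apply cont_div; [apply cont_mult; [apply cont_mult; [apply CP | apply cont_circ] | apply cont_const] | apply cont_mult; assumption|].
        rewrite Cmult_1_l. apply Cmult_neq_0; apply N. }
  assert (C1 : con (fun t => F (circ r t) * circ r t / (circ r t - z)) 0 (2 * PI)).
  { intros t _. apply cont_div; [apply cont_mult; [apply CF | apply cont_circ] | apply Cd | apply N]. }
  assert (C2 : con (fun t => P (circ r t) * circ r t * 1 / ((circ r t - 1 * z) * (circ r t - 1 * z))) 0 (2 * PI)).
  { intros t _. assert (continuous (fun t => circ r t - 1 * z) t) by (apply cont_minus; [apply cont_circ | apply cont_const]).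
    apply cont_div; [apply cont_mult; [apply cont_mult; [apply CP | apply cont_circ] | apply cont_const] | apply cont_mult; assumption|].
    rewrite Cmult_1_l. apply Cmult_neq_0; apply N. }
  rewrite CInt_scal in FT by (intros t Ht; apply cont_minus; [apply C1 | apply C2]; exact Ht).
  rewrite CInt_minus in FT by assumption.
  apply Ci_sub_eq, FT.
Qed.

Lemma mean_value F rho r : holo F rho -> (0 < r < rho)%R ->
  CInt (fun t => F (circ r t)) 0 (2 * PI) = RtoC (2 * PI) * F 0.
Proof.
  intros HF Hr. rewrite <- (Cauchy_formula F rho r 0 HF Hr) by (rewrite Cmod_0; lra).
  apply CInt_ext. intros t _.
  pose proof (circ_neq r t 0 ltac:(lra)) as N. rewrite Cmod_0 in N. specialize (N ltac:(lra)).
  field. intros E. apply N. rewrite E. ring.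
Qed.

(** Cauchy's formula differentiated once expresses the derivative by an integral with a double pole,
    and that integral can be differentiated again. *)
Lemma holo_derive F rho : holo F rho ->
  exists F1, (forall z, (Cmod z < rho)%R -> cder F z (F1 z)) /\ holo F1 rho.
Proof.
  intros HF. exists (C_derive F). pose proof two_PI_pos as HPI.
  assert (HD : forall z, (Cmod z < rho)%R -> cder F z (C_derive F z)).
  { intros z Hz. destruct (HF z Hz) as [l Hl].
    rewrite (is_C_derive_unique F z l (cder_is_derive _ _ _ Hl)). exact Hl. }
  split; [exact HD|].
  intros z Hz. pose proof (Cmod_ge_0 z) as Hz0.
  set (r := ((Cmod z + rho) / 2)%R).
  assert (Hr : (0 < r < rho)%R) by (unfold r; lra).
  assert (Hzr : (Cmod z < r)%R) by (unfold r; lra).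
  assert (Hcr : forall t, (Cmod (circ r t) < rho)%R) by (intros; rewrite Cmod_circ; lra).
  assert (CF : forall t, continuous (fun t => F (circ r t) * circ r t) t).
  { intros t. apply cont_mult; [|apply cont_circ].
    apply (continuous_comp (circ r) F); [apply cont_circ | eapply holo_cont; [exact HF | apply Hcr]]. }
  pose proof RtoC_2PI_neq as HN.
  assert (Hnear : forall u, (Cmod (u - z) < r - Cmod z)%R -> (Cmod u < r)%R).
  { intros u Hu. pose proof (Cmod_triangle (u - z) z) as T. replace (u - z + z) with u in T by ring. lra. }
  assert (E : forall u, (Cmod u < r)%R -> C_derive F u = / RtoC (2 * PI) *
     CInt (fun t => F (circ r t) * circ r t * 1 / ((circ r t - 1 * u) * (circ r t - 1 * u))) 0 (2 * PI)).
  { intros u Hu. apply is_C_derive_unique, cder_is_derive.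
    eapply gder_ext_loc; [| |apply gder_scal, (cder_kernel1 (fun t => F (circ r t) * circ r t) (circ r) (fun _ => 1) 0 (2 * PI) u (Rlt_le _ _ HPI))].
    - instantiate (1 := (r - Cmod u)%R). lra.
    - intros v Hv. cbv beta.
      assert (Hv' : (Cmod v < r)%R).
      { pose proof (Cmod_triangle (v - u) u) as T. replace (v - u + u) with v in T by ring. lra. }
      transitivity (/ RtoC (2 * PI) * (RtoC (2 * PI) * F v)); [|field; exact HN].
      f_equal. rewrite <- (Cauchy_formula F rho r v HF Hr Hv').
      apply CInt_ext. intros t _. rewrite Cmult_1_l. reflexivity.
    - intros t _. apply CF.
    - intros t _. apply cont_circ.
    - intros t _. apply cont_const.
    - intros t _. rewrite Cmult_1_l. apply circ_neq; lra. }
  eexists.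
  eapply gder_ext_loc; [| |apply gder_scal, (cder_kernel2 (fun t => F (circ r t) * circ r t * 1) (circ r) (fun _ => 1) 0 (2 * PI) z (Rlt_le _ _ HPI))].
  - instantiate (1 := (r - Cmod z)%R). lra.
  - intros u Hu. cbv beta. symmetry. apply E, Hnear, Hu.
  - intros t _. apply cont_mult; [apply CF | apply cont_const].
  - intros t _. apply cont_circ.
  - intros t _. apply cont_const.
  - intros t _. rewrite Cmult_1_l. apply circ_neq; lra.
Qed.

(** * Minimum principle and Schwarz lemma *)

Lemma holo_le F r s : (s <= r)%R -> holo F r -> holo F s.
Proof. intros H HF z Hz. apply HF. lra. Qed.

Lemma cder_derive (F : C -> C) z l : cder F z l -> C_derive F z = l.
Proof. intros H. apply is_C_derive_unique, cder_is_derive, H. Qed.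

Lemma holo_const c rho : holo (fun _ => c) rho.
Proof. intros z _. eexists. apply gder_const. Qed.

Lemma holo_id rho : holo (fun z => z) rho.
Proof. intros z _. eexists. apply gder_id. Qed.

Lemma holo_plus F G rho : holo F rho -> holo G rho -> holo (fun z => F z + G z) rho.
Proof. intros HF HG z Hz. destruct (HF z Hz), (HG z Hz). eexists. apply gder_plus; eassumption. Qed.

Lemma holo_minus F G rho : holo F rho -> holo G rho -> holo (fun z => F z - G z) rho.
Proof. intros HF HG z Hz. destruct (HF z Hz), (HG z Hz). eexists. apply gder_minus; eassumption. Qed.

Lemma holo_mult F G rho : holo F rho -> holo G rho -> holo (fun z => F z * G z) rho.
Proof. intros HF HG z Hz. destruct (HF z Hz), (HG z Hz). eexists. apply gder_mult; eassumption. Qed.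

Lemma holo_div F G rho : holo F rho -> holo G rho ->
  (forall z, (Cmod z < rho)%R -> G z <> 0) -> holo (fun z => F z / G z) rho.
Proof. intros HF HG H0 z Hz. destruct (HF z Hz), (HG z Hz). eexists. apply gder_div; auto; eassumption. Qed.

Lemma holo_comp F G rho s : holo G rho -> (forall z, (Cmod z < rho)%R -> (Cmod (G z) < s)%R) ->
  holo F s -> holo (fun z => F (G z)) rho.
Proof.
  intros HG HGs HF z Hz. destruct (HG z Hz) as [l Hl]. destruct (HF (G z) (HGs z Hz)) as [m Hm].
  eexists. apply gder_comp; eassumption.
Qed.

Lemma Cconj_RtoC (x : R) : Cconj (RtoC x) = RtoC x.
Proof. apply injective_projections; simpl; ring. Qed.

Lemma Cmod_sqr_conj (z : C) : z * Cconj z = RtoC (Cmod z * Cmod z).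
Proof.
  rewrite <- Cmod2_conj. f_equal. ring.
Qed.

Lemma CInt_norm_le f a b : (a <= b)%R -> con f a b ->
  (Cmod (CInt f a b) <= RInt (fun t => Cmod (f t)) a b)%R.
Proof.
  intros Hab Hf.
  assert (H : @is_RInt C_R_NormedModule f a b (CInt f a b)).
  { apply (is_RInt_fct_extend_pair (U := R_NormedModule) (V := R_NormedModule));
    apply (RInt_correct (V := R_CompleteNormedModule)); [apply con_Re | apply con_Im]; assumption. }
  rewrite Cmod_norm.
  refine (norm_RInt_le (V := C_R_NormedModule) f _ a b _ _ Hab _ H _).
  - intros x Hx. change (norm (f x)) with (@norm R_AbsRing C_R_NormedModule (f x)).
    rewrite Cmod_norm. apply Rle_refl.
  - apply (RInt_correct (V := R_CompleteNormedModule)).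
    apply (ex_RInt_continuous (V := R_CompleteNormedModule)). intros x Hx. apply cont_Cmod, Hf, Hx.
Qed.

Lemma Re_CInt f a b : Re (CInt f a b) = RInt (fun t => Re (f t)) a b.
Proof. reflexivity. Qed.

(** * The Poisson kernel *)

Definition poisson (r : R) (a : C) (t : R) : R :=
  ((r * r - Cmod a * Cmod a) / (Cmod (circ r t - a) * Cmod (circ r t - a)))%R.

Lemma poisson_pos r a t : (Cmod a < r)%R -> (0 < poisson r a t)%R.
Proof.
  intros H. pose proof (Cmod_ge_0 a).
  assert (0 < Cmod (circ r t - a))%R by (apply Cmod_gt_0, circ_neq; lra).
  apply Rdiv_lt_0_compat; nra.
Qed.

Lemma poisson_cont r a t : (Cmod a < r)%R -> continuous (poisson r a) t.
Proof.
  intros H. pose proof (Cmod_ge_0 a).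
  assert (0 < Cmod (circ r t - a))%R by (apply Cmod_gt_0, circ_neq; lra).
  assert (Hc : continuous (fun t => Cmod (circ r t - a)) t).
  { apply cont_Cmod, cont_minus; [apply cont_circ | apply cont_const]. }
  apply (continuous_mult (K := R_AbsRing) (fun _ => (r * r - Cmod a * Cmod a)%R)).
  - apply continuous_const.
  - apply continuous_Rinv_comp.
    + apply (continuous_mult (K := R_AbsRing)); exact Hc.
    + apply Rgt_not_eq. apply Rmult_lt_0_compat; assumption.
Qed.

Lemma circ_conj r t : circ r t * Cconj (circ r t) = RtoC (r * r).
Proof.
  unfold circ. rewrite Cmult_conj, Cconj_RtoC, expi_conj.
  transitivity (RtoC (r * r) * (expi t * expi (- t))); [rewrite RtoC_mult; ring|].
  rewrite <- expi_plus, Rplus_opp_r, expi_0. ring.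
Qed.

(** On the circle [conj zeta = r^2 / zeta]. The kernel is Cauchy's kernel plus a function of [zeta]
    that is holomorphic across the closed disc and vanishes at 0; the mean of the latter against any
    holomorphic function is 0. *)
Lemma poisson_split r a t : (Cmod a < r)%R ->
  RtoC (poisson r a t) =
    circ r t / (circ r t - a) + Cconj a * circ r t / (RtoC (r * r) - Cconj a * circ r t).
Proof.
  intros H. pose proof (Cmod_ge_0 a) as Ha.
  assert (N : circ r t - a <> 0) by (apply circ_neq; lra).
  assert (N0 : circ r t <> 0).
  { apply Cmod_gt_0. rewrite Cmod_circ; lra. }
  assert (Nc : Cconj (circ r t) - Cconj a <> 0).
  { rewrite <- Cminus_conj. intros E. apply N.
    rewrite <- (Cconj_conj (circ r t - a)), E. apply Cconj_RtoC. }
  unfold poisson. rewrite RtoC_div.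
  2:{ apply Rgt_not_eq. apply Cmod_gt_0 in N. apply Rmult_lt_0_compat; assumption. }
  rewrite <- Cmod_sqr_conj, RtoC_minus, <- (circ_conj r t), <- Cmod_sqr_conj, Cminus_conj.
  field. repeat split; auto.
  replace (circ r t * Cconj (circ r t) - Cconj a * circ r t) with
    (circ r t * (Cconj (circ r t) - Cconj a)) by ring.
  apply Cmult_neq_0; assumption.
Qed.

Lemma conj_kernel_neq r a u : (Cmod a < r)%R -> (Cmod a * Cmod u < r * r)%R ->
  RtoC (r * r) - Cconj a * u <> 0.
Proof.
  intros H Hu E. pose proof (Cmod_ge_0 a).
  assert (E' : RtoC (r * r) = Cconj a * u) by (rewrite <- (Cplus_0_l (Cconj a * u)), <- E; ring).
  apply (f_equal Cmod) in E'. rewrite Cmod_mult, Cmod_conj, Cmod_R, Rabs_pos_eq in E' by nra. lra.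
Qed.

(** The only possible pole, [r^2 / conj a], has modulus greater than [r]. The mean value property
    needs a disc strictly larger than the circle of integration, hence the explicit [s]. *)
Lemma conj_kernel_radius r rho a : (0 < r < rho)%R -> (Cmod a < r)%R ->
  exists s, (r < s <= rho)%R /\ forall u, (Cmod u < s)%R -> RtoC (r * r) - Cconj a * u <> 0.
Proof.
  intros Hr Ha. pose proof (Cmod_ge_0 a) as Ha0.
  exists (Rmin rho (r * r / (Cmod a + (r - Cmod a) / 2)))%R. split.
  - split; [apply Rmin_glb_lt; [lra|]|apply Rmin_l].
    apply Rmult_lt_reg_r with (Cmod a + (r - Cmod a) / 2)%R; [lra|].
    unfold Rdiv at 2. rewrite Rmult_assoc, Rinv_l, Rmult_1_r by lra. nra.
  - intros u Hu. apply conj_kernel_neq; [exact Ha|].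
    assert (Hu2 : (Cmod u < r * r / (Cmod a + (r - Cmod a) / 2))%R)
      by (eapply Rlt_le_trans; [exact Hu | apply Rmin_r]).
    apply Rmult_lt_compat_r with (r := (Cmod a + (r - Cmod a) / 2)%R) in Hu2; [|lra].
    unfold Rdiv at 2 in Hu2. rewrite Rmult_assoc, Rinv_l, Rmult_1_r in Hu2 by lra.
    pose proof (Cmod_ge_0 u). nra.
Qed.

Lemma mean_conj_kernel q rho r a : holo q rho -> (0 < r < rho)%R -> (Cmod a < r)%R ->
  CInt (fun t => q (circ r t) / (RtoC (r * r) - Cconj a * circ r t)) 0 (2 * PI)
    = RtoC (2 * PI) * (q 0 / RtoC (r * r)).
Proof.
  intros Hq Hr Ha. destruct (conj_kernel_radius r rho a Hr Ha) as [s [Hs HN]].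
  rewrite (mean_value (fun u => q u / (RtoC (r * r) - Cconj a * u)) s r).
  - rewrite Cmult_0_r. unfold Cminus. rewrite Copp_0, Cplus_0_r. reflexivity.
  - apply holo_div; [apply holo_le with (2 := Hq); lra| |exact HN].
    apply holo_minus; [apply holo_const | apply holo_mult; [apply holo_const | apply holo_id]].
  - lra.
Qed.

Section Disk_mean.
Variables (q : C -> C) (rho r : R).
Hypotheses (Hq : holo q rho) (Hr : (0 < r < rho)%R).

Lemma cont_holo_circ t : continuous (fun t => q (circ r t)) t.
Proof.
  apply (continuous_comp (circ r) q); [apply cont_circ|].
  eapply holo_cont; [exact Hq|]. rewrite Cmod_circ; lra.
Qed.

Lemma cont_holo_kernel a t : (Cmod a < r)%R ->
  continuous (fun t => q (circ r t) * circ r t / (circ r t - a)) t.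
Proof.
  intros Ha. apply cont_div; [apply cont_mult; [apply cont_holo_circ | apply cont_circ] |
    apply cont_minus; [apply cont_circ | apply cont_const] | apply circ_neq; lra].
Qed.

Lemma cont_holo_conj_kernel a t : (Cmod a < r)%R ->
  continuous (fun t => q (circ r t) / (RtoC (r * r) - Cconj a * circ r t)) t.
Proof.
  intros Ha. apply cont_div; [apply cont_holo_circ |
    apply cont_minus; [apply cont_const | apply cont_mult; [apply cont_const | apply cont_circ]] |].
  pose proof (Cmod_ge_0 a).
  apply conj_kernel_neq; [exact Ha|]. rewrite Cmod_circ by lra. nra.
Qed.
End Disk_mean.

Lemma Poisson_formula q rho r a : holo q rho -> (0 < r < rho)%R -> (Cmod a < r)%R ->
  CInt (fun t => RtoC (poisson r a t) * q (circ r t)) 0 (2 * PI) = RtoC (2 * PI) * q a.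
Proof.
  intros Hq Hr Ha.
  assert (Hq2 : holo (fun u => Cconj a * u * q u) rho).
  { apply holo_mult; [apply holo_mult; [apply holo_const | apply holo_id] | exact Hq]. }
  pose proof (mean_conj_kernel _ rho r a Hq2 Hr Ha) as E2. cbv beta in E2.
  rewrite <- (Cauchy_formula q rho r a Hq Hr Ha).
  transitivity (CInt (fun t => q (circ r t) * circ r t / (circ r t - a)) 0 (2 * PI) +
    CInt (fun t => Cconj a * circ r t * q (circ r t) / (RtoC (r * r) - Cconj a * circ r t)) 0 (2 * PI)).
  - rewrite <- CInt_plus.
    + apply CInt_ext. intros t _. rewrite poisson_split by exact Ha. unfold Cdiv. ring.
    + intros t _. eapply cont_holo_kernel; eassumption.
    + intros t _. apply (cont_holo_conj_kernel (fun u => Cconj a * u * q u) rho); assumption.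
  - rewrite E2. unfold Cdiv. ring.
Qed.

Lemma Poisson_one r a : (Cmod a < r)%R -> RInt (poisson r a) 0 (2 * PI) = (2 * PI)%R.
Proof.
  intros Ha. pose proof (Cmod_ge_0 a).
  pose proof (Poisson_formula (fun _ => 1) (r + 1) r a (holo_const 1 _) ltac:(lra) Ha) as E.
  rewrite Cmult_1_r in E. apply (f_equal Re) in E. rewrite Re_CInt in E. simpl in E.
  etransitivity; [|exact E]. apply (RInt_ext (V := R_CompleteNormedModule)). intros t _.
  simpl. ring.
Qed.

(** A strict inequality on the circle survives in the Poisson mean because the weight is positive
    with integral [2 PI]. *)
Lemma Re_min_principle q rho r m a : holo q rho -> (0 < r < rho)%R ->
  (forall t, (0 <= t <= 2 * PI)%R -> (m < Re (q (circ r t)))%R) -> (Cmod a < r)%R -> (m < Re (q a))%R.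
Proof.
  intros Hq Hr Hm Ha. pose proof two_PI_pos as HPI.
  pose proof (f_equal Re (Poisson_formula q rho r a Hq Hr Ha)) as E.
  rewrite Re_CInt in E.
  assert (L : (RInt (fun t => m * poisson r a t) 0 (2 * PI) < RInt (fun t => Re (RtoC (poisson r a t) * q (circ r t))) 0 (2 * PI))%R).
  { apply RInt_lt; [exact HPI| | |].
    - intros t _. apply cont_Re, cont_mult; [apply cont_RtoC, poisson_cont, Ha|].
      eapply cont_holo_circ; eassumption.
    - intros t _. apply (continuous_mult (K := R_AbsRing) (fun _ => m)); [apply continuous_const | apply poisson_cont, Ha].
    - intros t Ht. specialize (Hm t ltac:(lra)). pose proof (poisson_pos r a t Ha). simpl. unfold Re in Hm. nra. }
  rewrite E in L.
  assert (E1 : RInt (fun t => m * poisson r a t)%R 0 (2 * PI) = (m * (2 * PI))%R).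
  { etransitivity; [|exact (f_equal (Rmult m) (Poisson_one r a Ha))].
    apply (RInt_scal (V := R_CompleteNormedModule)).
    apply (ex_RInt_continuous (V := R_CompleteNormedModule)). intros; apply poisson_cont, Ha. }
  rewrite E1 in L. simpl in L. unfold Re.
  apply Rmult_lt_reg_l with (2 * PI)%R; [exact HPI|]. lra.
Qed.

(** Poisson's formula for [w(zeta) / zeta], multiplied by [z] so that no removable singularity has
    to be filled. On the circle this quotient has modulus below [1 / r]. *)
Lemma Schwarz_radius w r z : holo w 1 -> (forall u, (Cmod u < 1)%R -> (Cmod (w u) < 1)%R) ->
  w 0 = 0 -> (0 < r < 1)%R -> (Cmod z < r)%R -> (r * Cmod (w z) <= Cmod z)%R.
Proof.
  intros Hw Hb H0 Hr Hz. pose proof two_PI_pos as HPI. pose proof (Cmod_ge_0 z) as Hz0.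
  assert (N0 : forall t, circ r t <> 0).
  { intros t. apply Cmod_gt_0. rewrite Cmod_circ; lra. }
  assert (N : forall t, circ r t - z <> 0) by (intros; apply circ_neq; lra).
  assert (CP : forall t, continuous (fun t => RtoC (poisson r z t) * (z * w (circ r t) / circ r t)) t).
  { intros t. apply cont_mult; [apply cont_RtoC, poisson_cont, Hz|].
    apply cont_div; [apply cont_mult; [apply cont_const|eapply cont_holo_circ; eassumption] | apply cont_circ | apply N0]. }
  assert (E : CInt (fun t => RtoC (poisson r z t) * (z * w (circ r t) / circ r t)) 0 (2 * PI)
     = RtoC (2 * PI) * w z).
  { pose proof (mean_conj_kernel (fun u => z * Cconj z * w u) 1 r z
      ltac:(apply holo_mult; [apply holo_const | exact Hw]) Hr Hz) as E2.
    pose proof (Cauchy_formula w 1 r z Hw Hr Hz) as E1.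
    pose proof (mean_value w 1 r Hw Hr) as E3.
    rewrite H0 in E3. cbv beta in E2. rewrite H0 in E2.
    assert (K1 : con (fun t => w (circ r t) * circ r t / (circ r t - z)) 0 (2 * PI)).
    { intros t _. apply (cont_holo_kernel w 1); assumption. }
    assert (K3 : con (fun t => w (circ r t)) 0 (2 * PI)).
    { intros t _. apply (cont_holo_circ w 1); assumption. }
    (* Since [z / (zeta - z) = zeta / (zeta - z) - 1], the Cauchy term gives [w z], and the other
       two have means proportional to [w 0 = 0]. *)
    transitivity ((CInt (fun t => w (circ r t) * circ r t / (circ r t - z)) 0 (2 * PI)
      - CInt (fun t => w (circ r t)) 0 (2 * PI)) +
      CInt (fun t => z * Cconj z * w (circ r t) / (RtoC (r * r) - Cconj z * circ r t)) 0 (2 * PI)).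
    - rewrite <- (CInt_minus _ _ _ _ K1 K3), <- CInt_plus.
      2:{ intros t Ht. apply cont_minus; [apply K1 | apply K3]; exact Ht. }
      2:{ intros t _. apply (cont_holo_conj_kernel (fun u => z * Cconj z * w u) 1);
          [apply holo_mult; [apply holo_const | exact Hw] | exact Hr | exact Hz]. }
      apply CInt_ext. intros t _. rewrite poisson_split by exact Hz.
      field. split; [|split; auto].
      apply conj_kernel_neq; [exact Hz|]. rewrite Cmod_circ by lra. nra.
    - rewrite E1, E2, E3. unfold Cdiv. ring. }
  assert (L : (Cmod (RtoC (2 * PI) * w z) <= RInt (fun t => Cmod z / r * poisson r z t) 0 (2 * PI))%R).
  { rewrite <- E. eapply Rle_trans; [apply CInt_norm_le; [lra | intros t _; apply CP]|].
    apply RInt_le; [lra| | |].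
    - apply (ex_RInt_continuous (V := R_CompleteNormedModule)). intros t _. apply cont_Cmod, CP.
    - apply (ex_RInt_continuous (V := R_CompleteNormedModule)). intros t _.
      apply (continuous_mult (K := R_AbsRing) (fun _ => (Cmod z / r)%R)); [apply continuous_const | apply poisson_cont, Hz].
    - intros t _. rewrite Cmod_mult, Cmod_div, Cmod_mult, Cmod_circ, Cmod_R by (auto || lra).
      pose proof (poisson_pos r z t Hz) as Hp. rewrite Rabs_pos_eq by lra.
      rewrite Rmult_comm. apply Rmult_le_compat_r; [lra|].
      unfold Rdiv. apply Rmult_le_compat_r; [apply Rlt_le, Rinv_0_lt_compat; lra|].
      assert (Cmod (w (circ r t)) < 1)%R by (apply Hb; rewrite Cmod_circ; lra). nra. }
  assert (E1 : RInt (fun t => Cmod z / r * poisson r z t)%R 0 (2 * PI) = (Cmod z / r * (2 * PI))%R).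
  { etransitivity; [|exact (f_equal (Rmult (Cmod z / r)) (Poisson_one r z Hz))].
    apply (RInt_scal (V := R_CompleteNormedModule)).
    apply (ex_RInt_continuous (V := R_CompleteNormedModule)). intros; apply poisson_cont, Hz. }
  rewrite E1, Cmod_mult, Cmod_R, Rabs_pos_eq in L by lra.
  apply Rmult_le_reg_l with (2 * PI / r)%R.
  { apply Rdiv_lt_0_compat; lra. }
  replace (2 * PI / r * (r * Cmod (w z)))%R with (2 * PI * Cmod (w z))%R by (field; lra).
  replace (2 * PI / r * Cmod z)%R with (Cmod z / r * (2 * PI))%R by (field; lra).
  exact L.
Qed.

Lemma Schwarz_lemma w z : holo w 1 -> (forall u, (Cmod u < 1)%R -> (Cmod (w u) < 1)%R) ->
  w 0 = 0 -> (Cmod z < 1)%R -> (Cmod (w z) <= Cmod z)%R.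
Proof.
  intros Hw Hb H0 Hz. apply Rnot_lt_le. intros Hlt.
  pose proof (Cmod_ge_0 z) as Hz0. pose proof (Hb z Hz) as Hw1.
  (* The first term of the maximum gives [|z| < r], the second gives [r > |z| / |w z|], which
     contradicts [r |w z| <= |z|]. *)
  pose proof (Schwarz_radius w (Rmax ((1 + Cmod z) / 2) ((1 + Cmod z / Cmod (w z)) / 2)) z Hw Hb H0) as K.
  assert (Hq : (Cmod z / Cmod (w z) < 1)%R).
  { apply Rmult_lt_reg_r with (Cmod (w z)); [lra|].
    unfold Rdiv. rewrite Rmult_assoc, Rinv_l, Rmult_1_r by lra. lra. }
  set (r := Rmax ((1 + Cmod z) / 2) ((1 + Cmod z / Cmod (w z)) / 2)) in *.
  assert (R1 : ((1 + Cmod z) / 2 <= r)%R) by apply Rmax_l.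
  assert (R2 : ((1 + Cmod z / Cmod (w z)) / 2 <= r)%R) by apply Rmax_r.
  assert (R3 : (r < 1)%R) by (apply Rmax_lub_lt; lra).
  specialize (K ltac:(lra) ltac:(lra)).
  apply Rmult_le_compat_r with (r := Cmod (w z)) in R2; [|lra].
  replace ((1 + Cmod z / Cmod (w z)) / 2 * Cmod (w z))%R with ((Cmod (w z) + Cmod z) / 2)%R in R2 by (field; lra).
  lra.
Qed.

(** * Subordination and convex functions *)

(* Otherwise [1 / (g - g z1)] would be holomorphic around [z0] and larger at
   the centre than on the circle. *)
Lemma univalent_inverse_cont g z0 eps : holo g 1 -> univalent_on_disk g -> (Cmod z0 < 1)%R ->
  (0 < eps)%R -> exists delta, (0 < delta)%R /\
    forall z1, (Cmod z1 < 1)%R -> (Cmod (g z1 - g z0) < delta)%R -> (Cmod (z1 - z0) < eps)%R.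
Proof.
  intros Hg Hu Hz0 He. pose proof two_PI_pos as HPI.
  set (rho := Rmin eps (1 - Cmod z0)).
  assert (Hrho : (0 < rho)%R) by (apply Rmin_glb_lt; lra).
  assert (Hrho1 : (rho <= eps)%R) by apply Rmin_l.
  assert (Hrho2 : (rho <= 1 - Cmod z0)%R) by apply Rmin_r.
  assert (Hdisk : forall u, (Cmod u < rho)%R -> (Cmod (z0 + u) < 1)%R).
  { intros u Hu'. pose proof (Cmod_triangle z0 u). lra. }
  assert (Hshift : holo (fun u => g (z0 + u)) rho).
  { intros u Hu'. destruct (Hg (z0 + u) (Hdisk u Hu')) as [l Hl].
    eexists. apply (gder_comp _ (fun u => z0 + u) g); [|exact Hl].
    apply gder_plus; [apply gder_const | apply gder_id]. }
  assert (Hc : forall t, (Cmod (circ (rho / 2) t) < rho)%R) by (intros; rewrite Cmod_circ; lra).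
  destruct (con_bounded_below (fun t => g (z0 + circ (rho / 2) t) - g z0) 0 (2 * PI)) as [m [Hm Hm']].
  - lra.
  - intros t _. apply cont_minus; [|apply cont_const].
    apply (cont_holo_circ (fun u => g (z0 + u)) rho); [exact Hshift | lra].
  - intros t _ E. apply Ceq_minus in E. apply Hu in E; [|apply Hdisk, Hc|exact Hz0].
    assert (E0 : circ (rho / 2) t = 0).
    { replace (circ (rho / 2) t) with (z0 + circ (rho / 2) t - z0) by ring. rewrite E. ring. }
    apply (f_equal Cmod) in E0. rewrite Cmod_circ, Cmod_0 in E0 by lra. lra.
  (* For [g z1] this close to [g z0], the modulus of [g - g z1] is at least [2 m / 3] on the circle
     and below [m / 3] at its centre, which the mean value of the reciprocal forbids. *)
  - exists (m / 3)%R. split; [lra|]. intros z1 Hz1 Hd.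
    apply Rnot_le_lt. intros Hfar.
    assert (HN : forall u, (Cmod u < rho)%R -> g (z0 + u) - g z1 <> 0).
    { intros u Hu' E. apply Ceq_minus in E. apply Hu in E; [|apply Hdisk, Hu'|exact Hz1].
      rewrite <- E in Hfar. replace (z0 + u - z0) with u in Hfar by ring. lra. }
    assert (Hh : holo (fun u => 1 / (g (z0 + u) - g z1)) rho).
    { apply holo_div; [apply holo_const| |exact HN].
      apply holo_minus; [exact Hshift | apply holo_const]. }
    pose proof (mean_value _ rho (rho / 2) Hh ltac:(lra)) as E. cbv beta in E.
    apply (f_equal Cmod) in E. rewrite Cmod_mult, Cmod_R, Rabs_pos_eq in E by lra.
    rewrite Cplus_0_r in E.
    assert (B : (Cmod (CInt (fun t => (1 / (g (z0 + circ (rho / 2) t) - g z1))%C) 0 (2 * PI))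
      <= (2 * PI - 0) * / (2 * m / 3))%R).
    { apply CInt_bound_le; [lra| |].
      - intros t _. apply (cont_holo_circ _ rho (rho / 2) Hh). lra.
      - intros t Ht. unfold Cdiv. rewrite Cmult_1_l. apply Cmod_inv_le; [lra|].
        specialize (Hm' t Ht). cbv beta in Hm'.
        pose proof (Cmod_triangle_inv (g (z0 + circ (rho / 2) t) - g z0) (g z1 - g z0)) as T.
        replace (g (z0 + circ (rho / 2) t) - g z0 - (g z1 - g z0)) with
          (g (z0 + circ (rho / 2) t) - g z1) in T by ring. lra. }
    rewrite E in B.
    assert (N0 : g z0 - g z1 <> 0).
    { specialize (HN 0). rewrite Cplus_0_r in HN. apply HN. rewrite Cmod_0. lra. }
    unfold Cdiv in B. rewrite Cmult_1_l, Cmod_inv in B by exact N0.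
    rewrite (Cmod_sub_sym (g z1)) in Hd.
    assert (H3 : (/ (m / 3) < / Cmod (g z0 - g z1))%R).
    { apply Rinv_lt_contravar; [|exact Hd]. apply Cmod_gt_0 in N0. apply Rmult_lt_0_compat; lra. }
    assert (H4 : (/ (2 * m / 3) < / (m / 3))%R).
    { apply Rinv_lt_contravar; [|lra]. apply Rmult_lt_0_compat; lra. }
    nra.
Qed.

(** The equation [g (w y) = G y] may be differentiated once [w] is continuous: the increment of [w]
    is first bounded by [K] times that of [y], and then both first-order errors are small. *)
Lemma cder_inverse (g G w : C -> C) (z d l : C) : d <> 0 ->
  cder g (w z) d -> cder G z l ->
  (forall eps, (0 < eps)%R -> exists delta, (0 < delta)%R /\
     forall y, (Cmod (y - z) < delta)%R -> (Cmod (w y - w z) < eps)%R) ->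
  (exists delta, (0 < delta)%R /\ forall y, (Cmod (y - z) < delta)%R -> g (w y) = G y) ->
  cder w z (l / d).
Proof.
  intros Hd Hg HG Hw [d0 [Hd0 HE]] eps He.
  assert (Dp : (0 < Cmod d)%R) by (apply Cmod_gt_0; exact Hd).
  pose proof (Cmod_ge_0 l) as Hl.
  set (K := (2 * (Cmod l + 1) / Cmod d)%R).
  assert (HK : (0 < K)%R) by (apply Rdiv_lt_0_compat; lra).
  set (e1 := Rmin (Cmod d / 2) (eps * Cmod d / (2 * K))).
  assert (He1 : (0 < e1)%R).
  { apply Rmin_glb_lt; [lra|]. apply Rdiv_lt_0_compat; nra. }
  assert (He1a : (e1 <= Cmod d / 2)%R) by apply Rmin_l.
  assert (He1b : (e1 <= eps * Cmod d / (2 * K))%R) by apply Rmin_r.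
  set (e2 := Rmin 1 (eps * Cmod d / 2)).
  assert (He2 : (0 < e2)%R) by (apply Rmin_glb_lt; nra).
  assert (He2a : (e2 <= 1)%R) by apply Rmin_l.
  assert (He2b : (e2 <= eps * Cmod d / 2)%R) by apply Rmin_r.
  destruct (Hg e1 He1) as [d1 [Hd1 H1]].
  destruct (HG e2 He2) as [d2 [Hd2 H2]].
  destruct (Hw d1 Hd1) as [d3 [Hd3 H3]].
  exists (Rmin d0 (Rmin d2 d3)). split; [repeat apply Rmin_glb_lt; assumption|].
  intros y Hy.
  assert (Y0 : (Cmod (y - z) < d0)%R) by (eapply Rlt_le_trans; [exact Hy | apply Rmin_l]).
  assert (Y23 : (Cmod (y - z) < Rmin d2 d3)%R) by (eapply Rlt_le_trans; [exact Hy | apply Rmin_r]).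
  assert (Y2 : (Cmod (y - z) < d2)%R) by (eapply Rlt_le_trans; [exact Y23 | apply Rmin_l]).
  assert (Y3 : (Cmod (y - z) < d3)%R) by (eapply Rlt_le_trans; [exact Y23 | apply Rmin_r]).
  specialize (H1 (w y) (H3 y Y3)). specialize (H2 y Y2).
  rewrite (HE y Y0), (HE z) in H1.
  2:{ replace (z - z) with (RtoC 0) by ring. rewrite Cmod_0. exact Hd0. }
  set (h := w y - w z) in *. set (k := y - z) in *. set (D := G y - G z) in *.
  pose proof (Cmod_ge_0 h) as Hh. pose proof (Cmod_ge_0 k) as Hk.
  assert (A1 : (Cmod h * Cmod d <= Cmod (D - h * d) + Cmod (D - k * l) + Cmod k * Cmod l)%R).
  { rewrite <- !Cmod_mult. pose proof (Cmod_triangle (- (D - h * d)) ((D - k * l) + k * l)) as T.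
    replace (- (D - h * d) + (D - k * l + k * l)) with (h * d) in T by ring.
    rewrite Cmod_opp in T. pose proof (Cmod_triangle (D - k * l) (k * l)). lra. }
  assert (A2 : (Cmod h <= K * Cmod k)%R).
  { apply Rmult_le_reg_r with (Cmod d / 2)%R; [lra|].
    replace (K * Cmod k * (Cmod d / 2))%R with ((Cmod l + 1) * Cmod k)%R by (unfold K; field; lra).
    assert (e1 * Cmod h <= Cmod d / 2 * Cmod h)%R by (apply Rmult_le_compat_r; assumption).
    assert (e2 * Cmod k <= 1 * Cmod k)%R by (apply Rmult_le_compat_r; assumption).
    lra. }
  replace (h - k * (l / d)) with (((D - k * l) - (D - h * d)) / d) by (field; exact Hd).
  rewrite Cmod_div by exact Hd.
  apply Rmult_le_reg_r with (Cmod d); [exact Dp|].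
  unfold Rdiv. rewrite Rmult_assoc, Rinv_l, Rmult_1_r by lra.
  pose proof (Cmod_triangle_sub (D - k * l) (D - h * d)) as T.
  assert (B1 : (e1 * Cmod h <= eps * Cmod d / 2 * Cmod k)%R).
  { apply Rle_trans with (eps * Cmod d / (2 * K) * (K * Cmod k))%R.
    - apply Rmult_le_compat; lra.
    - right. field. lra. }
  assert (B2 : (e2 * Cmod k <= eps * Cmod d / 2 * Cmod k)%R) by (apply Rmult_le_compat_r; assumption).
  lra.
Qed.

(** The map [w] solving [g (w u) = G u] is chosen pointwise, and univalence makes the value unique.
    It is continuous by [univalent_inverse_cont], hence holomorphic, and it maps the disc into
    itself fixing 0, so the Schwarz lemma applies. *)
Lemma subordination g G z : holo g 1 -> univalent_on_disk g ->
  (forall u d, (Cmod u < 1)%R -> cder g u d -> d <> 0) ->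
  holo G 1 -> (forall u, (Cmod u < 1)%R -> image_of_disk g (G u)) -> G 0 = g 0 ->
  (Cmod z < 1)%R -> exists w, (Cmod w <= Cmod z)%R /\ g w = G z.
Proof.
  intros Hg Hu Hd HG Him H0 Hz.
  assert (Hex : forall u, exists v, (Cmod u < 1)%R -> (Cmod v < 1)%R /\ g v = G u).
  { intros u. destruct (Rlt_dec (Cmod u) 1) as [Hu1|Hu1].
    - destruct (Him u Hu1) as [v [Hv Ev]]. exists v. intros _. split; assumption.
    - exists 0. intros Hc. contradiction. }
  pose (w := fun u => proj1_sig (constructive_indefinite_description _ (Hex u))).
  assert (Hw : forall u, (Cmod u < 1)%R -> (Cmod (w u) < 1)%R /\ g (w u) = G u).
  { intros u. exact (proj2_sig (constructive_indefinite_description _ (Hex u))). }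
  exists (w z). split; [|apply Hw, Hz].
  apply Schwarz_lemma; [| |  |exact Hz].
  - intros u Hu1. destruct (Hw u Hu1) as [W1 W2].
    destruct (Hg _ W1) as [d Hd']. destruct (HG u Hu1) as [l Hl].
    exists (l / d). apply (cder_inverse g G); auto.
    + exact (Hd _ _ W1 Hd').
    + intros eps He.
      destruct (univalent_inverse_cont g (w u) eps Hg Hu W1 He) as [d1 [Hd1 H1]].
      destruct (gder_cont _ _ _ _ Hl d1 Hd1) as [d2 [Hd2 H2]].
      exists (Rmin d2 (1 - Cmod u)). split; [apply Rmin_glb_lt; lra|].
      intros y Hy.
      assert (Y1 : (Cmod (y - u) < d2)%R) by (eapply Rlt_le_trans; [exact Hy | apply Rmin_l]).
      assert (Y2 : (Cmod (y - u) < 1 - Cmod u)%R) by (eapply Rlt_le_trans; [exact Hy | apply Rmin_r]).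
      assert (Y3 : (Cmod y < 1)%R).
      { pose proof (Cmod_triangle (y - u) u) as T. replace (y - u + u) with y in T by ring. lra. }
      destruct (Hw y Y3) as [Wy1 Wy2]. apply H1; [exact Wy1|]. rewrite Wy2, W2. apply H2, Y1.
    + exists (1 - Cmod u)%R. split; [lra|]. intros y Hy. apply Hw.
      pose proof (Cmod_triangle (y - u) u) as T. replace (y - u + u) with y in T by ring. lra.
  - intros u Hu1. apply Hw, Hu1.
  - assert (Z : (Cmod 0 < 1)%R) by (rewrite Cmod_0; lra).
    destruct (Hw 0 Z) as [W1 W2]. apply Hu; [exact W1 | exact Z|]. rewrite W2. exact H0.
Qed.

(** * The analytic inequality for convex functions *)

Lemma Cmod_sqr (z : C) : (Cmod z * Cmod z = Re z * Re z + Im z * Im z)%R.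
Proof. pose proof (Cmod2_alt z) as H. simpl in H. rewrite !Rmult_1_r in H. exact H. Qed.

(* [|w|^2 <= |z0|^2] for [w = z0 - (t^2/2) X + o(t^2)] forces [Re (conj z0 X) >= 0]. *)
Lemma second_order_inside (g : C -> C) (z0 d kappa : C) (gam : R -> C) : d <> 0 ->
  cder g z0 d ->
  (forall eps, (0 < eps)%R -> exists delta, (0 < delta)%R /\ forall t : R, (0 < t < delta)%R ->
     (Cmod (gam t - g z0 + RtoC (t * t / 2) * kappa) <= eps * (t * t))%R) ->
  (forall eps, (0 < eps)%R -> exists delta, (0 < delta)%R /\ forall t : R, (0 < t < delta)%R ->
     exists w, (Cmod w <= Cmod z0)%R /\ g w = gam t /\ (Cmod (w - z0) < eps)%R) ->
  (0 <= Re (Cconj z0 * (kappa / d)))%R.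
Proof.
  intros Hd Hg Hgam Hw. apply Rnot_lt_le. intros Hneg.
  set (X := kappa / d) in *. set (c := (- Re (Cconj z0 * X))%R).
  assert (Hc : (0 < c)%R) by (unfold c; lra).
  assert (Dp : (0 < Cmod d)%R) by (apply Cmod_gt_0; exact Hd).
  pose proof (Cmod_ge_0 z0) as Hz. pose proof (Cmod_ge_0 X) as HX.
  (* This constant keeps the error below [c t^2 / 4], half of the main term [c t^2 / 2]. *)
  set (Q := (4 * (Cmod z0 + 1) * (2 + Cmod X))%R).
  assert (HQ : (0 < Q)%R) by (unfold Q; nra).
  set (eps := Rmin (Cmod d / 2) (c * Cmod d / Q)).
  assert (He : (0 < eps)%R).
  { apply Rmin_glb_lt; [lra|]. apply Rdiv_lt_0_compat; nra. }
  assert (Hea : (eps <= Cmod d / 2)%R) by apply Rmin_l.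
  assert (Heb : (eps <= c * Cmod d / Q)%R) by apply Rmin_r.
  destruct (Hg eps He) as [d1 [Hd1 H1]].
  destruct (Hgam eps He) as [d2 [Hd2 H2]].
  destruct (Hw d1 Hd1) as [d3 [Hd3 H3]].
  set (t := (Rmin d2 d3 / 2)%R).
  assert (Ht0 : (0 < Rmin d2 d3)%R) by (apply Rmin_glb_lt; assumption).
  pose proof (Rmin_l d2 d3). pose proof (Rmin_r d2 d3).
  specialize (H2 t ltac:(unfold t; lra)).
  destruct (H3 t ltac:(unfold t; lra)) as [w [W1 [W2 W3]]].
  specialize (H1 w W3). rewrite W2 in H1.
  set (h := w - z0) in *.
  set (E := h * d + RtoC (t * t / 2) * kappa).
  pose proof (Cmod_ge_0 h) as Hh.
  assert (T2 : (0 < t * t)%R) by (apply Rmult_lt_0_compat; unfold t; lra).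
  assert (BE : (Cmod E <= eps * (t * t) + eps * Cmod h)%R).
  { unfold E. pose proof (Cmod_triangle_sub (gam t - g z0 + RtoC (t * t / 2) * kappa) (gam t - g z0 - h * d)) as T.
    replace (gam t - g z0 + RtoC (t * t / 2) * kappa - (gam t - g z0 - h * d))
      with (h * d + RtoC (t * t / 2) * kappa) in T by ring. lra. }
  assert (Eh : h = E / d - RtoC (t * t / 2) * X).
  { unfold E, X. field. exact Hd. }
  assert (Bh0 : (Cmod h <= Cmod E / Cmod d + t * t / 2 * Cmod X)%R).
  { rewrite Eh at 1. eapply Rle_trans; [apply Cmod_triangle_sub|].
    rewrite Cmod_div, Cmod_mult, Cmod_R, Rabs_pos_eq by (auto; lra). lra. }
  assert (Bq : (Cmod E / Cmod d <= t * t / 2 + Cmod h / 2)%R).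
  { apply Rmult_le_reg_r with (Cmod d); [exact Dp|].
    unfold Rdiv at 1. rewrite Rmult_assoc, Rinv_l, Rmult_1_r by lra.
    eapply Rle_trans; [exact BE|].
    assert (eps * (t * t) <= Cmod d / 2 * (t * t))%R by (apply Rmult_le_compat_r; lra).
    assert (eps * Cmod h <= Cmod d / 2 * Cmod h)%R by (apply Rmult_le_compat_r; lra).
    lra. }
  assert (Bh : (Cmod h <= (1 + Cmod X) * (t * t))%R) by lra.
  assert (Hre : (Re (Cconj z0 * h) <= 0)%R).
  { assert (S : (Cmod w * Cmod w <= Cmod z0 * Cmod z0)%R).
    { apply Rmult_le_compat; auto; apply Cmod_ge_0. }
    assert (Ew : (Cmod w * Cmod w = Cmod z0 * Cmod z0 + 2 * Re (Cconj z0 * h) + Cmod h * Cmod h)%R).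
    { replace w with (z0 + h) by (unfold h; ring).
      rewrite !Cmod_sqr. unfold Re, Im. simpl. ring. }
    nra. }
  assert (Ere : (Re (Cconj z0 * h) = Re (Cconj z0 * (E / d)) + t * t / 2 * c)%R).
  { rewrite Eh at 1. unfold c. unfold Re. simpl. ring. }
  assert (Babs : (Rabs (Re (Cconj z0 * (E / d))) <= Cmod z0 * (Cmod E / Cmod d))%R).
  { eapply Rle_trans; [apply re_le_Cmod|]. rewrite Cmod_mult, Cmod_conj, Cmod_div by exact Hd. lra. }
  assert (BE2 : (Cmod E / Cmod d <= c / Q * (2 + Cmod X) * (t * t))%R).
  { apply Rmult_le_reg_r with (Cmod d); [exact Dp|].
    unfold Rdiv at 1. rewrite Rmult_assoc, Rinv_l, Rmult_1_r by lra.
    eapply Rle_trans; [exact BE|].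
    replace (c / Q * (2 + Cmod X) * (t * t) * Cmod d)%R with (c * Cmod d / Q * ((t * t) + (1 + Cmod X) * (t * t)))%R
      by (field; lra).
    rewrite <- Rmult_plus_distr_l. apply Rmult_le_compat; nra. }
  assert (Fin : (Cmod z0 * (Cmod E / Cmod d) <= c / 4 * (t * t))%R).
  { apply Rle_trans with ((Cmod z0 + 1) * (c / Q * (2 + Cmod X) * (t * t)))%R.
    - apply Rmult_le_compat; try lra. apply Rmult_le_pos; [apply Cmod_ge_0 | apply Rlt_le, Rinv_0_lt_compat; lra].
    - right. unfold Q. field. split; lra. }
  apply Rabs_le_between in Babs. nra.
Qed.

(** Averaging [A t] and [A (- t)] removes the linear term and leaves [A''(0) t^2 / 2] with
    [A''(0) = - kappa]. Only the derivative of [A1] at 0 is used, the estimate being integrated from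
    0 to [t]. *)
Lemma Taylor2_even (A A1 : R -> C) (kappa : C) :
  (forall t, rder A t (A1 t)) -> (forall t, continuous A1 t) -> rder A1 0 (- kappa) ->
  forall eps, (0 < eps)%R -> exists delta, (0 < delta)%R /\ forall t : R, (0 < t < delta)%R ->
     (Cmod (RtoC (/ 2) * (A t + A (- t)) - A 0%R + RtoC (t * t / 2) * kappa) <= eps * (t * t))%R.
Proof.
  intros HA Hc HA1 eps He.
  destruct (HA1 eps He) as [dl [Hdl H1]].
  exists dl. split; [exact Hdl|]. intros t Ht.
  pose (D := fun s : R => RtoC (/ 2) * (A s + A (- s)%R) + RtoC (s * s / 2) * kappa).
  pose (D1 := fun s : R => RtoC (/ 2) * (A1 s - A1 (- s)%R) + RtoC s * kappa).
  assert (Hopp : forall s, rder (fun s => RtoC (- s)) s (- (1))).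
  { intros s. apply gder_ext with (f := fun s => (-(1)) * RtoC s).
    - intros y. rewrite RtoC_opp. ring.
    - eapply gder_eq; [|apply gder_scal, gder_id]. ring. }
  assert (HAo : forall s, rder (fun s => A (- s)%R) s (- A1 (- s)%R)).
  { intros s e Hpe. destruct (HA (- s)%R e Hpe) as [d' [Hd' H']].
    exists d'. split; [exact Hd'|]. intros y Hy.
    assert (Ey : Cmod (RtoC (- y) - RtoC (- s)) = Cmod (RtoC y - RtoC s)).
    { rewrite <- !RtoC_minus, !Cmod_R. rewrite <- Rabs_Ropp. f_equal. ring. }
    specialize (H' (- y)%R). rewrite Ey in H'. specialize (H' Hy).
    replace (A (- y)%R - A (- s)%R - (RtoC y - RtoC s) * - A1 (- s)%R) with
      (A (- y)%R - A (- s)%R - (RtoC (- y) - RtoC (- s)) * A1 (- s)%R); [exact H'|].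
    rewrite !RtoC_opp. ring. }
  assert (HD : forall s, rder D s (D1 s)).
  { intros s. unfold D, D1. eapply gder_eq; [|apply gder_plus; [apply gder_scal, gder_plus; [apply HA | apply HAo]|]].
    2:{ apply gder_ext with (f := fun s => (RtoC (/ 2) * kappa) * (RtoC s * RtoC s)).
        - intros y. unfold Rdiv. rewrite !RtoC_mult. ring.
        - apply gder_scal, gder_mult; apply gder_id. }
    apply injective_projections; simpl; field. }
  assert (HD1c : forall s, continuous D1 s).
  { intros s. unfold D1. apply cont_plus; apply cont_mult; try apply cont_const.
    - apply cont_minus; [apply Hc|].
      apply (continuous_comp Ropp A1); [apply (continuous_opp (V := R_NormedModule)), continuous_id | apply Hc].
    - apply cont_RtoC, continuous_id. }
  assert (B : (Cmod (CInt D1 0 t) <= (t - 0) * (eps * t))%R).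
  { apply CInt_bound_le; [lra|intros s _; apply HD1c|]. intros s Hs.
    assert (K : forall u, (Rabs u <= t)%R -> (Cmod (A1 u - A1 0%R + RtoC u * kappa) <= eps * t)%R).
    { intros u Hu. specialize (H1 u). unfold Cminus at 1 in H1. rewrite Copp_0, Cplus_0_r, Cmod_R in H1.
      specialize (H1 ltac:(lra)).
      replace (A1 u - A1 0%R - (RtoC u - RtoC 0) * - kappa) with (A1 u - A1 0%R + RtoC u * kappa) in H1 by ring.
      replace (RtoC u - RtoC 0) with (RtoC u) in H1 by ring. rewrite Cmod_R in H1.
      eapply Rle_trans; [exact H1|]. apply Rmult_le_compat_l; lra. }
    pose proof (K s ltac:(rewrite Rabs_pos_eq; lra)) as K1.
    pose proof (K (- s)%R ltac:(rewrite Rabs_Ropp, Rabs_pos_eq; lra)) as K2.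
    replace (D1 s) with (RtoC (/ 2) * ((A1 s - A1 0%R + RtoC s * kappa) - (A1 (- s)%R - A1 0%R + RtoC (- s) * kappa))).
    2:{ unfold D1. rewrite RtoC_opp. apply injective_projections; simpl; field. }
    rewrite Cmod_mult, Cmod_R, Rabs_pos_eq by lra.
    pose proof (Cmod_triangle_sub (A1 s - A1 0%R + RtoC s * kappa) (A1 (- s)%R - A1 0%R + RtoC (- s) * kappa)). lra. }
  rewrite (CInt_FTC D D1 0 t (fun s _ => HD s) (fun s _ => HD1c s)) in B.
  replace (RtoC (/ 2) * (A t + A (- t)%R) - A 0%R + RtoC (t * t / 2) * kappa) with (D t - D 0%R).
  - lra.
  - unfold D. rewrite Ropp_0. apply injective_projections; simpl; field.
Qed.

(** The mean of [g (e^(it) z)] and [g (e^(-it) z)] takes values in the convex image and is therefore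
    subordinate to [g]. At [z0] it is [g z0 - (t^2 / 2) kappa] to second order, and a preimage of
    modulus at most [|z0|] forces the inequality. *)
Lemma convex_Re_nonneg g F1 F2 z0 : holo g 1 -> univalent_on_disk g -> convex_set (image_of_disk g) ->
  (forall z, (Cmod z < 1)%R -> cder g z (F1 z)) ->
  (forall z, (Cmod z < 1)%R -> cder F1 z (F2 z)) ->
  (forall z, (Cmod z < 1)%R -> F1 z <> 0) -> g 0 = 0 -> (Cmod z0 < 1)%R ->
  (0 <= Re (1 + z0 * F2 z0 / F1 z0))%R.
Proof.
  intros Hg Hu Hcv H1 H2 HN H0 Hz0.
  destruct (Ceq_dec z0 0) as [->|Hnz].
  { unfold Cdiv. rewrite !Cmult_0_l, Cplus_0_r. simpl. lra. }
  (* Minus the second derivative of [g (e^(it) z0)] at [t = 0]; divided by [g' z0] it is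
     [z0 (1 + z0 g''/g')]. *)
  set (kappa := z0 * F1 z0 + z0 * z0 * F2 z0).
  enough (P : (0 <= Re (Cconj z0 * (kappa / F1 z0)))%R).
  { assert (Zp : (0 < Cmod z0)%R) by (apply Cmod_gt_0; exact Hnz).
    replace (Cconj z0 * (kappa / F1 z0)) with (RtoC (Cmod z0 * Cmod z0) * (1 + z0 * F2 z0 / F1 z0)) in P.
    2:{ rewrite <- Cmod_sqr_conj. unfold kappa. field. apply HN, Hz0. }
    rewrite re_scal_l in P. apply Rmult_le_reg_l with (Cmod z0 * Cmod z0)%R; [nra | lra]. }
  pose (A := fun t : R => g (circ 1 t * z0)).
  pose (A1 := fun t : R => F1 (circ 1 t * z0) * (Ci * circ 1 t * z0)).
  assert (Hin : forall t u, (Cmod u < 1)%R -> (Cmod (circ 1 t * u) < 1)%R).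
  { intros t u Hu1. rewrite Cmod_mult, Cmod_circ by lra. lra. }
  assert (Hrot : forall t, rder (fun t => circ 1 t * z0) t (Ci * circ 1 t * z0)).
  { intros t. eapply gder_eq; [|apply gder_mult; [apply rder_circ | apply gder_const]]. cbv beta. ring. }
  assert (HA : forall t, rder A t (A1 t)).
  { intros t. apply (gder_comp RtoC (fun t => circ 1 t * z0) g); [apply Hrot | apply H1, Hin, Hz0]. }
  assert (HA1 : forall t, exists l, rder A1 t l /\ l = F2 (circ 1 t * z0) * (Ci * circ 1 t * z0) * (Ci * circ 1 t * z0)
      + F1 (circ 1 t * z0) * (Ci * (Ci * circ 1 t) * z0)).
  { intros t. eexists. split; [|reflexivity]. unfold A1.
    eapply gder_eq; [|apply gder_mult; [apply (gder_comp RtoC (fun t => circ 1 t * z0) F1); [apply Hrot | apply H2, Hin, Hz0]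
      | apply gder_mult; [apply gder_scal, rder_circ | apply gder_const]]].
    cbv beta. ring. }
  assert (E1 : circ 1 0 = 1) by (unfold circ; rewrite expi_0; ring).
  assert (HA10 : rder A1 0 (- kappa)).
  { destruct (HA1 0%R) as [l [Hl El]]. rewrite E1 in El.
    replace (- kappa) with l; [exact Hl|]. rewrite El. unfold kappa. rewrite !Cmult_1_l.
    generalize (F1 z0) (F2 z0). intros u v. apply injective_projections; simpl; ring. }
  assert (HA1c : forall t, continuous A1 t).
  { intros t. destruct (HA1 t) as [l [Hl _]]. exact (rder_cont _ _ _ Hl). }
  assert (A0 : A 0%R = g z0) by (unfold A; rewrite E1, Cmult_1_l; reflexivity).
  apply (second_order_inside g z0 (F1 z0) kappa (fun t => RtoC (/ 2) * (A t + A (- t)%R))).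
  - apply HN, Hz0.
  - apply H1, Hz0.
  - intros eps He. destruct (Taylor2_even A A1 kappa HA HA1c HA10 eps He) as [d [Hd HT]].
    exists d. split; [exact Hd|]. intros t Ht. rewrite <- A0. apply HT, Ht.
  - intros eps He.
    destruct (univalent_inverse_cont g z0 eps Hg Hu Hz0 He) as [d1 [Hd1 HI]].
    destruct (Taylor2_even A A1 kappa HA HA1c HA10 1%R Rlt_0_1) as [d2 [Hd2 HT]].
    pose proof (Cmod_ge_0 kappa) as Hk.
    exists (Rmin (Rmin d2 1) (d1 / (1 + Cmod kappa))). split.
    { repeat apply Rmin_glb_lt; try lra. apply Rdiv_lt_0_compat; lra. }
    intros t [Ht0 Ht].
    assert (Ta : (t < Rmin d2 1)%R) by (eapply Rlt_le_trans; [exact Ht | apply Rmin_l]).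
    assert (Tb : (t < d1 / (1 + Cmod kappa))%R) by (eapply Rlt_le_trans; [exact Ht | apply Rmin_r]).
    assert (Tc : (t < d2)%R) by (eapply Rlt_le_trans; [exact Ta | apply Rmin_l]).
    assert (Td : (t < 1)%R) by (eapply Rlt_le_trans; [exact Ta | apply Rmin_r]).
    specialize (HT t (conj Ht0 Tc)).
    destruct (subordination g (fun u => RtoC (/ 2) * (g (circ 1 t * u) + g (circ 1 (- t) * u))) z0) as [w [W1 W2]]; auto.
    + intros u d Hu1 Hd. rewrite <- (cder_derive _ _ _ Hd), (cder_derive _ _ _ (H1 u Hu1)). apply HN, Hu1.
    + assert (Hr : forall t, holo (fun u => g (circ 1 t * u)) 1).
      { intros s. apply (holo_comp g (fun u => circ 1 s * u) 1 1); [|intros; apply Hin; assumption|exact Hg].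
        apply holo_mult; [apply holo_const | apply holo_id]. }
      apply holo_mult; [apply holo_const | apply holo_plus; apply Hr].
    + intros u Hu1.
      pose proof (Hcv (g (circ 1 t * u)) (g (circ 1 (- t) * u)) (/ 2)%R) as K.
      replace (RtoC (/ 2) * (g (circ 1 t * u) + g (circ 1 (- t) * u))) with
        (RtoC (1 - / 2) * g (circ 1 t * u) + RtoC (/ 2) * g (circ 1 (- t) * u)).
      * apply K; [eexists; split; [apply Hin, Hu1 | reflexivity]..| lra].
      * apply injective_projections; simpl; field.
    + rewrite !Cmult_0_r, H0. ring.
    + exists w. split; [exact W1|]. split; [exact W2|]. apply HI; [unfold unit_disk in *; lra|].
      rewrite W2. cbv beta. rewrite <- A0. fold (A t) (A (- t)%R).
      pose proof (Cmod_triangle_sub (RtoC (/ 2) * (A t + A (- t)%R) - A 0%R + RtoC (t * t / 2) * kappa) (RtoC (t * t / 2) * kappa)) as T.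
      replace (RtoC (/ 2) * (A t + A (- t)%R) - A 0%R + RtoC (t * t / 2) * kappa - RtoC (t * t / 2) * kappa)
        with (RtoC (/ 2) * (A t + A (- t)%R) - A 0%R) in T by ring.
      rewrite Cmod_mult, Cmod_R, Rabs_pos_eq in T by nra.
      apply Rmult_lt_compat_r with (r := (1 + Cmod kappa)%R) in Tb; [|lra].
      unfold Rdiv in Tb. rewrite Rmult_assoc, Rinv_l, Rmult_1_r in Tb by lra.
      assert (t * t <= t)%R by nra. nra.
Qed.

(** * Arguments along circles and square roots *)

Definition cexp (z : C) : C := RtoC (exp (Re z)) * expi (Im z).

Lemma cexp_0 : cexp 0 = 1.
Proof. unfold cexp. simpl. rewrite exp_0, expi_0. ring. Qed.

Lemma cexp_plus z w : cexp (z + w) = cexp z * cexp w.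
Proof. unfold cexp. simpl. rewrite exp_plus, expi_plus, RtoC_mult. unfold Re, Im. ring. Qed.

Lemma cexp_neq_0 z : cexp z <> 0.
Proof.
  unfold cexp. apply Cmult_neq_0; [apply RtoC_neq, Rgt_not_eq, exp_pos | apply expi_neq_0].
Qed.

Lemma rder_exp t : rder (fun t => RtoC (exp t)) t (RtoC (exp t)).
Proof.
  apply (gder_pair exp (fun _ => 0%R) t (exp t) 0).
  - apply is_derive_exp.
  - apply (is_derive_const (K := R_AbsRing) (V := R_NormedModule)).
Qed.

(** The product of the two factors is expanded around 1 with the real derivatives of [exp] and
    [expi] at 0; the addition formula then carries the result to every point. *)
Lemma cder_cexp_0 : cder cexp 0 1.
Proof.
  intros eps He.
  pose proof (rder_exp 0) as HE. rewrite exp_0 in HE.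
  pose proof (rder_expi 0) as HI. rewrite expi_0, Cmult_1_r in HI.
  assert (He4 : (0 < Rmin (eps / 4) 1)%R) by (apply Rmin_glb_lt; lra).
  set (e := Rmin (eps / 4) 1) in *.
  assert (Hea : (e <= eps / 4)%R) by apply Rmin_l.
  assert (Heb : (e <= 1)%R) by apply Rmin_r.
  destruct (HE e He4) as [d1 [Hd1 H1]].
  destruct (HI e He4) as [d2 [Hd2 H2]].
  destruct (gder_cont _ _ _ _ HE e He4) as [d3 [Hd3 H3]].
  exists (Rmin d1 (Rmin d2 d3)). split; [repeat apply Rmin_glb_lt; assumption|].
  intros h Hh. unfold Cminus in Hh. rewrite Copp_0, Cplus_0_r in Hh.
  assert (Y1 : (Cmod h < d1)%R) by (eapply Rlt_le_trans; [exact Hh | apply Rmin_l]).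
  assert (Y23 : (Cmod h < Rmin d2 d3)%R) by (eapply Rlt_le_trans; [exact Hh | apply Rmin_r]).
  assert (Y2 : (Cmod h < d2)%R) by (eapply Rlt_le_trans; [exact Y23 | apply Rmin_l]).
  assert (Y3 : (Cmod h < d3)%R) by (eapply Rlt_le_trans; [exact Y23 | apply Rmin_r]).
  pose proof (re_le_Cmod h) as Ra. pose proof (im_le_Cmod h) as Rb.
  assert (Es : forall x : R, RtoC x - RtoC 0 = RtoC x) by (intros; ring).
  specialize (H1 (Re h)). specialize (H2 (Im h)). specialize (H3 (Re h)).
  cbv beta in H1, H2, H3. rewrite !Es, !Cmod_R in H1, H2, H3.
  specialize (H1 ltac:(lra)). specialize (H2 ltac:(lra)). specialize (H3 ltac:(lra)).
  rewrite exp_0 in H1, H3. rewrite expi_0 in H2. rewrite cexp_0.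
  replace (h - 0) with h by ring.
  set (u := RtoC (exp (Re h))) in *. set (v := expi (Im h)) in *.
  replace (cexp h - 1 - h * 1) with
    ((u - 1 - RtoC (Re h) * 1) + u * (v - 1 - RtoC (Im h) * Ci) + (u - 1) * (RtoC (Im h) * Ci)).
  2:{ unfold cexp. fold u v.
      replace h with (RtoC (Re h) + RtoC (Im h) * Ci) at 4 by (apply injective_projections; simpl; unfold Re, Im; ring).
      ring. }
  assert (Hu : (Cmod u <= 2)%R).
  { pose proof (Cmod_triangle (u - 1) 1) as T. replace (u - 1 + 1) with u in T by ring.
    rewrite Cmod_1 in T. lra. }
  eapply Rle_trans; [apply Cmod_triangle|].
  eapply Rle_trans; [apply Rplus_le_compat_r, Cmod_triangle|].
  rewrite !Cmod_mult, Cmod_Ci, Cmod_R, Rmult_1_r.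
  pose proof (Cmod_ge_0 h). pose proof (Rabs_pos (Re h)). pose proof (Rabs_pos (Im h)).
  assert (e * Rabs (Re h) <= e * Cmod h)%R by (apply Rmult_le_compat_l; lra).
  assert (e * Rabs (Im h) <= e * Cmod h)%R by (apply Rmult_le_compat_l; lra).
  assert (Cmod u * Cmod (v - 1 - RtoC (Im h) * Ci) <= 2 * (e * Cmod h))%R.
  { apply Rmult_le_compat; try apply Cmod_ge_0; lra. }
  assert (Cmod (u - 1) * Rabs (Im h) <= e * Cmod h)%R.
  { apply Rmult_le_compat; try apply Cmod_ge_0; lra. }
  assert (e * Cmod h <= eps / 4 * Cmod h)%R by (apply Rmult_le_compat_r; lra).
  lra.
Qed.

Lemma cder_cexp z : cder cexp z (cexp z).
Proof.
  apply gder_ext with (f := fun w => cexp z * cexp (w - z)).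
  { intros w. rewrite <- cexp_plus. f_equal. ring. }
  eapply gder_eq; [|apply gder_scal, (gder_comp _ (fun w => w - z) cexp z 1 1)].
  - ring.
  - eapply gder_eq; [|apply gder_minus; [apply gder_id | apply gder_const]]. ring.
  - replace (z - z) with (RtoC 0) by ring. apply cder_cexp_0.
Qed.

Lemma cexp_Ci w : cexp (Ci * w) = RtoC (exp (- Im w)) * expi (Re w).
Proof.
  unfold cexp. simpl. f_equal; [do 2 f_equal | f_equal]; unfold Re, Im; ring.
Qed.

Section Angle.
Variables (F F1 : C -> C) (rho r : R).
Hypothesis HF : forall z, (Cmod z < rho)%R -> cder F z (F1 z).
Hypothesis HF1 : holo F1 rho.
Hypothesis HN : forall z, (Cmod z < rho)%R -> F z <> 0.
Hypothesis Hr : (0 < r < rho)%R.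

(** The logarithmic derivative of [F (circ r t)] in [t] is [i] times this quantity: its real part is
    the rate of change of the argument of [F] along the circle, its imaginary part minus that of the
    logarithm of the modulus. *)
Definition log_slope (t : R) : C := circ r t * F1 (circ r t) / F (circ r t).

Lemma circ_in t : (Cmod (circ r t) < rho)%R.
Proof. rewrite Cmod_circ; lra. Qed.

Lemma holo_F : holo F rho.
Proof. intros z Hz. eexists. apply HF, Hz. Qed.

Lemma holo_log_slope : holo (fun z => z * F1 z / F z) rho.
Proof. apply holo_div; [apply holo_mult; [apply holo_id | exact HF1] | exact holo_F | exact HN]. Qed.

Lemma cont_log_slope t : continuous log_slope t.
Proof. apply (cont_holo_circ _ rho r holo_log_slope Hr). Qed.

(** A zero-free function does not wind around 0: the mean of [z F1 / F] over the circle is its value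
    at 0. *)
Lemma log_slope_period : CInt log_slope 0 (2 * PI) = 0.
Proof.
  transitivity (RtoC (2 * PI) * (0 * F1 0 / F 0)).
  - apply (mean_value (fun z => z * F1 z / F z) rho r holo_log_slope Hr).
  - unfold Cdiv. ring.
Qed.

(** A continuous argument without a choice of logarithm: [F (circ r s)] times the exponential of
    minus [i] times the accumulated slope has derivative 0. *)
Lemma angle_formula a b : F (circ r b) = F (circ r a) * cexp (Ci * CInt log_slope a b).
Proof.
  pose proof (rder_zero_const (fun s => F (circ r s) * cexp (- (Ci) * CInt log_slope a s)) a b) as K.
  cbv beta in K. rewrite CInt_point, Cmult_0_r, cexp_0, Cmult_1_r in K.
  rewrite K.
  - rewrite <- Cmult_assoc, <- cexp_plus.
    replace (- Ci * CInt log_slope a b + Ci * CInt log_slope a b) with (RtoC 0) by ring.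
    rewrite cexp_0. ring.
  - intros s _. eapply gder_eq; [|apply gder_mult;
      [apply (gder_comp RtoC (circ r) F); [apply rder_circ | apply HF, circ_in]
      |apply (gder_comp RtoC (fun s => - Ci * CInt log_slope a s) cexp);
        [apply gder_scal, rder_CInt, cont_log_slope | apply cder_cexp]]].
    cbv beta. unfold log_slope at 3. pose proof (HN _ (circ_in s)).
    field. assumption.
Qed.
End Angle.

(** With [M] the primitive of [F1 / F] vanishing at 0, the product [F exp (- M)] is constant, so
    [F = exp M] and the square root is [exp (M / 2)]. *)
Lemma holo_sqrt F F1 rho : (0 < rho)%R ->
  (forall z, (Cmod z < rho)%R -> cder F z (F1 z)) -> holo F1 rho ->
  (forall z, (Cmod z < rho)%R -> F z <> 0) -> F 0 = 1 ->
  exists G, (forall z, (Cmod z < rho)%R -> cder G z (G z * F1 z / (2 * F z)) /\ G z * G z = F z /\ G z <> 0).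
Proof.
  intros Hrho HF HF1 HN H0.
  assert (HF' : holo F rho) by (intros z Hz; eexists; apply HF, Hz).
  destruct (holo_primitive (fun z => F1 z / F z) rho) as [L HL].
  { apply holo_div; assumption. }
  pose (M := fun z => L z - L 0).
  assert (HM : forall z, (Cmod z < rho)%R -> cder M z (F1 z / F z)).
  { intros z Hz. eapply gder_eq; [|apply gder_minus; [apply HL, Hz | apply gder_const]]. ring. }
  assert (Z : (Cmod 0 < rho)%R) by (rewrite Cmod_0; exact Hrho).
  assert (EF : forall z, (Cmod z < rho)%R -> F z = cexp (M z)).
  { intros z Hz.
    assert (E : F z * cexp (- M z) = F 0 * cexp (- M 0)).
    { apply (cder_zero_const (fun z => F z * cexp (- M z)) rho); [|exact Hz|exact Z].
      intros u Hu. eapply gder_eq; [|apply gder_mult; [apply HF, Hu|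
        apply (gder_comp _ (fun u => - M u) cexp); [|apply cder_cexp]]].
      2:{ apply gder_ext with (f := fun u => (-(1)) * M u); [intros; ring|].
          apply gder_scal, HM, Hu. }
      cbv beta. field. apply HN, Hu. }
    unfold M at 2 in E. replace (- (L 0 - L 0)) with (RtoC 0) in E by ring.
    rewrite cexp_0, H0 in E.
    transitivity (F z * cexp (- M z) * cexp (M z)).
    - rewrite <- Cmult_assoc, <- cexp_plus. replace (- M z + M z) with (RtoC 0) by ring.
      rewrite cexp_0. ring.
    - rewrite E. ring. }
  exists (fun z => cexp (RtoC (/ 2) * M z)). intros z Hz. split; [|split].
  - eapply gder_eq; [|apply (gder_comp _ (fun u => RtoC (/ 2) * M u) cexp); [apply gder_scal, HM, Hz | apply cder_cexp]].
    rewrite RtoC_inv by lra. field. apply HN, Hz.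
  - rewrite <- cexp_plus, EF by exact Hz. f_equal. apply injective_projections; simpl; field.
  - apply cexp_neq_0.
Qed.

(** On an arc the argument of [F] grows by less than half the integral of [p] and drops by at most
    half the integral of [q], so by less than [PI] either way. The range of the argument is then
    shorter than [PI] and fits into an open half-plane. *)
Lemma half_plane_of_slope F F1 rho r (p q : R -> R) :
  (forall z, (Cmod z < rho)%R -> cder F z (F1 z)) -> holo F1 rho ->
  (forall z, (Cmod z < rho)%R -> F z <> 0) -> (0 < r < rho)%R ->
  (forall t, continuous p t) -> (forall t, continuous q t) ->
  (forall t, (0 <= p t)%R) -> (forall t, (0 < q t)%R) ->
  RInt p 0 (2 * PI) = (2 * PI)%R -> RInt q 0 (2 * PI) = (2 * PI)%R ->
  (forall t, Re (log_slope F F1 r t) = (p t / 2 - q t / 2)%R) ->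
  exists nu, forall t, (0 <= t <= 2 * PI)%R -> (0 < Re (nu * F (circ r t)))%R.
Proof.
  intros HF HF1 HN Hr Hp Hq Hp0 Hq0 Ip Iq Hk. pose proof two_PI_pos as HPI.
  set (k := log_slope F F1 r).
  assert (Hkc : forall t, continuous k t) by (intros; eapply cont_log_slope; eassumption).
  pose (Psi := fun t => Re (CInt k 0 t)).
  assert (exp_ : forall a b, ex_RInt p a b).
  { intros. apply (ex_RInt_continuous (V := R_CompleteNormedModule)). intros; apply Hp. }
  assert (exq : forall a b, ex_RInt q a b).
  { intros. apply (ex_RInt_continuous (V := R_CompleteNormedModule)). intros; apply Hq. }
  assert (EPsi : forall a b, (Psi b - Psi a = RInt p a b / 2 - RInt q a b / 2)%R).
  { intros a b. unfold Psi.
    assert (E : Re (CInt k a b) = (RInt p a b / 2 - RInt q a b / 2)%R).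
    { rewrite Re_CInt. etransitivity.
      - apply (RInt_ext (V := R_CompleteNormedModule) _ (fun t => minus (scal (/ 2)%R (p t)) (scal (/ 2)%R (q t)))).
        intros t _. unfold k. rewrite Hk. unfold minus, plus, opp, scal; simpl. unfold mult; simpl. field.
      - etransitivity.
        + apply (RInt_minus (V := R_CompleteNormedModule)); apply (ex_RInt_scal (V := R_CompleteNormedModule)); auto.
        + unfold minus, plus, opp; simpl.
          rewrite !(RInt_scal (V := R_CompleteNormedModule)) by auto.
          unfold scal; simpl. unfold mult; simpl. field. }
    rewrite <- E, <- (CInt_Chasles k 0 a b) by (intros ? _; apply Hkc).
    unfold Re. simpl. ring. }
  assert (Chp : forall a b c, (RInt p a b + RInt p b c)%R = RInt p a c).
  { intros. apply (RInt_Chasles (V := R_CompleteNormedModule)); auto. }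
  assert (Chq : forall a b c, (RInt q a b + RInt q b c)%R = RInt q a c).
  { intros. apply (RInt_Chasles (V := R_CompleteNormedModule)); auto. }
  assert (Pp : forall a b, (a <= b)%R -> (0 <= RInt p a b)%R).
  { intros. apply RInt_ge_0; auto. }
  assert (Pq : forall a b, (a < b)%R -> (0 < RInt q a b)%R).
  { intros. apply RInt_gt_0; auto. }
  assert (Pq' : forall a b, (a <= b)%R -> (0 <= RInt q a b)%R).
  { intros. apply RInt_ge_0; auto. intros. apply Rlt_le, Hq0. }
  (* Strictness: [q > 0] on the arc limits the increase, [q > 0] off the arc limits the decrease,
     and over the full circle the change is 0. *)
  assert (Osc : forall a b, (0 <= a <= b)%R -> (b <= 2 * PI)%R -> (Rabs (Psi b - Psi a) < PI)%R).
  { intros a b Ha Hb.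
    destruct (Req_dec a b) as [->|Hab].
    { rewrite Rminus_diag, Rabs_R0. lra. }
    rewrite EPsi.
    pose proof (Chp 0 a b)%R as X1. pose proof (Chp 0 b (2 * PI))%R as X2.
    pose proof (Chq 0 a b)%R as X3. pose proof (Chq 0 b (2 * PI))%R as X4.
    pose proof (Pp 0 a ltac:(lra))%R. pose proof (Pp b (2 * PI) ltac:(lra))%R. pose proof (Pp a b ltac:(lra)).
    pose proof (Pq a b ltac:(lra)).
    pose proof (Pq' 0 a ltac:(lra))%R. pose proof (Pq' b (2 * PI) ltac:(lra))%R.
    apply Rabs_def1; [lra|].
    destruct (Req_dec a 0) as [Ea|Ea].
    - destruct (Req_dec b (2 * PI)) as [Eb|Eb].
      + rewrite Ea, Eb, Ip, Iq. lra.
      + pose proof (Pq b (2 * PI) ltac:(lra))%R. lra.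
    - pose proof (Pq 0 a ltac:(lra))%R. lra. }
  assert (HPc : forall t, (0 <= t <= 2 * PI)%R -> continuity_pt Psi t).
  { intros t _. apply continuity_pt_filterlim. apply (cont_Re (fun t => CInt k 0 t)).
    exact (rder_cont _ _ _ (rder_CInt k 0 t Hkc)). }
  destruct (continuity_ab_maj Psi 0 (2 * PI) ltac:(lra) HPc) as [tM [HM HtM]].
  destruct (continuity_ab_min Psi 0 (2 * PI) ltac:(lra) HPc) as [tm [Hm Htm]].
  assert (HO : (Psi tM - Psi tm < PI)%R).
  { destruct (Rle_dec tm tM) as [Hle|Hle].
    - pose proof (Osc tm tM ltac:(lra) ltac:(lra)) as O. apply Rabs_def2 in O. lra.
    - pose proof (Osc tM tm ltac:(lra) ltac:(lra)) as O. apply Rabs_def2 in O. lra. }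
  (* Rotating by the midpoint of the range of the argument puts all values into the right
     half-plane. *)
  set (c := ((Psi tM + Psi tm) / 2)%R).
  assert (N0 : F (circ r 0) <> 0) by (apply HN, (circ_in rho r Hr)).
  exists (expi (- c) / F (circ r 0)). intros t Ht.
  rewrite (angle_formula F F1 rho r HF HF1 HN Hr 0 t). fold k. rewrite cexp_Ci.
  replace (expi (- c) / F (circ r 0) * (F (circ r 0) * (RtoC (exp (- Im (CInt k 0 t))) * expi (Re (CInt k 0 t)))))
    with (RtoC (exp (- Im (CInt k 0 t))) * (expi (- c) * expi (Psi t))) by (unfold Psi; field; exact N0).
  rewrite <- expi_plus, re_scal_l.
  apply Rmult_lt_0_compat; [apply exp_pos|]. simpl.
  specialize (HM t Ht). specialize (Hm t Ht). apply cos_gt_0; unfold c; lra.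
Qed.

Lemma Re_Cayley_pos w : (Cmod w < 1)%R -> (0 < Re ((1 + w) / (1 - w)))%R.
Proof.
  intros Hw.
  assert (N : 1 - w <> 0).
  { intros E. apply Ceq_minus in E. rewrite <- E, Cmod_1 in Hw. lra. }
  assert (Np : (0 < Cmod (1 - w))%R) by (apply Cmod_gt_0; exact N).
  assert (Nc : Cconj (1 - w) <> 0).
  { intros E. apply (f_equal Cmod) in E. rewrite Cmod_conj, Cmod_0 in E. lra. }
  replace ((1 + w) / (1 - w)) with (RtoC (/ (Cmod (1 - w) * Cmod (1 - w))) * ((1 + w) * Cconj (1 - w))).
  - rewrite re_scal_l. apply Rmult_lt_0_compat.
    + apply Rinv_0_lt_compat, Rmult_lt_0_compat; assumption.
    + pose proof (Cmod_sqr w) as E. pose proof (Cmod_ge_0 w). unfold Re, Im in *. simpl in *. nra.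
  - rewrite RtoC_inv, <- Cmod_sqr_conj by (apply Rgt_not_eq, Rmult_lt_0_compat; assumption).
    field. split; assumption.
Qed.

Lemma one_minus_neq a z : (Cmod a * Cmod z < 1)%R -> 1 - a * z <> 0.
Proof.
  intros H E. apply Ceq_minus in E. apply (f_equal Cmod) in E. rewrite Cmod_1, Cmod_mult in E. lra.
Qed.

(* Along the circle the argument of [(1 - a z) G] varies at the rate
   [(p - q) / 2] with [p >= 0], [q > 0] both of mean [1], hence by less than [PI]. *)
Lemma half_plane_sqrt F F1 G rho r a : (0 < r < rho)%R -> (Cmod a * r < 1)%R ->
  (forall z, (Cmod z < rho)%R -> cder F z (F1 z)) -> holo F1 rho ->
  (forall z, (Cmod z < rho)%R -> F z <> 0) ->
  (forall z, (Cmod z < rho)%R -> (0 <= Re (1 + z * F1 z / F z))%R) ->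
  (forall z, (Cmod z < rho)%R -> cder G z (G z * F1 z / (2 * F z)) /\ G z * G z = F z /\ G z <> 0) ->
  exists nu, forall t, (0 <= t <= 2 * PI)%R -> (0 < Re (nu * ((1 - a * circ r t) * G (circ r t))))%R.
Proof.
  intros Hr Ha HF HF1 HN Hre HG. pose proof (Cmod_ge_0 a) as Ha0.
  (* A radius beyond [r] for which [1 - a z] still has no zero, as the mean value property on the
     circle of radius [r] requires. *)
  assert (Hs : exists s, (r < s <= rho)%R /\ (Cmod a * s <= 1)%R).
  { exists (Rmin rho (1 / (Cmod a + (1 / r - Cmod a) / 2)))%R.
    assert (Hir : (Cmod a < 1 / r)%R).
    { apply Rmult_lt_reg_r with r; [lra|]. unfold Rdiv. rewrite Rmult_assoc, Rinv_l by lra. lra. }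
    set (m := (Cmod a + (1 / r - Cmod a) / 2)%R).
    assert (Hm : (Cmod a < m < 1 / r)%R) by (unfold m; lra).
    assert (Em : (1 / m * m = 1)%R) by (field; lra).
    assert (Er : (1 / r * r = 1)%R) by (field; lra).
    assert (Hp : (0 < 1 / m)%R) by (apply Rdiv_lt_0_compat; lra).
    split; [split; [apply Rmin_glb_lt; [lra|nra]|apply Rmin_l]|].
    pose proof (Rmin_r rho (1 / m)). nra. }
  destruct Hs as [s [Hs1 Hs2]].
  assert (Nl : forall z, (Cmod z < s)%R -> 1 - a * z <> 0).
  { intros z Hz. apply one_minus_neq. pose proof (Cmod_ge_0 z).
    destruct (Req_dec (Cmod a) 0) as [E|E]; [rewrite E; lra|].
    apply Rlt_le_trans with (Cmod a * s)%R; [apply Rmult_lt_compat_l; lra | exact Hs2]. }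
  assert (HFs : holo F s) by (intros z Hz; eexists; apply HF; lra).
  assert (HF1s : holo F1 s) by (apply holo_le with (2 := HF1); lra).
  assert (HGs : holo G s) by (intros z Hz; eexists; apply HG; lra).
  assert (Hlin : holo (fun z => 1 - a * z) s).
  { apply holo_minus; [apply holo_const | apply holo_mult; [apply holo_const | apply holo_id]]. }
  assert (Hrs : (0 < r < s)%R) by lra.
  assert (Hci : forall t, (Cmod (circ r t) < s)%R) by (intros; rewrite Cmod_circ; lra).
  assert (N2 : RtoC 2 <> 0) by (apply RtoC_neq; lra).
  assert (Hpq1 : holo (fun z => 1 + z * F1 z / F z) s).
  { apply holo_plus; [apply holo_const|]. apply holo_div; [apply holo_mult; [apply holo_id|]| |]; auto.
    intros z Hz. apply HN. lra. }
  assert (Hpq2 : holo (fun z => (1 + a * z) / (1 - a * z)) s).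
  { apply holo_div; auto. apply holo_plus; [apply holo_const | apply holo_mult; [apply holo_const | apply holo_id]]. }
  pose (D := fun z => - a * G z + (1 - a * z) * (G z * F1 z / (2 * F z))).
  apply (half_plane_of_slope (fun z => (1 - a * z) * G z) D s r
    (fun t => Re (1 + circ r t * F1 (circ r t) / F (circ r t)))
    (fun t => Re ((1 + a * circ r t) / (1 - a * circ r t)))).
  - intros z Hz. eapply gder_eq; [|apply gder_mult; [apply gder_minus; [apply gder_const | apply cder_scal] | apply HG; lra]].
    unfold D. cbv beta. ring.
  - unfold D. apply holo_plus; apply holo_mult; auto; try apply holo_const.
    apply holo_div; [apply holo_mult | apply holo_mult; [apply holo_const|]|]; auto.
    intros z Hz. apply Cmult_neq_0; [exact N2 | apply HN; lra].
  - intros z Hz. apply Cmult_neq_0; [apply Nl, Hz | apply HG; lra].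
  - exact Hrs.
  - intros t. apply cont_Re. apply (cont_holo_circ _ s r Hpq1 Hrs).
  - intros t. apply cont_Re. apply (cont_holo_circ _ s r Hpq2 Hrs).
  - intros t. apply Hre. rewrite Cmod_circ; lra.
  - intros t. apply Re_Cayley_pos. rewrite Cmod_mult, Cmod_circ; lra.
  - pose proof (f_equal Re (mean_value _ s r Hpq1 Hrs)) as E. rewrite Re_CInt in E.
    etransitivity; [exact E|]. rewrite re_scal_l. unfold Cdiv. rewrite !Cmult_0_l, Cplus_0_r. simpl. ring.
  - pose proof (f_equal Re (mean_value _ s r Hpq2 Hrs)) as E. rewrite Re_CInt in E.
    etransitivity; [exact E|]. rewrite re_scal_l. rewrite Cmult_0_r.
    replace ((1 + 0) / (1 - 0)) with (RtoC 1); [simpl; ring|]. field.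
  - intros t. unfold log_slope, D. cbv beta. specialize (Nl _ (Hci t)).
    pose proof (HN (circ r t) ltac:(specialize (Hci t); lra)) as NF.
    destruct (HG (circ r t) ltac:(specialize (Hci t); lra)) as [_ [_ NG]].
    set (z := circ r t) in *.
    (* The factor [1 - a z] contributes [- a z / (1 - a z) = 1/2 - (1 + a z) / (2 (1 - a z))], and
       [G] contributes half the slope of [F]; the constant 1/2 completes the latter to
       [(1 + z F1 / F) / 2]. *)
    replace (z * (- a * G z + (1 - a * z) * (G z * F1 z / (2 * F z))) / ((1 - a * z) * G z)) with
      (RtoC (/ 2) * (1 + z * F1 z / F z) - RtoC (/ 2) * ((1 + a * z) / (1 - a * z))).
    2:{ rewrite RtoC_inv by lra. field. repeat split; auto. }
    unfold Cminus at 1. unfold Re at 1. cbn [fst Cplus Copp].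
    change (Re (RtoC (/ 2) * (1 + z * F1 z / F z)) + - Re (RtoC (/ 2) * ((1 + a * z) / (1 - a * z))) =
      Re (1 + z * F1 z / F z) / 2 - Re ((1 + a * z) / (1 - a * z)) / 2)%R.
    rewrite !re_scal_l. field.
Qed.

(** * The functional, with one simple pole *)

Lemma con01_mult f g : con f 0 1 -> con g 0 1 -> con (fun t => f t * g t) 0 1.
Proof. intros Hf Hg x Hx. apply cont_mult; auto. Qed.

Lemma con_RtoC a b : con RtoC a b.
Proof. intros x _. apply cont_RtoC, continuous_id. Qed.

Lemma con_const (c : C) a b : con (fun _ => c) a b.
Proof. intros x _. apply cont_const. Qed.

Lemma con_lin a : con (fun t => 1 - RtoC t * a) 0 1.
Proof.
  intros x _. apply cont_minus; [apply cont_const|]. apply cont_mult; [|apply cont_const].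
  apply cont_RtoC, continuous_id.
Qed.

Definition ker (b : C) (t : R) : C := / (1 - RtoC t * b).

Lemma ker_neq b t : (Cmod b < 1)%R -> (0 <= t <= 1)%R -> 1 - RtoC t * b <> 0.
Proof.
  intros Hb Ht. apply one_minus_neq. rewrite Cmod_R, Rabs_pos_eq by lra.
  pose proof (Cmod_ge_0 b). nra.
Qed.

Lemma one_sub_neq z : (Cmod z < 1)%R -> 1 - z <> 0.
Proof.
  intros Hz. replace (1 - z) with (1 - RtoC 1 * z) by ring. apply ker_neq; [exact Hz | lra].
Qed.

Lemma con_ker b : (Cmod b < 1)%R -> con (ker b) 0 1.
Proof.
  intros Hb x Hx. apply cont_Cinv; [apply (con_lin b x Hx)|].
  rewrite Rmin_left, Rmax_right in Hx by lra. apply ker_neq; assumption.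
Qed.

#[local] Hint Resolve con01_mult con_RtoC con_const con_lin con_ker con_scal : con.

Definition LL (om : C) (phi : R -> C) : C := om * phi 1%R - CInt phi 0 1.

Section Functional.
Variable om : C.

Lemma LL_ext f g : (forall t, (0 <= t <= 1)%R -> f t = g t) -> LL om f = LL om g.
Proof.
  intros H. unfold LL. rewrite H by lra. rewrite (CInt_ext f g 0 1); [reflexivity|]. intros t Ht.
  rewrite Rmin_left, Rmax_right in Ht by lra. apply H. lra.
Qed.

Lemma LL_plus f g : con f 0 1 -> con g 0 1 -> LL om (fun t => f t + g t) = LL om f + LL om g.
Proof. intros Hf Hg. unfold LL. rewrite CInt_plus by assumption. ring. Qed.

Lemma LL_minus f g : con f 0 1 -> con g 0 1 -> LL om (fun t => f t - g t) = LL om f - LL om g.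
Proof. intros Hf Hg. unfold LL. rewrite CInt_minus by assumption. ring. Qed.

Lemma LL_scal c f : con f 0 1 -> LL om (fun t => c * f t) = c * LL om f.
Proof. intros Hf. unfold LL. rewrite CInt_scal by assumption. ring. Qed.

Lemma cder_LL1 k z : con k 0 1 -> (Cmod z < 1)%R ->
  cder (fun b => LL om (fun t => k t * ker b t)) z (LL om (fun t => k t * RtoC t * (ker z t * ker z t))).
Proof.
  intros Hk Hz. unfold LL, ker. apply gder_minus.
  - rewrite !Cmult_assoc. rewrite (Cmult_comm _ (/ _)).
    apply gder_ext with (f := fun b => (om * k 1%R) * / (1 - RtoC 1 * b)); [intros; ring|].
    eapply gder_eq; [|apply gder_scal, gder_inv; [apply ker_neq; [exact Hz | lra]|
      apply gder_minus; [apply gder_const | apply cder_scal]]].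
    cbv beta. field. exact (one_sub_neq z Hz).
  - eapply gder_eq; [|apply (cder_kernel1 k (fun _ => 1) RtoC 0 1 z); auto with con; [lra|]].
    + apply CInt_ext. intros t Ht. rewrite Rmin_left, Rmax_right in Ht by lra.
      field. apply ker_neq; [exact Hz | lra].
    + intros t Ht. apply ker_neq; assumption.
Qed.

Lemma cder_LL2 k z : con k 0 1 -> (Cmod z < 1)%R ->
  cder (fun b => LL om (fun t => k t * (ker b t * ker b t))) z
    (LL om (fun t => 2 * (k t * RtoC t * (ker z t * ker z t * ker z t)))).
Proof.
  intros Hk Hz.
  assert (Hnear : forall u, (Cmod (u - z) < 1 - Cmod z)%R -> (Cmod u < 1)%R).
  { intros u Hu. pose proof (Cmod_triangle (u - z) z) as T. replace (u - z + z) with u in T by ring. lra. }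
  unfold LL. apply gder_minus.
  - unfold ker. assert (N : 1 - RtoC 1 * z <> 0) by (apply ker_neq; [exact Hz | lra]).
    pose proof (gder_inv (fun z : C => z) (fun b => 1 - RtoC 1 * b) z _ N
      (gder_minus _ _ _ _ _ _ (gder_const _ 1 z) (cder_scal (RtoC 1) z))) as D.
    eapply gder_eq; [|apply gder_scal, gder_scal, gder_mult; exact D].
    cbv beta. field. exact (one_sub_neq z Hz).
  - eapply gder_eq; [|eapply gder_ext_loc; [| |apply (cder_kernel2 k (fun _ => 1) RtoC 0 1 z); auto with con; [lra|]]].
    + apply CInt_ext. intros t Ht. rewrite Rmin_left, Rmax_right in Ht by lra. unfold ker.
      field. apply ker_neq; [exact Hz | lra].
    + instantiate (1 := (1 - Cmod z)%R). lra.
    + intros u Hu. apply CInt_ext. intros t Ht. rewrite Rmin_left, Rmax_right in Ht by lra. unfold ker.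
      field. apply ker_neq; [apply Hnear, Hu | lra].
    + intros t Ht. apply ker_neq; assumption.
Qed.

Lemma holo_LL1 k : con k 0 1 -> holo (fun b => LL om (fun t => k t * ker b t)) 1.
Proof. intros Hk z Hz. eexists. apply cder_LL1; assumption. Qed.

Lemma holo_LL2 k : con k 0 1 -> holo (fun b => LL om (fun t => k t * (ker b t * ker b t))) 1.
Proof. intros Hk z Hz. eexists. apply cder_LL2; assumption. Qed.

(** The hypothesis forces [|A| >= s |B|], since otherwise [a = A / B] would be a zero. Hence
    [N = A - b B] satisfies [|A - N| < |A|], and [X = A / N] satisfies [|X - 1| < |X|], which
    describes the half-plane [Re X > 1/2]. *)
Lemma half_of_nonvanish (A B b : C) (s : R) : (0 < s)%R -> (Cmod b < s)%R ->
  (forall a, (Cmod a < s)%R -> A - a * B <> 0) ->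
  A - b * B <> 0 /\ (1 / 2 < Re (A / (A - b * B)))%R.
Proof.
  intros Hs Hb H. split; [apply H, Hb|].
  assert (HA : A <> 0).
  { specialize (H 0). rewrite Cmod_0, Cmult_0_l in H. unfold Cminus in H.
    rewrite Copp_0, Cplus_0_r in H. apply H, Hs. }
  assert (HN : A - b * B <> 0) by (apply H, Hb).
  set (N := A - b * B) in *.
  assert (Hlt : (Cmod (A - N) < Cmod A)%R).
  { replace (A - N) with (b * B) by (unfold N; ring). rewrite Cmod_mult.
    destruct (Ceq_dec B 0) as [->|HB].
    - rewrite Cmod_0, Rmult_0_r. apply Cmod_gt_0, HA.
    - assert (HBp : (0 < Cmod B)%R) by (apply Cmod_gt_0, HB).
      apply Rlt_le_trans with (s * Cmod B)%R; [apply Rmult_lt_compat_r; assumption|].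
      apply Rnot_lt_le. intros Hc. apply (H (A / B)).
      + rewrite Cmod_div by exact HB. apply Rmult_lt_reg_r with (Cmod B); [exact HBp|].
        unfold Rdiv. rewrite Rmult_assoc, Rinv_l by lra. lra.
      + field. exact HB. }
  set (X := A / N).
  assert (EA : A = X * N) by (unfold X; field; exact HN).
  assert (Hx : (Cmod (X - 1) < Cmod X)%R).
  { apply Rmult_lt_reg_r with (Cmod N); [apply Cmod_gt_0, HN|].
    rewrite <- !Cmod_mult, <- EA. replace ((X - 1) * N) with (A - N) by (rewrite EA; ring). exact Hlt. }
  pose proof (Cmod_sqr (X - 1)) as S1. pose proof (Cmod_sqr X) as S2.
  pose proof (Cmod_ge_0 (X - 1)) as H0.
  assert (Hsq : (Cmod (X - 1) * Cmod (X - 1) < Cmod X * Cmod X)%R).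
  { apply Rmult_le_0_lt_compat; assumption. }
  rewrite S1, S2 in Hsq.
  replace (Re (X - 1)) with (Re X - 1)%R in Hsq by reflexivity.
  replace (Im (X - 1)) with (Im X)%R in Hsq by (simpl; ring).
  lra.
Qed.

Lemma LL_lin k a : con k 0 1 -> LL om (fun t => k t * (1 - RtoC t * a)) =
  LL om k - a * LL om (fun t => k t * RtoC t).
Proof.
  intros Hk. rewrite <- LL_scal, <- LL_minus by auto with con.
  apply LL_ext. intros. ring.
Qed.

(** Partial fractions of [1 / ((1 - b t) (1 - e t))] inside the functional: a product of two kernels
    is reduced to a difference quotient. *)
Lemma LL_ker_pair k b e : con k 0 1 -> (Cmod b < 1)%R -> (Cmod e < 1)%R ->
  (b - e) * LL om (fun t => k t * (ker b t * ker e t)) =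
  b * LL om (fun t => k t * ker b t) - e * LL om (fun t => k t * ker e t).
Proof.
  intros Hk Hb He. rewrite <- !LL_scal, <- LL_minus by auto with con.
  apply LL_ext. intros t Ht. unfold ker. field. split; apply ker_neq; assumption.
Qed.
End Functional.

Lemma circ_le_1 s t : (0 <= s < 1)%R -> (Cmod (circ s t) < 1)%R.
Proof. intros H. rewrite Cmod_circ; lra. Qed.

Lemma re_plus (x y : C) : Re (x + y) = (Re x + Re y)%R.
Proof. reflexivity. Qed.

Lemma Re_div (x y : C) : y <> 0 -> Re (x / y) = (Re (x * Cconj y) / (Cmod y * Cmod y))%R.
Proof.
  intros Hy.
  assert (Hp : (0 < Cmod y)%R) by (apply Cmod_gt_0; exact Hy).
  assert (Nc : Cconj y <> 0).
  { intros E. apply (f_equal Cmod) in E. rewrite Cmod_conj, Cmod_0 in E. lra. }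
  replace (x / y) with (RtoC (/ (Cmod y * Cmod y)) * (x * Cconj y)).
  - rewrite re_scal_l. unfold Rdiv. ring.
  - rewrite RtoC_inv, <- Cmod_sqr_conj by (apply Rgt_not_eq, Rmult_lt_0_compat; assumption).
    field. split; assumption.
Qed.

(** The map [e |-> b / (b - e)] sends the circle through [b] centred at 0 to the line [Re = 1/2];
    the bound 1/2 is thus what the pole itself contributes. *)
Lemma Re_chord (b e : C) : Cmod b = Cmod e -> b <> e -> Re (b / (b - e)) = (1 / 2)%R.
Proof.
  intros He Hne. assert (N : b - e <> 0) by (apply Cminus_eq_contra; exact Hne).
  rewrite Re_div by exact N.
  assert (Hp : (0 < Cmod (b - e) * Cmod (b - e))%R) by (apply Cmod_gt_0 in N; apply Rmult_lt_0_compat; assumption).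
  apply Rmult_eq_reg_r with (Cmod (b - e) * Cmod (b - e))%R; [|lra].
  unfold Rdiv at 1. rewrite Rmult_assoc, Rinv_l, Rmult_1_r by lra.
  pose proof (Cmod_sqr (b - e)) as S. pose proof (Cmod_sqr b) as Sb. pose proof (Cmod_sqr e) as Se.
  rewrite He in Sb. rewrite S. unfold Re, Im in *.
  destruct b as [b1 b2], e as [e1 e2]. cbn [fst snd Cminus Cplus Copp Cmult Cconj] in *. lra.
Qed.

Section Order_one.
Variables (om : C) (k : R -> C) (s sg : R).
Hypotheses (Hk : con k 0 1) (Hs : (0 < sg < s)%R) (Hs1 : (s <= 1)%R).
Hypothesis HQ : forall a b, (Cmod a < s)%R -> (Cmod b < s)%R ->
  LL om (fun t => k t * (ker b t * ker b t) * (1 - RtoC t * a)) <> 0.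

Let E (b : C) : C := LL om (fun t => k t * ker b t).
Let E1 (b : C) : C := LL om (fun t => k t * RtoC t * (ker b t * ker b t)).
Let R2 (b e : C) : C := LL om (fun t => k t * (ker b t * ker e t)) / E b.

(** At [a = b] the linear factor cancels one of the two poles and leaves [E b], so the hypothesis
    yields both the non-vanishing of the denominator and, by [half_of_nonvanish], the inequality for
    coinciding poles. *)
Lemma oo_diag b : (Cmod b < s)%R -> E b <> 0 /\ (1 / 2 < Re (R2 b b))%R.
Proof.
  intros Hb.
  destruct (half_of_nonvanish (LL om (fun t => k t * (ker b t * ker b t)))
    (LL om (fun t => k t * (ker b t * ker b t) * RtoC t)) b s) as [H1 H2]; [lra|exact Hb| |].
  - intros a Ha. rewrite <- LL_lin by (auto with con; apply con01_mult; auto; apply con01_mult; apply con_ker; lra).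
    apply HQ; assumption.
  - assert (EE : LL om (fun t => k t * (ker b t * ker b t)) - b * LL om (fun t => k t * (ker b t * ker b t) * RtoC t) = E b).
    { rewrite <- LL_lin by (auto with con; apply con01_mult; auto; apply con01_mult; apply con_ker; lra).
      apply LL_ext. intros t Ht. unfold ker. field. apply ker_neq; lra. }
    rewrite EE in H1, H2. split; [exact H1 | exact H2].
Qed.

Lemma oo_E_cder z : (Cmod z < s)%R -> cder E z (E1 z).
Proof. intros Hz. apply cder_LL1; [exact Hk | lra]. Qed.

Lemma oo_E1_holo : holo E1 s.
Proof. apply holo_le with 1%R; [exact Hs1|]. apply (holo_LL2 om (fun t => k t * RtoC t)). auto with con. Qed.

(** Since [R2 b b = 1 + b E' / E], the diagonal inequality says that the argument of [sqrt b E(b)]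
    increases along the circle. *)
Lemma oo_slope t : (0 < 1 / 2 + Re (log_slope E E1 sg t))%R.
Proof.
  assert (Hc : (Cmod (circ sg t) < s)%R) by (rewrite Cmod_circ; lra).
  destruct (oo_diag _ Hc) as [D1 D2]. unfold log_slope. set (b := circ sg t) in *.
  assert (EE : R2 b b = 1 + b * E1 b / E b).
  { unfold R2. replace (LL om (fun t => k t * (ker b t * ker b t))) with (E b + b * E1 b).
    - field. exact D1.
    - unfold E, E1. assert (Hcb : con (ker b) 0 1) by (apply con_ker; lra).
      rewrite <- LL_scal, <- LL_plus by auto 8 with con.
      apply LL_ext. intros u Hu. unfold ker. field. apply ker_neq; lra. }
  rewrite EE in D2. replace (Re (1 + b * E1 b / E b)) with (1 + Re (b * E1 b / E b))%R in D2 by reflexivity.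
  lra.
Qed.

Lemma expi_minus_1 x : expi x - 1 = 2 * Ci * RtoC (sin (x / 2)) * expi (x / 2).
Proof.
  replace x with (x / 2 + x / 2)%R at 1 by field. rewrite expi_plus.
  pose proof (sin2_cos2 (x / 2)) as H. unfold Rsqr in H.
  apply injective_projections; simpl; [|ring].
  lra.
Qed.

(** Partial fractions give [R2 b e = b / (b - e) + (e / (e - b)) (E e / E b)]. The first term has
    real part 1/2. The real part of the second is a positive multiple of [sin Phi / sin (d / 2)],
    where [Phi] and [d / 2] are the increments of the arguments of [sqrt b E(b)] and of [sqrt b];
    both increase, by [PI] over the full circle, so the two sines have the same sign. *)
Lemma oo_torus be th : (0 <= be <= 2 * PI)%R -> (0 <= th <= 2 * PI)%R ->
  (1 / 2 < Re (R2 (circ sg be) (circ sg th)))%R.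
Proof.
  intros Hbe Hth. pose proof two_PI_pos as HPI.
  assert (Hc : forall t, (Cmod (circ sg t) < s)%R) by (intros; rewrite Cmod_circ; lra).
  destruct (Ceq_dec (circ sg be) (circ sg th)) as [Heq|Hneq].
  { rewrite <- Heq. apply oo_diag, Hc. }
  assert (HN : forall z, (Cmod z < s)%R -> E z <> 0) by (intros z Hz; apply oo_diag, Hz).
  assert (Hkc : forall t, continuous (log_slope E E1 sg) t).
  { intros t. apply (cont_log_slope E E1 s sg oo_E_cder oo_E1_holo HN Hs). }
  pose (p := fun t => (1 / 2 + Re (log_slope E E1 sg t))%R).
  assert (Hpc : forall t, continuous p t).
  { intros t. apply (continuous_plus (V := R_NormedModule) (fun _ => (1 / 2)%R)); [apply continuous_const|].
    apply (cont_Re (log_slope E E1 sg)), Hkc. }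
  assert (Hp : forall t, (0 < p t)%R) by (intros; apply oo_slope).
  assert (Ip : forall a b, RInt p a b = ((b - a) / 2 + Re (CInt (log_slope E E1 sg) a b))%R).
  { intros a b. etransitivity.
    - apply (RInt_plus (V := R_CompleteNormedModule) (fun _ => (1 / 2)%R)).
      + apply (ex_RInt_const (V := R_NormedModule)).
      + apply con_Re. intros t _. apply Hkc.
    - rewrite (RInt_const (V := R_CompleteNormedModule)). unfold plus, scal; simpl. unfold mult; simpl.
      unfold Re. simpl. f_equal. field. }
  assert (exp_ : forall a b, ex_RInt p a b).
  { intros. apply (ex_RInt_continuous (V := R_CompleteNormedModule)). intros; apply Hpc. }
  assert (Chp : forall a b c, (RInt p a b + RInt p b c)%R = RInt p a c).
  { intros. apply (RInt_Chasles (V := R_CompleteNormedModule)); auto. }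
  assert (Pp : forall a b, (a < b)%R -> (0 < RInt p a b)%R) by (intros; apply RInt_gt_0; auto).
  assert (Pp' : forall a b, (a <= b)%R -> (0 <= RInt p a b)%R).
  { intros. apply RInt_ge_0; auto. intros; apply Rlt_le, Hp. }
  assert (Tot : RInt p 0 (2 * PI) = PI).
  { rewrite Ip, (log_slope_period E E1 s sg oo_E_cder oo_E1_holo HN Hs). simpl. field. }
  set (d := (th - be)%R). set (Phi := RInt p be th).
  (* Both increments have the sign of [th - be] and modulus below [PI], because two distinct points
     of the circle do not span the whole parameter interval. *)
  assert (Hsign : (0 < sin Phi / sin (d / 2))%R /\ sin (d / 2) <> 0%R).
  { assert (K : forall a b, (0 <= a < b)%R -> (b <= 2 * PI)%R -> circ sg a <> circ sg b ->
      (0 < sin (RInt p a b))%R /\ (0 < sin ((b - a) / 2))%R).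
    { intros a b Ha Hb Hab.
      pose proof (Chp 0 a b)%R. pose proof (Chp 0 b (2 * PI))%R.
      pose proof (Pp a b ltac:(lra)). pose proof (Pp' 0 a ltac:(lra))%R. pose proof (Pp' b (2 * PI) ltac:(lra))%R.
      assert (Hnf : (0 < a \/ b < 2 * PI)%R).
      { destruct (Rle_lt_or_eq_dec 0 a ltac:(lra)) as [|Ea]; [left; assumption|].
        destruct (Rle_lt_or_eq_dec b (2 * PI) Hb) as [|Eb]; [right; assumption|].
        exfalso. apply Hab. rewrite <- Ea, Eb. symmetry. apply circ_2PI. }
      split; apply sin_gt_0; try lra.
      destruct Hnf; [pose proof (Pp 0 a ltac:(lra))%R | pose proof (Pp b (2 * PI) ltac:(lra))%R]; lra. }
    destruct (Rtotal_order be th) as [Hlt|[He|Hgt]].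
    - destruct (K be th ltac:(lra) ltac:(lra) Hneq) as [K1 K2]. fold d Phi in K1, K2.
      split; [apply Rdiv_lt_0_compat; assumption | lra].
    - exfalso. apply Hneq. rewrite He. reflexivity.
    - destruct (K th be ltac:(lra) ltac:(lra)) as [K1 K2]; [intros E0; apply Hneq; symmetry; exact E0|].
      assert (EP : Phi = (- RInt p th be)%R).
      { unfold Phi. symmetry. apply (opp_RInt_swap (V := R_CompleteNormedModule)). apply exp_. }
      assert (Ed : (d / 2 = - ((be - th) / 2))%R) by (unfold d; field).
      rewrite EP, Ed, !sin_neg. split; [|lra].
      replace (- sin (RInt p th be) / - sin ((be - th) / 2))%R with (sin (RInt p th be) / sin ((be - th) / 2))%R by (field; lra).
      apply Rdiv_lt_0_compat; assumption. }
  destruct Hsign as [Hsign Hsn].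
  set (b := circ sg be) in *. set (e := circ sg th) in *.
  assert (Hb : (Cmod b < 1)%R) by (specialize (Hc be); unfold b; lra).
  assert (He : (Cmod e < 1)%R) by (specialize (Hc th); unfold e; lra).
  assert (Hbe0 : b - e <> 0) by (apply Cminus_eq_contra; exact Hneq).
  assert (Eb : E b <> 0) by (apply HN, Hc).
  set (W := CInt (log_slope E E1 sg) be th).
  assert (Ee : E e = E b * cexp (Ci * W)).
  { apply (angle_formula E E1 s sg oo_E_cder oo_E1_holo HN Hs). }
  assert (Eeb : e = b * expi d).
  { unfold e, b, circ, d. rewrite <- Cmult_assoc, <- expi_plus. do 2 f_equal. ring. }
  assert (b0 : b <> 0).
  { apply Cmod_gt_0. unfold b. rewrite Cmod_circ; lra. }
  (* Here [e / (e - b) = expi (d / 2) / (2 i sin (d / 2))], and the half-angle joins the argument of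
     [E e / E b] to form [Phi]. *)
  assert (ER : R2 b e = b / (b - e) + RtoC (exp (- Im W) / (2 * sin (d / 2))) * (- Ci * expi Phi)).
  { unfold R2.
    assert (P := LL_ker_pair om k b e Hk Hb He). fold (E b) (E e) in P.
    replace (LL om (fun t => k t * (ker b t * ker e t))) with ((b * E b - e * E e) / (b - e))
      by (rewrite <- P; field; exact Hbe0).
    transitivity (b / (b - e) + (e / (e - b)) * (E e / E b)).
    { field. repeat split; auto. intros E0. apply Hbe0. replace (b - e) with (- (e - b)) by ring. rewrite E0. ring. }
    f_equal. rewrite Ee, cexp_Ci.
    assert (HX : expi d - 1 <> 0).
    { intros E0. apply Hbe0. rewrite Eeb. replace (b - b * expi d) with (- b * (expi d - 1)) by ring. rewrite E0. ring. }
    transitivity (expi d / (expi d - 1) * (RtoC (exp (- Im W)) * expi (Re W))).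
    { rewrite Eeb. field. repeat split; auto.
      replace (b * expi d - b) with (b * (expi d - 1)) by ring. apply Cmult_neq_0; assumption. }
    assert (EPhi : Phi = (d / 2 + Re W)%R) by (unfold Phi; rewrite Ip; reflexivity).
    rewrite EPhi, expi_plus, expi_minus_1.
    replace (expi d) with (expi (d / 2) * expi (d / 2)) by (rewrite <- expi_plus; f_equal; field).
    rewrite RtoC_div, RtoC_mult by lra.
    pose proof (expi_neq_0 (d / 2)). pose proof (RtoC_neq _ Hsn).
    assert (E2 : - Ci = / Ci).
    { transitivity (- Ci * (Ci * / Ci)); [rewrite Cinv_r by apply Ci_nz; ring|].
      replace (- Ci * (Ci * / Ci)) with (- (Ci * Ci) * / Ci) by ring.
      replace (- (Ci * Ci)) with (RtoC 1) by (apply injective_projections; simpl; ring). ring. }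
    rewrite E2. field. repeat split; auto. apply Ci_nz. }
  rewrite ER.
  replace (Re (b / (b - e) + RtoC (exp (- Im W) / (2 * sin (d / 2))) * (- Ci * expi Phi))) with
    (Re (b / (b - e)) + exp (- Im W) / (2 * sin (d / 2)) * sin Phi)%R.
  2:{ rewrite re_plus, re_scal_l. f_equal. f_equal. unfold Re. simpl. ring. }
  assert (Hhalf : Re (b / (b - e)) = (1 / 2)%R).
  { apply Re_chord; [|exact Hneq]. unfold b, e. rewrite !Cmod_circ by lra. reflexivity. }
  rewrite Hhalf.
  assert (0 < exp (- Im W) / (2 * sin (d / 2)) * sin Phi)%R; [|lra].
  replace (exp (- Im W) / (2 * sin (d / 2)) * sin Phi)%R with (exp (- Im W) / 2 * (sin Phi / sin (d / 2)))%R by (field; exact Hsn).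
  apply Rmult_lt_0_compat; [|exact Hsign]. pose proof (exp_pos (- Im W)). lra.
Qed.
End Order_one.

(** * The functional, with a double pole *)

Section Sine_integral.
Variables (p m : R -> R).
Hypotheses (Hpc : forall t, continuous p t) (Hp : forall t, (0 < p t)%R)
  (Hm : forall t, (0 < m t)%R)
  (Tot : RInt p 0 (2 * PI) = (2 * PI)%R).
Variable be : R.
Hypothesis Hbe : (0 <= be <= 2 * PI)%R.
Let S (t : R) : R := (m t * sin (RInt p be t))%R.
Hypothesis Sc : forall t, continuous S t.
Hypothesis Closed : RInt S 0 (2 * PI) = 0%R.

(* [S] has the sign of the sine of an angle increasing by [2 PI] in total, and
   its integral over the whole circle is [0]. *)
Lemma sine_integral_pos th : (0 <= th <= 2 * PI)%R -> be <> th ->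
  (0 < be \/ th < 2 * PI)%R -> (be < 2 * PI \/ 0 < th)%R ->
  (0 < RInt S be th)%R.
Proof.
  intros Hth Hne Hd1 Hd2. pose proof two_PI_pos as HPI.
  assert (exp_ : forall a b, ex_RInt p a b).
  { intros. apply (ex_RInt_continuous (V := R_CompleteNormedModule)). intros; apply Hpc. }
  assert (exS : forall a b, ex_RInt S a b).
  { intros. apply (ex_RInt_continuous (V := R_CompleteNormedModule)). intros; apply Sc. }
  assert (Chp : forall a b c, (RInt p a b + RInt p b c)%R = RInt p a c).
  { intros. apply (RInt_Chasles (V := R_CompleteNormedModule)); auto. }
  assert (ChS : forall a b c, (RInt S a b + RInt S b c)%R = RInt S a c).
  { intros. apply (RInt_Chasles (V := R_CompleteNormedModule)); auto. }
  assert (Pp : forall a b, (a < b)%R -> (0 < RInt p a b)%R) by (intros; apply RInt_gt_0; auto).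
  assert (Pp' : forall a b, (a <= b)%R -> (0 <= RInt p a b)%R).
  { intros. apply RInt_ge_0; auto. intros; apply Rlt_le, Hp. }
  assert (Pos : forall a b, (a < b)%R -> (forall t, (a < t < b)%R -> (0 < sin (RInt p be t))%R) -> (0 < RInt S a b)%R).
  { intros a b Hab H. apply RInt_gt_0; [exact Hab| |intros; apply Sc].
    intros t Ht. apply Rmult_lt_0_compat; [apply Hm | apply H, Ht]. }
  assert (Neg : forall a b, (a < b)%R -> (forall t, (a < t < b)%R -> (sin (RInt p be t) < 0)%R) -> (RInt S a b < 0)%R).
  { intros a b Hab H.
    pose proof (RInt_gt_0 (fun t => - S t)%R a b Hab) as K.
    assert (E : RInt (fun t => - S t)%R a b = (- RInt S a b)%R)
      by (apply (RInt_opp (V := R_CompleteNormedModule)); auto).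
    rewrite E in K.
    assert (0 < - RInt S a b)%R; [|lra]. apply K.
    - intros t Ht. specialize (H t Ht). specialize (Hm t). unfold S. nra.
    - intros t _. apply (continuous_opp (V := R_NormedModule)), Sc. }
  assert (Zero : forall a, RInt S a a = 0%R) by (intros; apply (RInt_point (V := R_CompleteNormedModule))).
  assert (Pzero : forall a, RInt p a a = 0%R) by (intros; apply (RInt_point (V := R_CompleteNormedModule))).
  set (al := RInt p 0 be).
  assert (Hal : (0 <= al)%R) by (apply Pp'; lra).
  pose proof (Chp 0 be (2 * PI))%R as Eal. fold al in Eal.
  assert (Hfwd : forall t, (be < t <= 2 * PI)%R -> (0 < RInt p be t <= 2 * PI - al)%R).
  { intros t Ht. pose proof (Chp be t (2 * PI))%R. pose proof (Pp be t ltac:(lra)).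
    pose proof (Pp' t (2 * PI) ltac:(lra))%R. lra. }
  assert (Hbwd : forall t, (0 <= t < be)%R -> (- al <= RInt p be t < 0)%R).
  { intros t Ht. pose proof (Chp 0 t be)%R as X. fold al in X. pose proof (Pp t be ltac:(lra)).
    pose proof (Pp' 0 t ltac:(lra))%R. pose proof (Chp be t be) as Y. rewrite Pzero in Y. lra. }
  pose proof (ChS 0 be th)%R as S1. pose proof (ChS 0 th (2 * PI))%R as S2. pose proof (ChS 0 be (2 * PI))%R as S4.
  pose proof (ChS 0 th be)%R as S3. pose proof (ChS be th be) as S5. rewrite Zero in S5.
  destruct (Rtotal_order be th) as [Hlt|[He|Hgt]]; [|contradiction|].
  - pose proof (Hfwd th ltac:(lra)) as F.
    (* Up to the angle [PI] the integrand is positive on the arc. Beyond it, [S] is negative on the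
       remaining pieces [[0, be]] and [[th, 2 PI]], and the zero total makes the integral over the
       arc positive. *)
    destruct (Rle_dec (RInt p be th) PI) as [Hle|Hnle].
    + apply Pos; [exact Hlt|]. intros t Ht. pose proof (Hfwd t ltac:(lra)).
      pose proof (Chp be t th). pose proof (Pp t th ltac:(lra)). apply sin_gt_0; lra.
    + assert (N1 : (0 < be)%R -> (RInt S 0 be < 0)%R).
      { intros H0. apply Neg; [exact H0|]. intros t Ht. pose proof (Hbwd t ltac:(lra)).
        apply sin_lt_0_var; lra. }
      assert (N2 : (th < 2 * PI)%R -> (RInt S th (2 * PI) < 0)%R).
      { intros H0. apply Neg; [exact H0|]. intros t Ht. pose proof (Hfwd t ltac:(lra)) as G.
        pose proof (Chp be th t). pose proof (Pp th t ltac:(lra)).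
        pose proof (Chp be t (2 * PI))%R. pose proof (Pp t (2 * PI) ltac:(lra))%R.
        apply sin_lt_0; lra. }
      destruct (Rle_lt_or_eq_dec 0 be ltac:(lra)) as [B|B];
      destruct (Rle_lt_or_eq_dec th (2 * PI) ltac:(lra)) as [T|T].
      * specialize (N1 B). specialize (N2 T). lra.
      * specialize (N1 B). rewrite T in *. lra.
      * specialize (N2 T). rewrite <- B in *. rewrite Zero in *. lra.
      * exfalso. lra.
  - pose proof (Hbwd th ltac:(lra)) as F.
    destruct (Rle_dec (- PI) (RInt p be th)) as [Hle|Hnle].
    + assert (RInt S th be < 0)%R; [|lra].
      apply Neg; [exact Hgt|]. intros t Ht. pose proof (Hbwd t ltac:(lra)).
      pose proof (Chp be th t). pose proof (Pp th t ltac:(lra)). apply sin_lt_0_var; lra.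
    + assert (N1 : (0 < th)%R -> (0 < RInt S 0 th)%R).
      { intros H0. apply Pos; [exact H0|]. intros t Ht. pose proof (Hbwd t ltac:(lra)).
        pose proof (Chp be t th). pose proof (Pp t th ltac:(lra)).
        pose proof (Chp 0 t be)%R as X. fold al in X. pose proof (Pp 0 t ltac:(lra))%R.
        pose proof (Chp be t be) as Y. rewrite Pzero in Y.
        rewrite <- (Ropp_involutive (RInt p be t)), sin_neg.
        assert (sin (- RInt p be t) < 0)%R; [|lra]. apply sin_lt_0; [lra|].
        pose proof (Pp' be (2 * PI) ltac:(lra))%R. lra. }
      assert (N2 : (be < 2 * PI)%R -> (0 < RInt S be (2 * PI))%R).
      { intros H0. apply Pos; [exact H0|]. intros t Ht. pose proof (Hfwd t ltac:(lra)) as G.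
        apply sin_gt_0; lra. }
      destruct (Rle_lt_or_eq_dec 0 th ltac:(lra)) as [B|B];
      destruct (Rle_lt_or_eq_dec be (2 * PI) ltac:(lra)) as [T|T].
      * specialize (N1 B). specialize (N2 T). lra.
      * specialize (N1 B). rewrite T in *. rewrite Zero in *. lra.
      * specialize (N2 T). rewrite <- B in *. rewrite Zero in *. lra.
      * exfalso. lra.
Qed.
End Sine_integral.

Section Order_two.
Variables (om : C) (k : R -> C) (s sg : R).
Hypotheses (Hk : con k 0 1) (Hs : (0 < sg < s)%R) (Hs1 : (s <= 1)%R).
Hypothesis HQ : forall a b, (Cmod a < s)%R -> (Cmod b < s)%R ->
  LL om (fun t => k t * (ker b t * ker b t * ker b t) * (1 - RtoC t * a)) <> 0.

Let E (b : C) : C := LL om (fun t => k t * (ker b t * ker b t)).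
Let K (b : C) : C := b * LL om (fun t => k t * ker b t).
Let R3 (b e : C) : C := LL om (fun t => k t * ker b t * (ker b t * ker e t)) / E b.

Lemma ot_diag b : (Cmod b < s)%R -> E b <> 0 /\ (1 / 2 < Re (R3 b b))%R.
Proof.
  intros Hb. assert (Hcb : con (ker b) 0 1) by (apply con_ker; lra).
  destruct (half_of_nonvanish (LL om (fun t => k t * (ker b t * ker b t * ker b t)))
    (LL om (fun t => k t * (ker b t * ker b t * ker b t) * RtoC t)) b s) as [H1 H2]; [lra|exact Hb| |].
  - intros a Ha. rewrite <- LL_lin by auto 8 with con. apply HQ; assumption.
  - assert (EE : LL om (fun t => k t * (ker b t * ker b t * ker b t)) - b * LL om (fun t => k t * (ker b t * ker b t * ker b t) * RtoC t) = E b).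
    { rewrite <- LL_lin by auto 8 with con.
      apply LL_ext. intros t Ht. unfold ker. field. apply ker_neq; lra. }
    rewrite EE in H1, H2. split; [exact H1|].
    replace (R3 b b) with (LL om (fun t => k t * (ker b t * ker b t * ker b t)) / E b); [exact H2|].
    unfold R3. f_equal. apply LL_ext. intros. ring.
Qed.

(** The derivative of [b / (1 - t b)] in [b] is [1 / (1 - t b)^2]. Having [K] as a primitive of [E]
    lets the difference quotient of [K] be written as an arc integral of [E]. *)
Lemma ot_K_cder z : (Cmod z < s)%R -> cder K z (E z).
Proof.
  intros Hz. assert (Hcb : con (ker z) 0 1) by (apply con_ker; lra).
  eapply gder_eq; [|apply gder_mult; [apply gder_id | apply cder_LL1; [exact Hk | lra]]].
  cbv beta. rewrite <- (Cmult_1_l (LL om (fun t => k t * ker z t))) at 1.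
  rewrite <- !LL_scal, <- LL_plus by auto 8 with con.
  apply LL_ext. intros t Ht. unfold ker. field. apply ker_neq; lra.
Qed.

(** As [K' = E], the vector [b E b] is the outer normal at [b] of the curve [K (circ sg t)], and
    [p > 0] with total [2 PI] says that this closed curve is convex. The inequality expresses that
    the curve lies on the inner side of its tangent at [b]; the vanishing full integral is the
    closedness of the curve. *)
Lemma ot_torus be th : (0 <= be <= 2 * PI)%R -> (0 <= th <= 2 * PI)%R ->
  (1 / 2 < Re (R3 (circ sg be) (circ sg th)))%R.
Proof.
  intros Hbe Hth. pose proof two_PI_pos as HPI.
  assert (Hc : forall t, (Cmod (circ sg t) < s)%R) by (intros; rewrite Cmod_circ; lra).
  destruct (Ceq_dec (circ sg be) (circ sg th)) as [Heq|Hneq].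
  { rewrite <- Heq. apply ot_diag, Hc. }
  assert (HN : forall z, (Cmod z < s)%R -> E z <> 0) by (intros z Hz; apply ot_diag, Hz).
  assert (HE : holo E s) by (apply holo_le with 1%R; [exact Hs1 | apply holo_LL2, Hk]).
  destruct (holo_derive E s HE) as [E1 [HE1 HE1h]].
  set (sl := log_slope E E1 sg).
  assert (Hkc : forall t, continuous sl t).
  { intros t. apply (cont_log_slope E E1 s sg HE1 HE1h HN Hs). }
  pose (p := fun t => (1 + Re (sl t))%R).
  assert (Hpc : forall t, continuous p t).
  { intros t. apply (continuous_plus (V := R_NormedModule) (fun _ => 1%R)); [apply continuous_const|].
    apply (cont_Re sl), Hkc. }
  (* Since [R3 b b = 1 + b E' / (2 E)], the diagonal inequality is the positivity of
     [1 + Re (b E' / E)]. *)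
  assert (Hp : forall t, (0 < p t)%R).
  { intros t. unfold p, sl, log_slope. destruct (ot_diag _ (Hc t)) as [D1 D2].
    pose proof (HE1 _ (Hc t)) as D. apply cder_derive in D.
    set (b := circ sg t) in *.
    assert (Hb : (Cmod b < 1)%R) by (specialize (Hc t); unfold b; lra).
    assert (Hcb : con (ker b) 0 1) by (apply con_ker, Hb).
    rewrite (cder_derive E b _ (cder_LL2 om k b Hk Hb)) in D.
    set (L3 := LL om (fun t => k t * RtoC t * (ker b t * ker b t * ker b t))).
    assert (ED : E1 b = 2 * L3) by (rewrite <- D; apply LL_scal; auto 8 with con).
    assert (ER : R3 b b = 1 + RtoC (/ 2) * (b * E1 b / E b)).
    { unfold R3. replace (LL om (fun t => k t * ker b t * (ker b t * ker b t))) with (E b + b * L3).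
      - rewrite ED, RtoC_inv by lra. field. exact D1.
      - unfold E, L3. rewrite <- LL_scal, <- LL_plus by auto 8 with con.
        apply LL_ext. intros u Hu. unfold ker. field. apply ker_neq; lra. }
    rewrite ER, re_plus, re_scal_l in D2. simpl (Re 1) in D2. lra. }
  assert (Ip : forall a b, RInt p a b = ((b - a) + Re (CInt sl a b))%R).
  { intros a b. etransitivity.
    - apply (RInt_plus (V := R_CompleteNormedModule) (fun _ => 1%R)).
      + apply (ex_RInt_const (V := R_NormedModule)).
      + apply con_Re. intros t _. apply Hkc.
    - rewrite (RInt_const (V := R_CompleteNormedModule)). unfold plus, scal; simpl. unfold mult; simpl.
      unfold Re. simpl. f_equal. ring. }
  assert (Tot : RInt p 0 (2 * PI) = (2 * PI)%R).
  { rewrite Ip. unfold sl. rewrite (log_slope_period E E1 s sg HE1 HE1h HN Hs). simpl. ring. }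
  set (b := circ sg be) in *. set (e := circ sg th) in *.
  assert (Hb : (Cmod b < 1)%R) by (specialize (Hc be); unfold b; lra).
  assert (He : (Cmod e < 1)%R) by (specialize (Hc th); unfold e; lra).
  assert (Hbe0 : b - e <> 0) by (apply Cminus_eq_contra; exact Hneq).
  assert (Eb : E b <> 0) by (apply HN, Hc).
  assert (b0 : b <> 0) by (apply Cmod_gt_0; unfold b; rewrite Cmod_circ; lra).
  assert (e0 : e <> 0) by (apply Cmod_gt_0; unfold e; rewrite Cmod_circ; lra).
  pose (W := fun t => CInt sl be t).
  (* The velocity of the curve [K (circ sg t)] divided by [b E b]: it equals [i] at [t = be] and
     turns through the angle [RInt p be t], so minus its real part is a positive multiple of the
     sine. *)
  pose (T := fun t => Ci * (RtoC (exp (- Im (W t))) * expi (RInt p be t))).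
  assert (ET : forall t, E (circ sg t) * (Ci * circ sg t) = b * E b * T t).
  { intros t. rewrite (angle_formula E E1 s sg HE1 HE1h HN Hs be t). fold sl b. fold (W t).
    rewrite cexp_Ci. unfold T. rewrite Ip. fold (W t). rewrite expi_plus.
    replace (circ sg t) with (b * expi (t - be)).
    2:{ unfold b, circ. rewrite <- Cmult_assoc, <- expi_plus. do 2 f_equal. ring. }
    ring. }
  assert (ETc : forall t, continuous (fun t => E (circ sg t) * (Ci * circ sg t)) t).
  { intros t. apply cont_mult; [apply (cont_holo_circ E s); assumption|].
    apply cont_mult; [apply cont_const | apply cont_circ]. }
  assert (HbE : b * E b <> 0) by (apply Cmult_neq_0; assumption).
  assert (Tc : forall t, continuous T t).
  { intros t. apply continuous_ext with (f := fun t => / (b * E b) * (E (circ sg t) * (Ci * circ sg t))).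
    - intros u. rewrite ET. match goal with |- ?x = ?y => change (@eq C x y) end. field. split; assumption.
    - apply cont_mult; [apply cont_const | apply ETc]. }
  assert (IT : forall x y, K (circ sg y) - K (circ sg x) = b * E b * CInt T x y).
  { intros x y. rewrite <- CInt_scal by (intros t _; apply Tc).
    rewrite <- (CInt_FTC (fun t => K (circ sg t)) (fun t => E (circ sg t) * (Ci * circ sg t)) x y).
    - apply CInt_ext. intros t _. apply ET.
    - intros t _. apply (gder_comp RtoC (circ sg) K); [apply rder_circ | apply ot_K_cder, Hc].
    - intros t _. apply ETc. }
  pose (m := fun t => exp (- Im (W t))).
  assert (SE : forall t, (- Re (T t))%R = (m t * sin (RInt p be t))%R).
  { intros t. unfold T, m. unfold Re. simpl. ring. }
  assert (IS : forall x y, RInt (fun t => m t * sin (RInt p be t))%R x y = (- Re (CInt T x y))%R).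
  { intros x y. rewrite Re_CInt. etransitivity.
    - apply (RInt_ext (V := R_CompleteNormedModule) _ (fun t => - Re (T t))%R). intros; symmetry; apply SE.
    - apply (RInt_opp (V := R_CompleteNormedModule)). apply con_Re. intros t _. apply Tc. }
  assert (Pos : (0 < RInt (fun t => m t * sin (RInt p be t)) be th)%R).
  { apply sine_integral_pos; auto.
    - intros t. apply exp_pos.
    - intros t. apply continuous_ext with (f := fun t => (- Re (T t))%R); [exact SE|].
      apply (continuous_opp (V := R_NormedModule)), (cont_Re T), Tc.
    - rewrite IS. pose proof (IT 0 (2 * PI))%R as Z. rewrite circ_2PI in Z.
      replace (CInt T 0 (2 * PI)) with (RtoC 0); [simpl; ring|].
      transitivity (/ (b * E b) * (b * E b * CInt T 0 (2 * PI))).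
      + rewrite <- Z. ring.
      + field. split; assumption.
    - intros Ex. apply Hneq. unfold b, e. rewrite Ex. reflexivity.
    - destruct (Rle_lt_or_eq_dec 0 be ltac:(lra)) as [B|B]; [left; exact B|].
      destruct (Rle_lt_or_eq_dec th (2 * PI) ltac:(lra)) as [B'|B']; [right; exact B'|].
      exfalso. apply Hneq. unfold b, e. rewrite <- B, B'. symmetry. apply circ_2PI.
    - destruct (Rle_lt_or_eq_dec be (2 * PI) ltac:(lra)) as [B|B]; [left; exact B|].
      destruct (Rle_lt_or_eq_dec 0 th ltac:(lra)) as [B'|B']; [right; exact B'|].
      exfalso. apply Hneq. unfold b, e. rewrite <- B', B. apply circ_2PI. }
  rewrite IS in Pos.
  assert (Nbe : (0 < Cmod (b - e) * Cmod (b - e))%R).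
  { apply Cmod_gt_0 in Hbe0. apply Rmult_lt_0_compat; assumption. }
  assert (ER : R3 b e = b / (b - e) + RtoC (sg * sg / (Cmod (b - e) * Cmod (b - e))) * (- CInt T be th)).
  { unfold R3.
    assert (Hcb : con (ker b) 0 1) by (apply con_ker, Hb).
    assert (P1 := LL_ker_pair om (fun t => k t * ker b t) b e ltac:(auto with con) Hb He). cbv beta in P1.
    assert (P2 := LL_ker_pair om k b e Hk Hb He). fold (K b) (K e) in P2.
    pose proof (IT be th) as P3. fold b e in P3.
    replace (LL om (fun t => k t * ker b t * ker b t)) with (E b) in P1
      by (apply LL_ext; intros; ring).
    replace (LL om (fun t => k t * ker b t * ker e t)) with ((K b - K e) / (b - e)) in P1.
    2:{ rewrite <- P2. replace (LL om (fun t => k t * ker b t * ker e t)) with (LL om (fun t => k t * (ker b t * ker e t)))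
          by (apply LL_ext; intros; ring). field. exact Hbe0. }
    replace (LL om (fun t => k t * ker b t * (ker b t * ker e t))) with
      ((b * E b - e * ((K b - K e) / (b - e))) / (b - e)) by (rewrite <- P1; field; exact Hbe0).
    replace (K b - K e) with (- (b * E b * CInt T be th)) by (rewrite <- P3; ring).
    (* For two points of the same circle [b e / (b - e)^2] is a negative real number; this turns the
       sign of the arc integral into the sign of the real part. *)
    assert (EQ : RtoC (sg * sg / (Cmod (b - e) * Cmod (b - e))) = - (b * e) / ((b - e) * (b - e))).
    { rewrite RtoC_div by lra. rewrite <- Cmod_sqr_conj.
      assert (Nc : Cconj (b - e) <> 0).
      { intros E0. apply (f_equal Cmod) in E0. rewrite Cmod_conj, Cmod_0 in E0. apply Cmod_gt_0 in Hbe0. lra. }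
      assert (Q : Cconj (b - e) * (b * e) = RtoC (sg * sg) * (e - b)).
      { rewrite Cminus_conj.
        transitivity ((b * Cconj b) * e - (e * Cconj e) * b); [ring|].
        unfold b, e. rewrite !circ_conj. ring. }
      assert (Nsq : (b - e) * (b - e) <> 0) by (apply Cmult_neq_0; assumption).
      transitivity (RtoC (sg * sg) * (e - b) / ((e - b) * ((b - e) * Cconj (b - e)))).
      - field. repeat split; auto. intros E0. apply Hbe0. replace (b - e) with (- (e - b)) by ring. rewrite E0. ring.
      - rewrite <- Q. field. repeat split; auto. intros E0. apply Hbe0. replace (b - e) with (- (e - b)) by ring. rewrite E0. ring. }
    rewrite EQ. field. split; assumption. }
  rewrite ER, re_plus, re_scal_l, Re_chord.
  - assert (0 < sg * sg / (Cmod (b - e) * Cmod (b - e)) * Re (- CInt T be th))%R; [|lra].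
    apply Rmult_lt_0_compat; [apply Rdiv_lt_0_compat; [nra | exact Nbe]|]. exact Pos.
  - unfold b, e. rewrite !Cmod_circ by lra. reflexivity.
  - exact Hneq.
Qed.
End Order_two.

(** * From poles to close-to-convex functions *)

Lemma CInt_conj f a b : con f a b -> CInt (fun t => Cconj (f t)) a b = Cconj (CInt f a b).
Proof.
  intros Hf. unfold CInt, Cconj. apply injective_projections; simpl; [reflexivity|].
  apply (RInt_opp (V := R_CompleteNormedModule)). apply con_Im, Hf.
Qed.

Lemma LL_conj om f : con f 0 1 -> LL (Cconj om) (fun t => Cconj (f t)) = Cconj (LL om f).
Proof. intros Hf. unfold LL. rewrite CInt_conj, Cminus_conj, Cmult_conj by exact Hf. reflexivity. Qed.

Section Swap.
Variables (om : C) (k w e : R -> C).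
Hypotheses (Hk : con k 0 1) (Hw : forall th, continuous w th) (He : forall th, continuous e th)
  (Hes : forall th, (Cmod (e th) < 1)%R).

Lemma cont_LL_ker om' th : continuous (fun th => LL om' (fun t => k t * ker (e th) t)) th.
Proof.
  apply (continuous_comp e (fun b => LL om' (fun t => k t * ker b t))); [apply He|].
  exact (cder_cont _ _ _ (cder_LL1 om' k (e th) Hk (Hes th))).
Qed.

(** Evaluation at 1 commutes with the circle integral, and Fubini exchanges it with the integral
    over [[0, 1]]; the poles lie in the open unit disc, so the kernels are continuous. *)
Lemma LL_swap :
  LL om (fun t => k t * CInt (fun th => w th * ker (e th) t) 0 (2 * PI)) =
  CInt (fun th => w th * LL om (fun t => k t * ker (e th) t)) 0 (2 * PI).
Proof.
  pose proof two_PI_pos as HPI.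
  assert (Cin : forall t, (0 <= t <= 1)%R -> con (fun th => w th * ker (e th) t) 0 (2 * PI)).
  { intros t Ht th _. apply cont_mult; [apply Hw|]. apply cont_Cinv.
    - apply cont_minus; [apply cont_const | apply cont_mult; [apply cont_const | apply He]].
    - apply ker_neq; [apply Hes | exact Ht]. }
  assert (Cth : forall th, con (fun t => k t * ker (e th) t) 0 1) by (intros; auto with con).
  transitivity (om * (k 1%R * CInt (fun th => w th * ker (e th) 1) 0 (2 * PI))
    - CInt (fun t => CInt (fun th => k t * (w th * ker (e th) t)) 0 (2 * PI)) 0 1).
  { unfold LL. rewrite (CInt_ext (fun t => k t * CInt (fun th => w th * ker (e th) t) 0 (2 * PI))
      (fun t => CInt (fun th => k t * (w th * ker (e th) t)) 0 (2 * PI)) 0 1); [reflexivity|].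
    intros t Ht. rewrite Rmin_left, Rmax_right in Ht by lra.
    symmetry. apply CInt_scal, Cin. lra. }
  rewrite (CInt_Fubini (fun t th => k t * (w th * ker (e th) t)) 0 1 0 (2 * PI)); [|lra|lra|].
  2:{ intros t th Ht Hth. apply cont_mult; [|apply cont_mult].
      - apply (continuous_comp fst k); [apply continuous_fst|]. apply Hk. rewrite Rmin_left, Rmax_right; simpl; lra.
      - apply (continuous_comp snd w); [apply continuous_snd | apply Hw].
      - apply cont_Cinv.
        + apply cont_minus; [apply cont_const | apply cont_mult].
          * apply cont_RtoC, continuous_fst.
          * apply (continuous_comp snd e); [apply continuous_snd | apply He].
        + apply ker_neq; [apply Hes | exact Ht]. }
  rewrite <- (CInt_scal (k 1%R) _ _ _ (Cin 1%R ltac:(lra))), <- CInt_scal by (apply con_scal, Cin; lra).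
  rewrite <- CInt_minus.
  - apply CInt_ext. intros th _. unfold LL.
    transitivity (om * (k 1%R * (w th * ker (e th) 1)) - w th * CInt (fun t => k t * ker (e th) t) 0 1); [|ring].
    rewrite <- CInt_scal by apply Cth. f_equal.
    apply CInt_ext. intros; ring.
  - apply con_scal, con_scal, Cin. lra.
  (* With [om = 0] the functional is minus the integral over [[0, 1]], so [cont_LL_ker] already
     gives its continuity in [th]. *)
  - intros th _. apply continuous_ext with (f := fun th => - (w th * LL 0 (fun t => k t * ker (e th) t))).
    + intros u. unfold LL. match goal with |- ?x = ?y => change (@eq C x y) end.
      rewrite Cmult_0_l. transitivity (w u * CInt (fun t => k t * ker (e u) t) 0 1); [ring|].
      rewrite <- CInt_scal by apply Cth. apply CInt_ext. intros; ring.
    + apply cont_opp, cont_mult; [apply Hw | apply cont_LL_ker].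
Qed.
End Swap.

(* With [R(eta) = L(k / (1 - eta t)) / L(k)], the value [L(k F) / L(k)] is the mean of
   [F(1 / eta)] with respect to the positive weight [2 Re R(eta) - 1] on [|eta| = sg]. *)
Lemma half_plane_functional om k sg rho F nu : con k 0 1 -> (0 < sg < 1)%R -> (1 / sg < rho)%R ->
  LL om k <> 0 ->
  (forall th, (0 <= th <= 2 * PI)%R -> (1 / 2 < Re (LL om (fun t => k t * ker (circ sg th) t) / LL om k)%C)%R) ->
  holo F rho ->
  (forall th, (0 <= th <= 2 * PI)%R -> (0 < Re (nu * F (circ (1 / sg) th))%C)%R) ->
  LL om (fun t => k t * F (RtoC t)) <> 0.
Proof.
  intros Hk Hsg Hrho HN HR HF Hnu H0. pose proof two_PI_pos as HPI.
  set (r := (1 / sg)%R) in *. set (N := LL om k) in *.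
  assert (Ers : (r * sg = 1)%R) by (unfold r; field; lra).
  assert (Hr : (1 < r)%R).
  { apply Rmult_lt_reg_r with sg; lra. }
  pose (e := fun th => circ sg (- th)). pose (ec := fun th => circ sg th).
  pose (w := fun th => F (circ r th)).
  assert (Hinv : forall th, circ r th * e th = 1).
  { intros th. unfold e, circ.
    transitivity (RtoC (r * sg) * (expi th * expi (- th))); [rewrite RtoC_mult; ring|].
    rewrite <- expi_plus, Rplus_opp_r, expi_0, Ers. ring. }
  assert (Hec : forall th, Cconj (e th) = ec th).
  { intros th. unfold e, ec, circ. rewrite Cmult_conj, Cconj_RtoC, expi_conj, Ropp_involutive. reflexivity. }
  assert (Hecr : forall th, RtoC (r * r) * ec th = circ r th).
  { intros th. unfold ec, circ. rewrite Cmult_assoc, <- RtoC_mult, Rmult_assoc, Ers, Rmult_1_r. reflexivity. }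
  assert (We : forall th, (Cmod (e th) < 1)%R) by (intros; apply circ_le_1; lra).
  assert (Wec : forall th, (Cmod (ec th) < 1)%R) by (intros; apply circ_le_1; lra).
  assert (Ce : forall th, continuous e th).
  { intros th. apply (continuous_comp Ropp (circ sg)); [apply (continuous_opp (V := R_NormedModule)), continuous_id | apply cont_circ]. }
  assert (Cec : forall th, continuous ec th) by (intros; apply cont_circ).
  assert (Cw : forall th, continuous w th) by (intros; apply (cont_holo_circ F rho); [exact HF | lra]).
  assert (Hkc : con (fun t => Cconj (k t)) 0 1) by (intros t Ht; apply cont_conj; auto).
  pose (Q := fun th => LL om (fun t => k t * ker (e th) t)).
  assert (CQ : forall th, continuous Q th) by (intros; apply cont_LL_ker; assumption).
  (* Cauchy's kernel at [zeta = circ r th] is [zeta / (zeta - t) = 1 / (1 - t e)] with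
     [e = 1 / zeta], so the mean of [w Q] is the functional of [k F], assumed to be 0. *)
  assert (A1 : CInt (fun th => w th * Q th) 0 (2 * PI) = 0).
  { unfold Q. rewrite <- (LL_swap om k w e) by assumption.
    transitivity (LL om (fun t => RtoC (2 * PI) * (k t * F (RtoC t)))).
    - apply LL_ext. intros t Ht.
      transitivity (k t * (RtoC (2 * PI) * F (RtoC t))); [f_equal|ring].
      rewrite <- (Cauchy_formula F rho r (RtoC t) HF) by (try lra; rewrite Cmod_R, Rabs_pos_eq; lra).
      apply CInt_ext. intros th _. unfold w, ker.
      assert (N1 : 1 - RtoC t * e th <> 0) by (apply ker_neq; [apply We | exact Ht]).
      assert (N0 : circ r th <> 0) by (apply Cmod_gt_0; rewrite Cmod_circ; lra).
      replace (1 - RtoC t * e th) with ((circ r th - RtoC t) / circ r th).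
      + assert (circ r th - RtoC t <> 0) by (apply circ_neq; [lra | rewrite Cmod_R, Rabs_pos_eq; lra]).
        field. split; assumption.
      + replace (e th) with (/ circ r th); [field; exact N0|].
        transitivity (/ circ r th * (circ r th * e th)); [rewrite Hinv; ring | field; exact N0].
    - rewrite LL_scal, H0; [ring|].
      intros t Ht. apply cont_mult; [apply Hk, Ht|].
      rewrite Rmin_left, Rmax_right in Ht by lra.
      apply (continuous_comp RtoC F); [apply cont_RtoC, continuous_id|].
      eapply holo_cont; [exact HF|]. rewrite Cmod_R, Rabs_pos_eq; lra. }
  (* Conjugation turns the pole [1 / zeta] into [zeta / r^2]. The integrand becomes holomorphic in
     [zeta], and its mean is the value at 0. *)
  assert (A2 : CInt (fun th => w th * Cconj (Q th)) 0 (2 * PI) = RtoC (2 * PI) * F 0 * Cconj N).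
  { transitivity (CInt (fun th => w th * LL (Cconj om) (fun t => Cconj (k t) * ker (ec th) t)) 0 (2 * PI)).
    - apply CInt_ext. intros th _. f_equal. unfold Q. rewrite <- LL_conj by auto with con.
      apply LL_ext. intros t Ht. rewrite Cmult_conj. f_equal. unfold ker.
      assert (N1 : 1 - RtoC t * e th <> 0) by (apply ker_neq; [apply We | exact Ht]).
      rewrite Cinv_conj, Cminus_conj, Cmult_conj, !Cconj_RtoC, Hec by exact N1. reflexivity.
    - rewrite <- (LL_swap (Cconj om) (fun t => Cconj (k t)) w ec) by assumption.
      unfold N. rewrite <- LL_conj, <- LL_scal by assumption.
      apply LL_ext. intros t Ht. rewrite Cmult_comm. f_equal.
      assert (Ht' : (Cmod (RtoC t) < r)%R) by (rewrite Cmod_R, Rabs_pos_eq; lra).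
      assert (Nr : RtoC (r * r) <> 0) by (apply RtoC_neq, Rgt_not_eq; nra).
      pose proof (mean_conj_kernel F rho r (RtoC t) HF ltac:(lra) Ht') as M.
      transitivity (RtoC (r * r) * (RtoC (2 * PI) * (F 0 / RtoC (r * r)))); [|field; exact Nr].
      rewrite <- M, <- CInt_scal.
      + apply CInt_ext. intros th _. unfold w, ker. generalize (F (circ r th)). intros x0. rewrite Cconj_RtoC, <- Hecr.
        assert (N1 : 1 - RtoC t * ec th <> 0) by (apply ker_neq; [apply Wec | exact Ht]).
        assert (N2 : RtoC (r * r) - RtoC t * (RtoC (r * r) * ec th) <> 0).
        { replace (RtoC (r * r) - RtoC t * (RtoC (r * r) * ec th)) with (RtoC (r * r) * (1 - RtoC t * ec th)) by ring.
          apply Cmult_neq_0; assumption. }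
        field. split; assumption.
      + intros th _. apply (cont_holo_conj_kernel F rho r HF); [lra | exact Ht']. }
  assert (Nc : Cconj N <> 0).
  { intros E0. apply HN. rewrite <- (Cconj_conj N), E0. apply Cconj_RtoC. }
  pose proof (mean_value F rho r HF ltac:(lra)) as A3. fold w in A3.
  change (fun t => F (circ r t)) with w in A3.
  pose (P := fun th => (2 * Re (Q th / N)%C - 1)%R).
  assert (CP : forall th, continuous P th).
  { intros th. apply (continuous_minus (V := R_NormedModule) (fun th => (2 * Re (Q th / N)%C)%R)); [|apply continuous_const].
    apply (continuous_mult (K := R_AbsRing) (fun _ => 2%R)); [apply continuous_const|].
    apply (cont_Re (fun th => Q th / N)), cont_mult; [apply CQ | apply cont_const]. }
  (* The weight is [Q / N + conj (Q / N) - 1]; the means of its three terms against [F] are 0, [F 0]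
     and [- F 0]. *)
  assert (A : CInt (fun th => w th * RtoC (P th)) 0 (2 * PI) = 0).
  { transitivity (/ N * CInt (fun th => w th * Q th) 0 (2 * PI) + / Cconj N * CInt (fun th => w th * Cconj (Q th)) 0 (2 * PI) - CInt w 0 (2 * PI)).
    - assert (K1 : con (fun th => w th * Q th) 0 (2 * PI)) by (intros th _; apply cont_mult; auto).
      assert (K2 : con (fun th => w th * Cconj (Q th)) 0 (2 * PI)) by (intros th _; apply cont_mult; [|apply cont_conj]; auto).
      assert (K3 : con w 0 (2 * PI)) by (intros th _; apply Cw).
      rewrite <- (CInt_scal (/ N) _ _ _ K1), <- (CInt_scal (/ Cconj N) _ _ _ K2).
      rewrite <- CInt_plus by (apply con_scal; assumption).
      rewrite <- CInt_minus; [|intros th Hth; apply cont_plus; apply (con_scal _ _ 0 (2 * PI)); assumption | exact K3].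
      apply CInt_ext. intros th _. unfold P.
      assert (EP : RtoC (2 * Re (Q th / N) - 1) = Q th / N + Cconj (Q th) / Cconj N - 1).
      { rewrite <- Cdiv_conj by exact HN. apply injective_projections; simpl; unfold Re; simpl; ring. }
      rewrite EP. unfold Cdiv. ring.
    - rewrite A1, A2, A3. field. split; assumption. }
  assert (B : (0 < RInt (fun th => Re (nu * (w th * RtoC (P th)))%C) 0 (2 * PI))%R).
  { apply RInt_gt_0; [exact HPI| |].
    - intros th Hth.
      replace (nu * (w th * RtoC (P th))) with (RtoC (P th) * (nu * w th)) by ring.
      rewrite re_scal_l. apply Rmult_lt_0_compat; [|apply Hnu; lra].
      (* The pole is [circ sg (- th)]; periodicity brings its angle back into [[0, 2 PI]]. *)
      specialize (HR (2 * PI - th)%R ltac:(lra)).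
      replace (circ sg (2 * PI - th)) with (e th) in HR.
      + unfold P, Q. lra.
      + unfold e, circ. f_equal. replace (2 * PI - th)%R with (- th + 2 * PI)%R by ring. symmetry. apply expi_2PI.
    - intros th _. apply (cont_Re (fun th => nu * (w th * RtoC (P th)))), cont_mult; [apply cont_const|].
      apply cont_mult; [apply Cw | apply cont_RtoC, CP]. }
  rewrite <- Re_CInt, CInt_scal, A, Cmult_0_r in B.
  - simpl in B. lra.
  - intros th _. apply cont_mult; [apply Cw | apply cont_RtoC, CP].
Qed.

(** As [|a| / sg < 1], the values of [(1 - a z) G] on the circle of radius [1 / sg] lie in a
    half-plane. Keeping the factor [1 - a t] gives the conclusion the form of the hypothesis needed
    for the next replacement. *)
Lemma sqrt_derivative_functional om k sg rho F F1 G : con k 0 1 -> (0 < sg < 1)%R -> (1 / sg < rho)%R ->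
  (forall z, (Cmod z < rho)%R -> cder F z (F1 z)) -> holo F1 rho ->
  (forall z, (Cmod z < rho)%R -> F z <> 0) ->
  (forall z, (Cmod z < rho)%R -> (0 <= Re (1 + z * F1 z / F z)%C)%R) ->
  (forall z, (Cmod z < rho)%R -> cder G z (G z * F1 z / (2 * F z)) /\ G z * G z = F z /\ G z <> 0) ->
  LL om k <> 0 ->
  (forall th, (0 <= th <= 2 * PI)%R -> (1 / 2 < Re (LL om (fun t => k t * ker (circ sg th) t) / LL om k)%C)%R) ->
  forall a, (Cmod a < sg)%R -> LL om (fun t => k t * ((1 - a * RtoC t) * G (RtoC t))) <> 0.
Proof.
  intros Hk Hsg Hrho HF HF1 HN Hre HG HNk HR a Ha. pose proof (Cmod_ge_0 a).
  assert (E1 : (1 / sg * sg = 1)%R) by (field; lra).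
  assert (Hp : (0 < 1 / sg)%R) by (apply Rdiv_lt_0_compat; lra).
  destruct (half_plane_sqrt F F1 G rho (1 / sg) a) as [nu Hnu]; auto.
  { apply Rmult_lt_reg_r with sg; [lra|]. rewrite Rmult_assoc, E1. lra. }
  apply (half_plane_functional om k sg rho (fun z => (1 - a * z) * G z) nu); auto.
  apply holo_mult.
  - apply holo_minus; [apply holo_const | apply holo_mult; [apply holo_const | apply holo_id]].
  - intros z Hz. eexists. apply HG, Hz.
Qed.

(** Each replacement takes [eta] on a circle strictly inside the disc of the preceding non-vanishing
    statement, while the contour of inverse radius must stay inside the disc of radius [1 / r].
    Three replacements therefore consume three intermediate radii, spaced evenly between [s] and
    [r]. *)
Lemma close_to_convex_functional om r s F F1 G p nu : (0 < r < s)%R -> (s < 1)%R ->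
  (forall z, (Cmod z < 1 / r)%R -> cder F z (F1 z)) -> holo F1 (1 / r) ->
  (forall z, (Cmod z < 1 / r)%R -> F z <> 0) ->
  (forall z, (Cmod z < 1 / r)%R -> (0 <= Re (1 + z * F1 z / F z)%C)%R) ->
  (forall z, (Cmod z < 1 / r)%R -> cder G z (G z * F1 z / (2 * F z)) /\ G z * G z = F z /\ G z <> 0) ->
  holo p (1 / r) -> (forall z, (Cmod z < 1 / r)%R -> (0 < Re (nu * p z)%C)%R) ->
  (forall a b, (Cmod a < s)%R -> (Cmod b < s)%R ->
    LL om (fun t => 1 * (ker b t * ker b t * ker b t) * (1 - RtoC t * a)) <> 0) ->
  LL om (fun t => F (RtoC t) * p (RtoC t)) <> 0.
Proof.
  intros Hr Hs HF HF1 HN Hre HG Hp Hnu HQ.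
  set (s1 := (s - (s - r) / 4)%R). set (s2 := (s - (s - r) / 2)%R). set (s3 := (s - 3 * (s - r) / 4)%R).
  assert (Hord : (r < s3 < s2)%R /\ (s2 < s1 < s)%R) by (unfold s1, s2, s3; lra).
  assert (Hinv : forall x, (r < x)%R -> (1 / x < 1 / r)%R).
  { intros x Hx. unfold Rdiv. rewrite !Rmult_1_l. apply Rinv_lt_contravar; nra. }
  assert (H1r : (1 < 1 / r)%R).
  { apply Rmult_lt_reg_r with r; [lra|]. unfold Rdiv. rewrite Rmult_assoc, Rinv_l; lra. }
  assert (Hcirc : forall x t, (0 < x < 1)%R -> (Cmod (circ x t) < 1)%R) by (intros; apply circ_le_1; lra).
  assert (CG : con (fun t => G (RtoC t)) 0 1).
  { intros t Ht. rewrite Rmin_left, Rmax_right in Ht by lra.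
    eapply cont_cder_comp; [apply cont_RtoC, continuous_id|]. apply HG. rewrite Cmod_R, Rabs_pos_eq; lra. }
  (* One of the three poles becomes [G]: the weight is the remaining double pole at [b], with [eta]
     on the circle of radius [s1]. *)
  assert (Q1 : forall a b, (Cmod a < s1)%R -> (Cmod b < s1)%R ->
    LL om (fun t => G (RtoC t) * (ker b t * ker b t) * (1 - RtoC t * a)) <> 0).
  { intros a b Ha Hb.
    assert (Hcb : con (ker b) 0 1) by (apply con_ker; lra).
    assert (HEn : forall b, (Cmod b < s)%R -> LL om (fun t => 1 * (ker b t * ker b t)) <> 0).
    { intros b' Hb'. apply (ot_diag om (fun _ => 1) s s1 (con_const 1 0 1) ltac:(lra) ltac:(lra) HQ b' Hb'). }
    assert (EE : LL om (fun t => 1 * (ker b t * ker b t)) = LL om (fun t => ker b t * ker b t)).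
    { apply LL_ext. intros; ring. }
    replace (LL om (fun t => G (RtoC t) * (ker b t * ker b t) * (1 - RtoC t * a))) with
      (LL om (fun t => (ker b t * ker b t) * ((1 - a * RtoC t) * G (RtoC t)))) by (apply LL_ext; intros; ring).
    apply (sqrt_derivative_functional om (fun t => ker b t * ker b t) s1 (1 / r) F F1 G); auto with con; try lra.
    - apply Hinv. lra.
    - rewrite <- EE. apply HEn. lra.
    - intros th Hth.
      assert (Hce : (Cmod (circ s1 th) < 1)%R) by (apply Hcirc; lra).
      pose (q := fun b => LL om (fun t => ker (circ s1 th) t * (ker b t * ker b t)) / LL om (fun t => 1 * (ker b t * ker b t))).
      assert (Hq : holo q s).
      { apply holo_div.
        - apply holo_le with 1%R; [lra|]. apply holo_LL2. apply con_ker, Hce.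
        - apply holo_le with 1%R; [lra|]. apply holo_LL2. apply con_const.
        - exact HEn. }
      (* [ot_torus] treats [b] on the circle of radius [s1]. For fixed [eta] the ratio is
         holomorphic in [b], since its denominator has no zero, and the inequality passes to the
         inside. *)
      pose proof (Re_min_principle q s s1 (1 / 2) b Hq ltac:(lra)) as MP.
      replace (LL om (fun t => ker b t * ker b t * ker (circ s1 th) t) / LL om (fun t => ker b t * ker b t)) with (q b).
      + apply MP; [|exact Hb]. intros be Hbe.
        pose proof (ot_torus om (fun _ => 1) s s1 (con_const 1 0 1) ltac:(lra) ltac:(lra) HQ be th Hbe Hth) as T.
        unfold q. replace (LL om (fun t => ker (circ s1 th) t * (ker (circ s1 be) t * ker (circ s1 be) t))) with
          (LL om (fun t => 1 * ker (circ s1 be) t * (ker (circ s1 be) t * ker (circ s1 th) t))); [exact T|].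
        apply LL_ext. intros; ring.
      + unfold q. rewrite EE. f_equal. apply LL_ext. intros; ring. }
  (* The second pole becomes another [G], and [G^2 = F] on the segment; the weight is now [G] with a
     simple pole. *)
  assert (Q2 : forall a b, (Cmod a < s2)%R -> (Cmod b < s2)%R ->
    LL om (fun t => F (RtoC t) * ker b t * (1 - RtoC t * a)) <> 0).
  { intros a b Ha Hb.
    assert (Hcb : con (ker b) 0 1) by (apply con_ker; lra).
    assert (HEn : forall b, (Cmod b < s1)%R -> LL om (fun t => G (RtoC t) * ker b t) <> 0).
    { intros b' Hb'. apply (oo_diag om (fun t => G (RtoC t)) s1 s2 CG ltac:(lra) ltac:(lra) Q1 b' Hb'). }
    replace (LL om (fun t => F (RtoC t) * ker b t * (1 - RtoC t * a))) with
      (LL om (fun t => (G (RtoC t) * ker b t) * ((1 - a * RtoC t) * G (RtoC t)))).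
    2:{ apply LL_ext. intros t Ht. destruct (HG (RtoC t)) as [_ [EG _]]; [rewrite Cmod_R, Rabs_pos_eq; lra|].
        rewrite <- EG. ring. }
    apply (sqrt_derivative_functional om (fun t => G (RtoC t) * ker b t) s2 (1 / r) F F1 G); auto with con; try lra.
    - apply Hinv. lra.
    - apply HEn. lra.
    - intros th Hth.
      assert (Hce : (Cmod (circ s2 th) < 1)%R) by (apply Hcirc; lra).
      pose (q := fun b => LL om (fun t => G (RtoC t) * ker (circ s2 th) t * ker b t) / LL om (fun t => G (RtoC t) * ker b t)).
      assert (Hq : holo q s1).
      { apply holo_div.
        - apply holo_le with 1%R; [lra|]. apply (holo_LL1 om (fun t => G (RtoC t) * ker (circ s2 th) t)). auto with con.
        - apply holo_le with 1%R; [lra|]. apply (holo_LL1 om (fun t => G (RtoC t))). exact CG.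
        - exact HEn. }
      pose proof (Re_min_principle q s1 s2 (1 / 2) b Hq ltac:(lra)) as MP.
      replace (LL om (fun t => G (RtoC t) * ker b t * ker (circ s2 th) t) / LL om (fun t => G (RtoC t) * ker b t)) with (q b).
      + apply MP; [|exact Hb]. intros be Hbe.
        pose proof (oo_torus om (fun t => G (RtoC t)) s1 s2 CG ltac:(lra) ltac:(lra) Q1 be th Hbe Hth) as T.
        unfold q. replace (LL om (fun t => G (RtoC t) * ker (circ s2 th) t * ker (circ s2 be) t)) with
          (LL om (fun t => G (RtoC t) * (ker (circ s2 be) t * ker (circ s2 th) t))); [exact T|].
        apply LL_ext. intros; ring.
      + unfold q. f_equal. apply LL_ext. intros; ring. }
  assert (CF : con (fun t => F (RtoC t)) 0 1).
  { intros t Ht. rewrite Rmin_left, Rmax_right in Ht by lra.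
    eapply cont_cder_comp; [apply cont_RtoC, continuous_id|]. apply HF. rewrite Cmod_R, Rabs_pos_eq; lra. }
  (* The last pole is itself the kernel in [eta]: [half_of_nonvanish] gives the inequality directly,
     the factor [1 - b t] cancelling the pole. *)
  assert (Q3 : forall b, (Cmod b < s2)%R -> LL om (fun t => F (RtoC t)) <> 0 /\
    (1 / 2 < Re (LL om (fun t => F (RtoC t) * ker b t) / LL om (fun t => F (RtoC t)))%C)%R).
  { intros b Hb. assert (Hcb : con (ker b) 0 1) by (apply con_ker; lra).
    destruct (half_of_nonvanish (LL om (fun t => F (RtoC t) * ker b t)) (LL om (fun t => F (RtoC t) * ker b t * RtoC t)) b s2)
      as [H1 H2]; [lra|exact Hb| |].
    - intros a Ha. rewrite <- LL_lin by auto with con. apply Q2; assumption.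
    - rewrite <- LL_lin in H1, H2 by auto with con.
      replace (LL om (fun t => F (RtoC t) * ker b t * (1 - RtoC t * b))) with (LL om (fun t => F (RtoC t))) in H1, H2
        by (apply LL_ext; intros t Ht; unfold ker; field; apply ker_neq; lra).
      split; assumption. }
  apply (half_plane_functional om (fun t => F (RtoC t)) s3 (1 / r) p nu); auto; try lra.
  - apply Hinv. lra.
  - apply (Q3 0). rewrite Cmod_0. lra.
  - intros th Hth. apply Q3. rewrite Cmod_circ; lra.
  - intros th Hth. apply Hnu. rewrite Cmod_circ.
    + apply Hinv. lra.
    + apply Rlt_le, Rdiv_lt_0_compat; lra.
Qed.

(** * The region *)

Lemma Cinv_0 : / (RtoC 0) = 0.
Proof. apply injective_projections; simpl; unfold Rdiv; ring. Qed.

Lemma analytic_holo f : analytic_on_disk f -> holo f 1.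
Proof. intros H z Hz. destruct (H z Hz) as [l Hl]. exists l. apply is_derive_cder, Hl. Qed.

Lemma holo_analytic f : holo f 1 -> analytic_on_disk f.
Proof. intros H z Hz. destruct (H z Hz) as [l Hl]. exists l. apply cder_is_derive, Hl. Qed.

(** The primitive of [(1 - x z) / (1 - y z)^3] vanishing at 0. It serves twice: as the closed form
    of the model integral, and as the function that attains a prescribed point of the region. *)
Definition koebe_ctc (x y z : C) : C := (z - (x + y) / 2 * (z * z)) / ((1 - y * z) * (1 - y * z)).

Lemma gder_koebe {X} (i : X -> C) x y t : 1 - y * i t <> 0 ->
  gder i (fun t => koebe_ctc x y (i t)) t ((1 - x * i t) / ((1 - y * i t) * (1 - y * i t) * (1 - y * i t))).
Proof.
  intros N.
  assert (D : gder i (fun t => 1 - y * i t) t (- y)).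
  { eapply gder_eq; [|apply gder_minus; [apply gder_const | apply gder_scal, gder_id]]. ring. }
  unfold koebe_ctc.
  eapply gder_eq; [|apply gder_div; [apply Cmult_neq_0; exact N|
    apply gder_minus; [apply gder_id | apply gder_scal, gder_mult; apply gder_id]|
    apply gder_mult; exact D]].
  cbv beta. field. exact N.
Qed.

Lemma LL_model om a b : (Cmod a < 1)%R -> (Cmod b < 1)%R ->
  LL om (fun t => 1 * (ker b t * ker b t * ker b t) * (1 - RtoC t * a)) =
  om * (1 - a) / ((1 - b) * (1 - b) * (1 - b)) - (1 - (a + b) / 2) / ((1 - b) * (1 - b)).
Proof.
  intros Ha Hb.
  assert (N : forall t, (0 <= t <= 1)%R -> 1 - b * RtoC t <> 0).
  { intros t Ht. rewrite Cmult_comm. apply ker_neq; assumption. }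
  unfold LL.
  replace (CInt (fun t => 1 * (ker b t * ker b t * ker b t) * (1 - RtoC t * a)) 0 1) with
    (koebe_ctc a b (RtoC 1) - koebe_ctc a b (RtoC 0)).
  - unfold koebe_ctc, ker. field. exact (one_sub_neq b Hb).
  - rewrite <- (CInt_FTC (fun t => koebe_ctc a b (RtoC t))
      (fun t => (1 - a * RtoC t) / ((1 - b * RtoC t) * (1 - b * RtoC t) * (1 - b * RtoC t)))).
    + apply CInt_ext. intros t Ht. rewrite Rmin_left, Rmax_right in Ht by lra. unfold ker.
      field. first [apply N; lra | rewrite Cmult_comm; apply N; lra].
    + intros t Ht. rewrite Rmin_left, Rmax_right in Ht by lra. apply (gder_koebe RtoC). apply N, Ht.
    + intros t Ht. rewrite Rmin_left, Rmax_right in Ht by lra.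
      assert (L : forall c, continuous (fun t => 1 - c * RtoC t) t).
      { intros c. apply cont_minus; [apply cont_const | apply cont_mult; [apply cont_const | apply cont_RtoC, continuous_id]]. }
      apply cont_div; [apply L | apply cont_mult; [apply cont_mult|]; apply L | repeat apply Cmult_neq_0; apply N, Ht].
Qed.

(* For given [v], the solution of [2 om u = v (u + v)] is [u = v^2 / (2 om - v)]. *)
Lemma solutions_closed (om : C) (r : R) : (0 < r < 1)%R ->
  (forall s, (r < s < 1)%R -> exists u v, (Cmod (u - 1) < s)%R /\ (Cmod (v - 1) < s)%R /\ 2 * om * u = v * (u + v)) ->
  exists u v, (Cmod (u - 1) <= r)%R /\ (Cmod (v - 1) <= r)%R /\ 2 * om * u = v * (u + v).
Proof.
  intros Hr H.
  assert (Vne : forall v, (Cmod (v - 1) < 1)%R -> v <> 0).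
  { intros v Hv E. rewrite E in Hv. replace (0 - 1) with (- (1)) in Hv by ring. rewrite Cmod_opp, Cmod_1 in Hv. lra. }
  (* For given [v], the condition on [u = v^2 / (2 om - v)] reads
     [|v^2 + v - 2 om| <= r |2 om - v|], so a single unknown remains. *)
  destruct (classic (exists v, (Cmod (v - 1) <= r)%R /\ (Cmod (v * v + v - 2 * om) <= r * Cmod (2 * om - v))%R)) as [[v [Hv Hle]]|Hno].
  - assert (N : 2 * om - v <> 0).
    { intros E. rewrite E, Cmod_0, Rmult_0_r in Hle.
      assert (E2 : v * v + v - 2 * om = 0) by (apply Cmod_eq_0; pose proof (Cmod_ge_0 (v * v + v - 2 * om)); lra).
      assert (E3 : v * v = 0).
      { transitivity ((v * v + v - 2 * om) + (2 * om - v)); [ring|]. rewrite E, E2. ring. }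
      assert (v <> 0) by (apply Vne; lra). apply (Cmult_neq_0 v v); assumption. }
    exists (v * v / (2 * om - v)), v. split; [|split; [exact Hv|]].
    + replace (v * v / (2 * om - v) - 1) with ((v * v + v - 2 * om) / (2 * om - v)) by (field; exact N).
      rewrite Cmod_div by exact N. apply Cmod_gt_0 in N.
      apply Rmult_le_reg_r with (Cmod (2 * om - v)); [exact N|].
      unfold Rdiv. rewrite Rmult_assoc, Rinv_l, Rmult_1_r by lra. exact Hle.
    + field. exact N.
  - exfalso.
    (* If no [v] works, every point has a neighbourhood of size [d] on which the two conditions fail
       even with [r] enlarged to [r + d]. Compactness of the square makes [d] uniform, against the
       solvability for all [s > r]. *)
    assert (Hd : forall x y : R, exists d : posreal, forall v : C,
      (Rabs (Re v - x) < d)%R -> (Rabs (Im v - y) < d)%R ->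
      ~ ((Cmod (v - 1) < r + d)%R /\ (Cmod (v * v + v - 2 * om) <= (r + d) * Cmod (2 * om - v))%R)).
    { intros x y. set (v0 := (x, y) : C).
      assert (Hdist : forall (v : C) d, (Rabs (Re v - x) < d)%R -> (Rabs (Im v - y) < d)%R -> (Cmod (v - v0) < 2 * d)%R).
      { intros v d H1 H2. eapply Rle_lt_trans; [apply Cmod_le_sum|].
        change (Rabs (Re v - x) + Rabs (Im v - y) < 2 * d)%R. lra. }
      destruct (Rle_dec (Cmod (v0 - 1)) r) as [Hin|Hout].
      - set (e := (Cmod (v0 * v0 + v0 - 2 * om) - r * Cmod (2 * om - v0))%R).
        assert (He : (0 < e)%R).
        { apply Rnot_le_lt. intros Hc. apply Hno. exists v0. split; [exact Hin | unfold e in Hc; lra]. }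
        pose proof (Cmod_ge_0 (2 * om)) as HO.
        (* The 21 exceeds 14 + 2 + 4: the changes of [v^2 + v] and of [r |2 om - v|], and the bound
           4 for [|v|] in [d |2 om - v|]. *)
        set (d := Rmin 1 (e / (21 + Cmod (2 * om)))).
        assert (Hdp : (0 < d)%R) by (apply Rmin_glb_lt; [lra | apply Rdiv_lt_0_compat; lra]).
        assert (Hd1 : (d <= 1)%R) by apply Rmin_l.
        assert (Hd2 : (d * (21 + Cmod (2 * om)) <= e)%R).
        { pose proof (Rmin_r 1 (e / (21 + Cmod (2 * om)))) as M. fold d in M.
          apply Rmult_le_compat_r with (r := (21 + Cmod (2 * om))%R) in M; [|lra].
          unfold Rdiv in M. rewrite Rmult_assoc, Rinv_l in M by lra. lra. }
        exists (mkposreal d Hdp). simpl. intros v H1 H2 [_ H4].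
        pose proof (Hdist v d H1 H2) as D.
        assert (V0 : (Cmod v0 <= 2)%R).
        { pose proof (Cmod_triangle (v0 - 1) 1) as T. replace (v0 - 1 + 1) with v0 in T by ring. rewrite Cmod_1 in T. lra. }
        assert (V1 : (Cmod v <= 4)%R).
        { pose proof (Cmod_triangle (v - v0) v0) as T. replace (v - v0 + v0) with v in T by ring. lra. }
        assert (A1 : (Cmod (v0 * v0 + v0 - 2 * om) <= Cmod (v * v + v - 2 * om) + 14 * d)%R).
        { replace (v0 * v0 + v0 - 2 * om) with ((v * v + v - 2 * om) - (v - v0) * (v + v0 + 1)) by ring.
          eapply Rle_trans; [apply Cmod_triangle_sub|]. rewrite Cmod_mult.
          assert (Cmod (v + v0 + 1) <= 7)%R.
          { pose proof (Cmod_triangle (v + v0) 1). pose proof (Cmod_triangle v v0). rewrite Cmod_1 in *. lra. }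
          pose proof (Cmod_ge_0 (v - v0)). pose proof (Cmod_ge_0 (v + v0 + 1)). nra. }
        assert (A2 : (Cmod (2 * om - v) <= Cmod (2 * om - v0) + 2 * d)%R).
        { replace (2 * om - v) with ((2 * om - v0) - (v - v0)) by ring.
          eapply Rle_trans; [apply Cmod_triangle_sub|]. lra. }
        assert (A3 : (Cmod (2 * om - v) <= Cmod (2 * om) + 4)%R).
        { eapply Rle_trans; [apply Cmod_triangle_sub|]. lra. }
        assert (r * Cmod (2 * om - v) <= r * Cmod (2 * om - v0) + 2 * d)%R by nra.
        assert (d * Cmod (2 * om - v) <= d * (Cmod (2 * om) + 4))%R by (apply Rmult_le_compat_l; lra).
        unfold e in Hd2. lra.
      - assert (Hdp : (0 < (Cmod (v0 - 1) - r) / 4)%R) by lra.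
        exists (mkposreal _ Hdp). simpl. intros v H1 H2 [H3 _].
        pose proof (Hdist v _ H1 H2) as D. rewrite Cmod_sub_sym in D.
        pose proof (Cmod_triangle (v0 - v) (v - 1)) as T. replace (v0 - v + (v - 1)) with (v0 - 1) in T by ring. lra. }
    pose (delta := fun x y => proj1_sig (constructive_indefinite_description _ (Hd x y))).
    assert (Hdelta : forall x y (v : C), (Rabs (Re v - x) < delta x y)%R -> (Rabs (Im v - y) < delta x y)%R ->
      ~ ((Cmod (v - 1) < r + delta x y)%R /\ (Cmod (v * v + v - 2 * om) <= (r + delta x y) * Cmod (2 * om - v))%R)).
    { intros x y. exact (proj2_sig (constructive_indefinite_description _ (Hd x y))). }
    destruct (compactness_value_2d 0 2 (-1) 1 delta) as [d Hdd].
    pose proof (cond_pos d) as Hdp.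
    set (s := Rmin (r + d) ((1 + r) / 2)).
    assert (Hs : (r < s)%R) by (apply Rmin_glb_lt; lra).
    assert (Hs1 : (s <= r + d)%R) by apply Rmin_l.
    assert (Hs2 : (s <= (1 + r) / 2)%R) by apply Rmin_r.
    destruct (H s ltac:(lra)) as [u [v [Hu [Hv E]]]].
    pose proof (re_le_Cmod (v - 1)) as B1. pose proof (im_le_Cmod (v - 1)) as B2.
    replace (Re (v - 1)) with (Re v - 1)%R in B1 by reflexivity.
    replace (Im (v - 1)) with (Im v) in B2 by (unfold Im; simpl; ring).
    assert (B1' : (Rabs (Re v - 1) <= 1)%R) by lra. apply Rabs_le_between in B1'.
    assert (B2' : (Rabs (Im v) <= 1)%R) by lra. apply Rabs_le_between in B2'.
    apply (Hdd (Re v) (Im v)); [lra|lra|].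
    intros [x [y [_ [_ [H1 [H2 H3]]]]]].
    apply (Hdelta x y v H1 H2). split; [lra|].
    replace (v * v + v - 2 * om) with ((u - 1) * (2 * om - v)).
    + rewrite Cmod_mult. apply Rmult_le_compat_r; [apply Cmod_ge_0 | lra].
    + transitivity (2 * om * u - v * (u + v) + (v * v + v - 2 * om)); [ring|]. rewrite E. ring.
Qed.

Lemma close_to_convex_region f r : (0 < r < 1)%R -> close_to_convex f ->
  exists u v : C, (Cmod (u - 1) <= r)%R /\ (Cmod (v - 1) <= r)%R /\
    RtoC r * C_derive f (RtoC r) / f (RtoC r) = 2 * u / (v * (u + v)).
Proof.
  intros Hr [Haf [[f0 f1] [g [lam [[Hag [[g0 g1] [Hgu Hgc]]] [_ Hre]]]]]].
  pose proof (analytic_holo f Haf) as Hf. pose proof (analytic_holo g Hag) as Hg.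
  destruct (holo_derive f 1 Hf) as [df [Hdf Hdfh]].
  destruct (holo_derive g 1 Hg) as [dg [Hdg Hdgh]].
  destruct (holo_derive dg 1 Hdgh) as [ddg [Hddg Hddgh]].
  assert (Edf : forall z, (Cmod z < 1)%R -> C_derive f z = df z) by (intros z Hz; apply cder_derive, Hdf, Hz).
  assert (Edg : forall z, (Cmod z < 1)%R -> C_derive g z = dg z) by (intros z Hz; apply cder_derive, Hdg, Hz).
  assert (Hpos : forall z, (Cmod z < 1)%R -> (0 < Re (expi lam * (df z / dg z))%C)%R).
  { intros z Hz. rewrite <- Edf, <- Edg by exact Hz. apply Hre, Hz. }
  (* A zero of [g'] would make the totalized quotient [f' / g'] equal to 0, against the strict
     inequality in the definition of the class. *)
  assert (Ndg : forall z, (Cmod z < 1)%R -> dg z <> 0).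
  { intros z Hz E. specialize (Hpos z Hz). rewrite E in Hpos. unfold Cdiv in Hpos.
    rewrite Cinv_0, !Cmult_0_r in Hpos. simpl in Hpos. lra. }
  assert (Ndf : forall z, (Cmod z < 1)%R -> df z <> 0).
  { intros z Hz E. specialize (Hpos z Hz). rewrite E in Hpos. unfold Cdiv in Hpos.
    rewrite Cmult_0_l, Cmult_0_r in Hpos. simpl in Hpos. lra. }
  assert (Hconv : forall z, (Cmod z < 1)%R -> (0 <= Re (1 + z * ddg z / dg z)%C)%R).
  { intros z Hz. apply (convex_Re_nonneg g dg ddg z); auto. }
  assert (Z0 : (Cmod 0 < 1)%R) by (rewrite Cmod_0; lra).
  assert (Edg0 : dg 0 = 1).
  { rewrite <- (Edg 0 Z0). apply Ceq_minus, g1. }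
  assert (Hsc : forall z, (Cmod z < 1 / r)%R -> (Cmod (RtoC r * z) < 1)%R).
  { intros z Hz. rewrite Cmod_mult, Cmod_R, Rabs_pos_eq by lra.
    apply Rmult_lt_compat_l with (r := r) in Hz; [|lra].
    unfold Rdiv in Hz. rewrite Rmult_1_l, Rinv_r in Hz by lra. exact Hz. }
  assert (Hscale : forall F, holo F 1 -> holo (fun z => F (RtoC r * z)) (1 / r)).
  { intros F HF. apply (holo_comp F (fun z => RtoC r * z) (1 / r) 1); [|exact Hsc|exact HF].
    apply holo_mult; [apply holo_const | apply holo_id]. }
  assert (Hrpos : (0 < 1 / r)%R) by (apply Rdiv_lt_0_compat; lra).
  (* Rescaling by [r] moves the evaluation point to 1 and provides holomorphy on the disc of radius
     [1 / r], which leaves room for contours outside the unit circle. *)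
  pose (F := fun z => dg (RtoC r * z)). pose (F1 := fun z => RtoC r * ddg (RtoC r * z)).
  pose (p := fun z => df (RtoC r * z) / dg (RtoC r * z)).
  assert (HF : forall z, (Cmod z < 1 / r)%R -> cder F z (F1 z)).
  { intros z Hz. unfold F, F1. eapply gder_eq; [|apply (gder_comp _ (fun z => RtoC r * z) dg); [apply cder_scal | apply Hddg, Hsc, Hz]].
    ring. }
  assert (HF1 : holo F1 (1 / r)).
  { apply holo_mult; [apply holo_const | apply Hscale, Hddgh]. }
  assert (HN : forall z, (Cmod z < 1 / r)%R -> F z <> 0) by (intros z Hz; apply Ndg, Hsc, Hz).
  destruct (holo_sqrt F F1 (1 / r) Hrpos HF HF1 HN) as [G HG].
  { unfold F. rewrite Cmult_0_r. exact Edg0. }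
  assert (Hrr : (Cmod (RtoC r) < 1)%R) by (rewrite Cmod_R, Rabs_pos_eq; lra).
  assert (r0 : RtoC r <> 0) by (apply RtoC_neq; lra).
  pose proof (Ndf _ Hrr) as Nr.
  set (om := f (RtoC r) / (RtoC r * df (RtoC r))).
  assert (HL : LL om (fun t => F (RtoC t) * p (RtoC t)) = 0).
  { rewrite (LL_ext om _ (fun t => / RtoC r * (RtoC r * df (RtoC r * RtoC t)))).
    2:{ intros t Ht. unfold F, p.
        assert (dg (RtoC r * RtoC t) <> 0).
        { apply Ndg. rewrite Cmod_mult, !Cmod_R, !Rabs_pos_eq by lra. nra. }
        field. split; assumption. }
    assert (Hseg : forall t, (0 <= t <= 1)%R -> (Cmod (RtoC r * RtoC t) < 1)%R).
    { intros t Ht. rewrite Cmod_mult, !Cmod_R, !Rabs_pos_eq by lra. nra. }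
    assert (Hct : con (fun t => RtoC r * df (RtoC r * RtoC t)) 0 1).
    { intros t Ht. rewrite Rmin_left, Rmax_right in Ht by lra. apply cont_mult; [apply cont_const|].
      apply (continuous_comp (fun t => RtoC r * RtoC t) df).
      - apply cont_mult; [apply cont_const | apply cont_RtoC, continuous_id].
      - eapply holo_cont; [exact Hdfh | apply Hseg, Ht]. }
    rewrite LL_scal by exact Hct. unfold LL.
    rewrite (CInt_FTC (fun t => f (RtoC r * RtoC t))); [|intros t Ht|exact Hct].
    - rewrite Cmult_1_r, Cmult_0_r, f0. unfold om. field. split; assumption.
    - rewrite Rmin_left, Rmax_right in Ht by lra.
      eapply gder_eq; [|apply (gder_comp RtoC (fun t => RtoC r * RtoC t) f); [apply gder_scal, gder_id | apply Hdf, Hseg, Ht]].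
      ring. }
  destruct (solutions_closed om r Hr) as [u [v [Hu [Hv E]]]].
  { intros s Hs.
    destruct (classic (exists a b, (Cmod a < s)%R /\ (Cmod b < s)%R /\
       LL om (fun t => 1 * (ker b t * ker b t * ker b t) * (1 - RtoC t * a)) = 0)) as [[a [b [Ha [Hb E]]]]|Hno].
    - exists (1 - a), (1 - b).
      split; [replace (1 - a - 1) with (- a) by ring; rewrite Cmod_opp; exact Ha|].
      split; [replace (1 - b - 1) with (- b) by ring; rewrite Cmod_opp; exact Hb|].
      rewrite LL_model in E by lra.
      assert (Nb : 1 - b <> 0) by (apply one_sub_neq; lra).
      apply Ceq_minus.
      transitivity ((2 * (1 - b) * (1 - b) * (1 - b)) *
        (om * (1 - a) / ((1 - b) * (1 - b) * (1 - b)) - (1 - (a + b) / 2) / ((1 - b) * (1 - b)))).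
      + field. exact Nb.
      + rewrite E. ring.
    - exfalso. apply (close_to_convex_functional om r s F F1 G p (expi lam)) in HL; auto; try lra.
      + intros z Hz. unfold F, F1. specialize (Hconv _ (Hsc z Hz)).
        replace (z * (RtoC r * ddg (RtoC r * z)) / dg (RtoC r * z)) with (RtoC r * z * ddg (RtoC r * z) / dg (RtoC r * z));
          [exact Hconv | unfold Cdiv; ring].
      + apply holo_div; [apply Hscale, Hdfh | apply Hscale, Hdgh | exact HN].
      + intros z Hz. apply Hpos, Hsc, Hz.
      + intros a b Ha Hb Ec. apply Hno. exists a, b. auto. }
  exists u, v. split; [exact Hu|]. split; [exact Hv|].
  rewrite (Edf _ Hrr).
  assert (Hne : forall x, (Cmod (x - 1) <= r)%R -> (0 < Re x)%R).
  { intros x Hx. pose proof (re_le_Cmod (x - 1)) as B. replace (Re (x - 1)) with (Re x - 1)%R in B by reflexivity.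
    assert (B' : (Rabs (Re x - 1) <= r)%R) by lra. apply Rabs_le_between in B'. lra. }
  assert (u0 : u <> 0) by (intros Ez; specialize (Hne u Hu); rewrite Ez in Hne; simpl in Hne; lra).
  assert (v0 : v <> 0) by (intros Ez; specialize (Hne v Hv); rewrite Ez in Hne; simpl in Hne; lra).
  assert (uv0 : u + v <> 0).
  { intros Ez. pose proof (Hne u Hu). pose proof (Hne v Hv). apply (f_equal Re) in Ez. rewrite re_plus in Ez. simpl in Ez. unfold Re in *. lra. }
  (* If [f r] were 0, then [om = 0] and the equation would give [v (u + v) = 0], although [u] and
     [v] have positive real parts. *)
  assert (fr0 : f (RtoC r) <> 0).
  { intros Ez. assert (Q : v * (u + v) = 0) by (rewrite <- E; unfold om; rewrite Ez; unfold Cdiv; ring).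
    apply (Cmult_neq_0 v (u + v)); assumption. }
  rewrite <- E. unfold om. field. repeat split; auto.
Qed.

(** * The functions that fill the region *)

(** The inverse map is [w / (1 + y w)], so the image is the set [|w| < |1 + y w|], a half-plane for
    [|y| = 1] and a disc otherwise. It is convex because [|1 + y w|^2 - |w|^2] is concave in [w]
    when [|y| <= 1]. *)
Lemma half_plane_convex y : (Cmod y <= 1)%R -> convex_function (fun z => z / (1 - y * z)).
Proof.
  intros Hy. pose proof (Cmod_ge_0 y) as Hy0.
  assert (N : forall z, (Cmod z < 1)%R -> 1 - y * z <> 0).
  { intros z Hz. apply one_minus_neq. pose proof (Cmod_ge_0 z). nra. }
  assert (D : forall z, (Cmod z < 1)%R -> cder (fun z => z / (1 - y * z)) z (1 / ((1 - y * z) * (1 - y * z)))).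
  { intros z Hz. eapply gder_eq; [|apply gder_div; [apply N, Hz | apply gder_id |
      apply gder_minus; [apply gder_const | apply cder_scal]]].
    cbv beta. field. apply N, Hz. }
  split; [|split; [|split]].
  - apply holo_analytic. intros z Hz. eexists. apply D, Hz.
  - assert (Z0 : (Cmod 0 < 1)%R) by (rewrite Cmod_0; lra). split.
    + unfold Cdiv. ring.
    + rewrite (cder_derive _ _ _ (D 0 Z0)). field; apply N, Z0.
  - intros z w Hz Hw E.
    assert (E2 : z * (1 - y * w) = w * (1 - y * z)).
    { transitivity (z / (1 - y * z) * ((1 - y * z) * (1 - y * w))); [field; apply N, Hz|].
      rewrite E. field. apply N, Hw. }
    transitivity (z * (1 - y * w) + y * z * w); [ring|]. rewrite E2. ring.
  - assert (Char : forall w, image_of_disk (fun z => z / (1 - y * z)) w <-> (Cmod w < Cmod (1 + y * w))%R).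
    { intros w. split.
      - intros [z [Hz <-]]. specialize (N z Hz).
        replace (1 + y * (z / (1 - y * z))) with (/ (1 - y * z)) by (field; exact N).
        unfold Cdiv. rewrite Cmod_mult. rewrite <- (Rmult_1_l (Cmod (/ _))) at 2.
        apply Rmult_lt_compat_r; [|exact Hz]. rewrite Cmod_inv by exact N.
        apply Rinv_0_lt_compat, Cmod_gt_0, N.
      - intros Hw. pose proof (Cmod_ge_0 w).
        assert (Nw : 1 + y * w <> 0) by (apply Cmod_gt_0; lra).
        exists (w / (1 + y * w)). split.
        + unfold unit_disk. rewrite Cmod_div by exact Nw. apply Rmult_lt_reg_r with (Cmod (1 + y * w)); [lra|].
          unfold Rdiv. rewrite Rmult_assoc, Rinv_l by lra. lra.
        + assert (N1 : 1 + y * w - y * w <> 0).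
          { replace (1 + y * w - y * w) with (RtoC 1) by ring. intros E. injection E. lra. }
          field. split; assumption. }
    intros a b t Ha Hb Ht. apply Char in Ha. apply Char in Hb. apply Char.
    assert (Sq : forall w, (Cmod w < Cmod (1 + y * w))%R <-> (Cmod w * Cmod w < Cmod (1 + y * w) * Cmod (1 + y * w))%R).
    { intros w. pose proof (Cmod_ge_0 w). pose proof (Cmod_ge_0 (1 + y * w)). split; intros; nra. }
    apply Sq in Ha. apply Sq in Hb. apply Sq. rewrite !Cmod_sqr in *.
    assert (Y : (Re y * Re y + Im y * Im y <= 1)%R) by (rewrite <- Cmod_sqr; nra).
    destruct a as [a1 a2], b as [b1 b2], y as [y1 y2]. unfold Re, Im in *. simpl in *.
    (* The exact gap in the concavity inequality for [|1 + y w|^2 - |w|^2] between [a] and [b]. *)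
    assert (P : (0 <= t * (1 - t) * ((1 - (y1 * y1 + y2 * y2)) * ((a1 - b1) * (a1 - b1) + (a2 - b2) * (a2 - b2))))%R).
    { apply Rmult_le_pos; [apply Rmult_le_pos; lra|]. apply Rmult_le_pos; [lra|].
      pose proof (Rle_0_sqr (a1 - b1)) as Q1. pose proof (Rle_0_sqr (a2 - b2)) as Q2. unfold Rsqr in Q1, Q2. lra. }
    assert (Pa : (0 <= (1 - t) * ((1 + (y1 * a1 - y2 * a2)) * (1 + (y1 * a1 - y2 * a2)) +
       (0 + (y1 * a2 + y2 * a1)) * (0 + (y1 * a2 + y2 * a1)) - (a1 * a1 + a2 * a2)))%R) by (apply Rmult_le_pos; lra).
    assert (Pb : (0 <= t * ((1 + (y1 * b1 - y2 * b2)) * (1 + (y1 * b1 - y2 * b2)) +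
       (0 + (y1 * b2 + y2 * b1)) * (0 + (y1 * b2 + y2 * b1)) - (b1 * b1 + b2 * b2)))%R) by (apply Rmult_le_pos; lra).
    destruct (Req_dec t 0) as [->|Ht0].
    + ring_simplify. ring_simplify in Ha. lra.
    + assert (Pb' : (0 < t * ((1 + (y1 * b1 - y2 * b2)) * (1 + (y1 * b1 - y2 * b2)) +
       (0 + (y1 * b2 + y2 * b1)) * (0 + (y1 * b2 + y2 * b1)) - (b1 * b1 + b2 * b2)))%R) by (apply Rmult_lt_0_compat; lra).
      lra.
Qed.

(** For [|y| < 1] the quotient [(1 - x z) / (1 - y z)] maps the disc onto a disc (or a point)
    centred at [(1 - x conj y) / (1 - |y|^2)]. Multiplication by [1 - conj x y] rotates this centre
    onto the positive axis, and the image does not contain 0. *)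
Lemma half_plane_quotient_pos x y z : (Cmod x <= 1)%R -> (Cmod y <= 1)%R -> (Cmod z < 1)%R ->
  1 - Cconj x * y <> 0 -> (0 < Re ((1 - Cconj x * y) * ((1 - x * z) * Cconj (1 - y * z))))%R.
Proof.
  intros Hx Hy Hz HA.
  pose proof (Cmod_ge_0 x) as Hx0. pose proof (Cmod_ge_0 y) as Hy0. pose proof (Cmod_ge_0 z) as Hz0.
  set (a := Cmod x) in *. set (b := Cmod y) in *. set (s := Cmod z) in *.
  set (c := Re (Cconj x * y)).
  assert (E : Re ((1 - Cconj x * y) * ((1 - x * z) * Cconj (1 - y * z))) =
    (1 - (a * a) * (b * b) * (s * s) - (1 - s * s) * c - Re (z * x) * (1 - b * b) - Re (z * y) * (1 - a * a))%R).
  { unfold a, b, s, c. rewrite !Cmod_sqr. destruct x, y, z. unfold Re, Im. simpl. ring. }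
  rewrite E.
  assert (B1 : (Re (z * x) <= s * a)%R).
  { unfold s, a. rewrite <- Cmod_mult. eapply Rle_trans; [apply Rle_abs | apply re_le_Cmod]. }
  assert (B2 : (Re (z * y) <= s * b)%R).
  { unfold s, b. rewrite <- Cmod_mult. eapply Rle_trans; [apply Rle_abs | apply re_le_Cmod]. }
  assert (Bc : (c <= a * b)%R).
  { unfold c, a, b. rewrite <- (Cmod_conj x), <- Cmod_mult. eapply Rle_trans; [apply Rle_abs | apply re_le_Cmod]. }
  assert (Hc1 : (c < 1)%R).
  { apply Rnot_le_lt. intros Hc. apply HA.
    assert (M : (Cmod (Cconj x * y) <= 1)%R) by (rewrite Cmod_mult, Cmod_conj; fold a b; nra).
    pose proof (Cmod_sqr (Cconj x * y)) as S. pose proof (Cmod_ge_0 (Cconj x * y)). fold c in S.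
    assert (I0 : Im (Cconj x * y) = 0%R) by nra. assert (C1 : c = 1%R) by nra.
    apply injective_projections.
    - change (1 - Re (Cconj x * y) = 0)%R. fold c. lra.
    - change (0 - Im (Cconj x * y) = 0)%R. rewrite I0. ring. }
  assert (T1 : (Re (z * x) * (1 - b * b) <= s * a * (1 - b * b))%R) by (apply Rmult_le_compat_r; nra).
  assert (T2 : (Re (z * y) * (1 - a * a) <= s * b * (1 - a * a))%R) by (apply Rmult_le_compat_r; nra).
  assert (Hss : (0 < 1 - s * s)%R) by nra.
  (* The product bound used below degenerates only for [|x| = |y| = 1], where the expression is
     [(1 - s^2) (1 - c)] with [c < 1]. *)
  destruct (Req_dec (a * b) 1) as [Hab|Hab].
  - assert (a = 1%R) by nra. assert (b = 1%R) by nra.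
    replace a with 1%R in * by lra. replace b with 1%R in * by lra. nra.
  - assert (Hab' : (0 < 1 - a * b)%R) by nra.
    assert (T3 : ((1 - s * s) * c <= (1 - s * s) * (a * b))%R) by (apply Rmult_le_compat_l; lra).
    (* Replacing [Re (z x)], [Re (z y)] and [c] by their upper bounds turns the expression into
       exactly this product. *)
    assert (P : (0 < (1 - a * b) * ((1 - s * a) * (1 - s * b)))%R).
    { apply Rmult_lt_0_compat; [exact Hab'|]. apply Rmult_lt_0_compat; nra. }
    nra.
Qed.

Lemma exists_rotation (A : C) : (0 < Re A)%R -> exists (lam c : R), (Rabs lam < PI / 2)%R /\ (0 < c)%R /\
  expi lam = RtoC c * A.
Proof.
  intros HA. set (q := (Im A / Re A)%R).
  assert (Hq : (0 < 1 + q²)%R) by (pose proof (Rle_0_sqr q); lra).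
  assert (Hs : (0 < sqrt (1 + q²))%R) by (apply sqrt_lt_R0; exact Hq).
  exists (atan q), (1 / sqrt (1 + q²) / Re A)%R. split; [|split].
  - pose proof (atan_bound q). apply Rabs_def1; lra.
  - repeat apply Rdiv_lt_0_compat; lra.
  - unfold expi. rewrite cos_atan, sin_atan. unfold q at 2. destruct A as [A1 A2]. unfold Re, Im in *. simpl in *.
    apply injective_projections; simpl; field; lra.
Qed.

Lemma koebe_close_to_convex x y : (Cmod x <= 1)%R -> (Cmod y <= 1)%R -> close_to_convex (koebe_ctc x y).
Proof.
  intros Hx Hy. pose proof (Cmod_ge_0 y) as Hy0. pose proof (Cmod_ge_0 x) as Hx0.
  assert (N : forall z, (Cmod z < 1)%R -> 1 - y * z <> 0).
  { intros z Hz. apply one_minus_neq. pose proof (Cmod_ge_0 z). nra. }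
  assert (Nx : forall z, (Cmod z < 1)%R -> 1 - x * z <> 0).
  { intros z Hz. apply one_minus_neq. pose proof (Cmod_ge_0 z). nra. }
  assert (D : forall z, (Cmod z < 1)%R -> cder (koebe_ctc x y) z ((1 - x * z) / ((1 - y * z) * (1 - y * z) * (1 - y * z)))).
  { intros z Hz. apply (gder_koebe (fun z => z)). apply N, Hz. }
  assert (Dg : forall z, (Cmod z < 1)%R -> C_derive (fun z => z / (1 - y * z)) z = 1 / ((1 - y * z) * (1 - y * z))).
  { intros z Hz. apply cder_derive. eapply gder_eq; [|apply gder_div; [apply N, Hz | apply gder_id |
      apply gder_minus; [apply gder_const | apply cder_scal]]].
    cbv beta. field. apply N, Hz. }
  assert (Q : forall z, (Cmod z < 1)%R -> C_derive (koebe_ctc x y) z / C_derive (fun z => z / (1 - y * z)) z = (1 - x * z) / (1 - y * z)).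
  { intros z Hz. rewrite (cder_derive _ _ _ (D z Hz)), Dg by exact Hz. field. apply N, Hz. }
  assert (Z0 : (Cmod 0 < 1)%R) by (rewrite Cmod_0; lra).
  split; [|split; [split|]].
  - apply holo_analytic. intros z Hz. eexists. apply D, Hz.
  - unfold koebe_ctc, Cdiv. ring.
  - rewrite (cder_derive _ _ _ (D 0 Z0)). field; apply N, Z0.
  - exists (fun z => z / (1 - y * z)).
    destruct (Ceq_dec (1 - Cconj x * y) 0) as [HA|HA].
    (* Here [conj x y = 1], so [x = y] lies on the unit circle and the derivative quotient is
       identically 1. *)
    + exists 0%R. split; [apply half_plane_convex, Hy|]. split; [rewrite Rabs_R0; pose proof PI_RGT_0; lra|].
      intros z Hz. rewrite Q by exact Hz.
      assert (Exy : x = y).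
      { assert (E1 : Cconj x * y = 1) by (symmetry; apply Ceq_minus; exact HA).
        assert (M : (Cmod x * Cmod y = 1)%R) by (rewrite <- (Cmod_conj x), <- Cmod_mult, E1; apply Cmod_1).
        assert (Mx : (Cmod x = 1)%R) by nra.
        transitivity (x * (Cconj x * y)); [rewrite E1; ring|].
        transitivity (x * Cconj x * y); [ring|]. rewrite Cmod_sqr_conj, Mx, Rmult_1_r. ring. }
      rewrite Exy, expi_0. replace (1 * ((1 - y * z) / (1 - y * z))) with (RtoC 1) by (field; apply N, Hz).
      simpl. lra.
    (* The angle [lam] is the argument of [1 - conj x y], whose real part is seen to be positive by
       taking [z = 0]. *)
    + assert (HAr : (0 < Re (1 - Cconj x * y))%R).
      { pose proof (half_plane_quotient_pos x y 0 Hx Hy Z0 HA) as P. rewrite !Cmult_0_r in P.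
        replace ((1 - Cconj x * y) * ((1 - 0) * Cconj (1 - 0))) with (1 - Cconj x * y) in P; [exact P|].
        replace (1 - 0) with (RtoC 1) by ring. rewrite Cconj_RtoC. ring. }
      destruct (exists_rotation _ HAr) as [lam [c [Hl [Hc El]]]].
      exists lam. split; [apply half_plane_convex, Hy|]. split; [exact Hl|].
      intros z Hz. rewrite Q, El by exact Hz.
      replace (RtoC c * (1 - Cconj x * y) * ((1 - x * z) / (1 - y * z))) with
        (RtoC c * (((1 - Cconj x * y) * (1 - x * z)) / (1 - y * z))) by (unfold Cdiv; ring).
      rewrite re_scal_l. apply Rmult_lt_0_compat; [exact Hc|].
      rewrite Re_div by (apply N, Hz). apply Rdiv_lt_0_compat.
      * rewrite <- Cmult_assoc. apply half_plane_quotient_pos; assumption.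
      * pose proof (N z Hz) as Nz. apply Cmod_gt_0 in Nz. apply Rmult_lt_0_compat; assumption.
Qed.

Theorem theorem1p5 :
  forall r : R, (0 < r < 1)%R ->
    forall w : C,
      W r w <->
      exists u v : C,
        (Cmod (u - 1) <= r)%R /\ (Cmod (v - 1) <= r)%R /\
        w = 2 * u / (v * (u + v)).
Proof.
  intros r Hr w. split.
  - intros [f [Hf ->]]. apply close_to_convex_region; assumption.
  - intros [u [v [Hu [Hv ->]]]].
    assert (r0 : RtoC r <> 0) by (apply RtoC_neq; lra).
    assert (B : forall u, (Cmod (u - 1) <= r)%R -> (Cmod ((1 - u) / RtoC r) <= 1)%R).
    { intros x Hx. rewrite Cmod_div, Cmod_R, Rabs_pos_eq, Cmod_sub_sym by (auto; lra).
      apply Rmult_le_reg_r with r; [lra|]. unfold Rdiv. rewrite Rmult_assoc, Rinv_l by lra. lra. }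
    assert (Hne : forall x, (Cmod (x - 1) <= r)%R -> (0 < Re x)%R).
    { intros x Hx. pose proof (re_le_Cmod (x - 1)) as Bx. replace (Re (x - 1)) with (Re x - 1)%R in Bx by reflexivity.
      assert (B' : (Rabs (Re x - 1) <= r)%R) by lra. apply Rabs_le_between in B'. lra. }
    assert (v0 : v <> 0) by (intros Ez; specialize (Hne v Hv); rewrite Ez in Hne; simpl in Hne; lra).
    assert (uv0 : u + v <> 0).
    { intros Ez. pose proof (Hne u Hu). pose proof (Hne v Hv). apply (f_equal Re) in Ez. rewrite re_plus in Ez. simpl in Ez. unfold Re in *. lra. }
    (* Chosen so that [1 - x z] and [1 - y z] become [u] and [v] at [z = r]; then
       [f(r) = r (u + v) / (2 v^2)] and [f'(r) = u / v^3]. *)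
    set (x := (1 - u) / RtoC r). set (y := (1 - v) / RtoC r).
    exists (koebe_ctc x y). split; [apply koebe_close_to_convex; apply B; assumption|].
    assert (Ex : 1 - x * RtoC r = u) by (unfold x; field; exact r0).
    assert (Ey : 1 - y * RtoC r = v) by (unfold y; field; exact r0).
    assert (Ny : 1 - y * RtoC r <> 0) by (rewrite Ey; exact v0).
    rewrite (cder_derive (koebe_ctc x y) (RtoC r) _ (gder_koebe (fun z => z) x y (RtoC r) Ny)).
    unfold koebe_ctc. rewrite Ex, Ey.
    replace (RtoC r - (x + y) / 2 * (RtoC r * RtoC r)) with (RtoC r * ((u + v) / 2)).
    2:{ rewrite <- Ex, <- Ey. field. }
    field. repeat split; auto.
Qed.
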